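(* Let $n\ge 1$, $s\ge1$, $P(x)=\sum_{j=1}^n(x_j^2-x_{n+j}^2)$ on $\mathbb R^{2n}$, and let $K_{0,s}\in\mathcal S'(\mathbb R^{2n+s})$ be the tempered distribution $$K_{0,s}(\varphi)=\int_{\mathbb R^{2n+s}} q(\xi,\vartheta)\,[\mathcal F\varphi](\xi,\vartheta)\,d\xi\,d\vartheta,\qquad q(\xi,\vartheta)=\frac{i}{(2\pi)^{n+\frac s2}}\int_0^\infty \frac{1}{|\vartheta|\cosh^n t}\exp\Big\{ i\,\frac{\tanh t}{|\vartheta|}\,P(\xi)\Big\}\,dt .$$ Then the singular support of $K_{0,s}$ is contained in $$\big\{(x,z)\in\mathbb R^{2n}\times\mathbb R^{s}:\ |P(x)|\le 4|z|\big\}.$$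
   Context: Fourier transform on $\mathbb R^d$: $[\mathcal F\varphi](\xi)=(2\pi)^{-d/2}\int\varphi(x)e^{-ix\cdot\xi}dx$. $|z|$ is the Euclidean norm. The function $q$ (defined for $\vartheta\ne0$) is integrable against $(1+|\xi|^2+|\vartheta|^2)^{-N}$ for $N$ large, so $K_{0,s}$ is well defined. The singular support is the complement of the largest open set on which the distribution is given by a $C^\infty$ function. ($K_{0,s}$ is a fundamental solution of the ultra-hyperbolic operator $\Delta_{0,s}$ on the pseudo $H$-type group $G_{0,s}\cong\mathbb R^{2n+s}$; this is not needed to parse the statement.) *)

(* Defs.v *)
From HB Require Import structures.
From mathcomp Require Import all_boot all_order all_algebra.
From mathcomp Require Import all_classical all_reals all_analysis.
From mathcomp Require Import complex.
Import Order.TTheory GRing.Theory Num.Theory.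
Import numFieldNormedType.Exports.

Set Implicit Arguments.
Unset Strict Implicit.
Unset Printing Implicit Defensive.

Local Open Scope classical_set_scope.
Local Open Scope complex_scope.
Local Open Scope ring_scope.

(* 'rV[R]_m carries the sigma-algebra generated by the coordinates (i.e. the
   Borel one), presented as the library does for n.-tuple. *)

Definition measure_rV_display : measure_display.
Proof. exact: default_measure_display. Qed.

Section measurable_rV.
Context {R : realType}.
Variable m : nat.

Let coors : 'I_m -> 'rV[R]_m -> measurableTypeR R := fun i x => x ord0 i.

Let rV_set0 : g_sigma_preimage coors set0.
Proof. exact: sigma_algebra0. Qed.

Let rV_setC A : g_sigma_preimage coors A -> g_sigma_preimage coors (~` A).
Proof. exact: sigma_algebraC. Qed.

Let rV_bigcup (F : _^nat) : (forall i, g_sigma_preimage coors (F i)) ->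
  g_sigma_preimage coors (\bigcup_i (F i)).
Proof. exact: sigma_algebra_bigcup. Qed.

HB.instance Definition _ := @isMeasurable.Build measure_rV_display
  'rV[R]_m (g_sigma_preimage coors) rV_set0 rV_setC rV_bigcup.

End measurable_rV.

Section lebesgue_rV.
Context {R : realType}.
Local Notation R' := (measurableTypeR R).

Lemma measurable_coord m (i : 'I_m) :
  measurable_fun [set: 'rV[R]_m] (fun x => x ord0 i : R').
Proof.
move=> _ Y mY; rewrite setTI; apply: sub_sigma_algebra => /=.
rewrite -bigcup_seq/=; exists i => /=; first by rewrite mem_index_enum.
by exists Y => //; rewrite setTI.
Qed.

Lemma measurable_fun_rV d (T : measurableType d) m (f : T -> 'rV[R]_m) :
  (forall i, measurable_fun setT (fun t => f t ord0 i : R')) ->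
  measurable_fun setT f.
Proof.
move=> mf _ A mA; rewrite setTI.
suff : preimage_set_system setT f
    (g_sigma_preimage (fun i (x : 'rV[R]_m) => x ord0 i : R')) `<=` measurable.
  by apply; exists A => //; rewrite setTI.
rewrite -g_sigma_preimage_comp; apply: smallest_sub.
  exact: sigma_algebra_measurable.
case: m => [|m] in f mf A mA *; first by rewrite big_ord0.
rewrite -bigcup_mkord_ord; apply: bigcup_sub => i Ii.
by move=> B [C mC <-]; exact: mf.
Qed.

Definition cons_rV m (p : R' * 'rV[R]_m) : 'rV[R]_m.+1 := row_mx p.1%:M p.2.

Definition uncons_rV m (v : 'rV[R]_m.+1) : R' * 'rV[R]_m :=
  (v ord0 ord0, @rsubmx R 1 1 m v).

Lemma cons_rVK m : cancel (@cons_rV m) (@uncons_rV m).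
Proof.
move=> [a v]; rewrite /uncons_rV /cons_rV /= row_mxKr; congr pair.
have -> : ord0 = lshift m ord0 :> 'I_(1 + m) by apply/val_inj.
by rewrite (row_mxEl (a%:M : 'M[R]_1) v) mxE.
Qed.

Lemma cons_rV0 m (p : R' * 'rV[R]_m) : cons_rV p ord0 ord0 = p.1.
Proof. by rewrite -[LHS]/(uncons_rV _).1 cons_rVK. Qed.

Lemma cons_rVS m (p : R' * 'rV[R]_m) (i : 'I_m) :
  cons_rV p ord0 (lift ord0 i) = p.2 ord0 i.
Proof.
have -> : lift ord0 i = rshift 1 i :> 'I_(1 + m) by apply/val_inj.
exact: (row_mxEr (p.1%:M : 'M[R]_1) p.2).
Qed.

Lemma measurable_cons_rV m : measurable_fun setT (@cons_rV m).
Proof.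
apply: measurable_fun_rV => i; have [j ->|->] := unliftP ord0 i.
  rewrite (_ : (fun _ => _) = (fun x : 'rV[R]_m => x ord0 j) \o snd).
    by apply: measurableT_comp; [exact: measurable_coord|exact: measurable_snd].
  by apply/funext => p; exact: cons_rVS.
rewrite (_ : (fun _ => _) = fst); first exact: measurable_fst.
by apply/funext => p; exact: cons_rV0.
Qed.

Lemma measurable_uncons_rV m : measurable_fun setT (@uncons_rV m).
Proof.
apply/measurable_fun_pair => /=; first exact: measurable_coord.
apply: measurable_fun_rV => i.
rewrite (_ : (fun _ => _) = (fun x : 'rV[R]_m.+1 => x ord0 (rshift 1 i))).
  exact: measurable_coord.
by apply/funext => v; rewrite mxE.
Qed.

Section step.
Variables (m : nat) (mu : {sigma_finite_measure set 'rV[R]_m -> \bar R}).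

Definition lebesgue_rVS : set 'rV[R]_m.+1 -> \bar R :=
  pushforward (@lebesgue_measure R \x mu)%E (@cons_rV m).

Let mf := @measurable_cons_rV m.

Let lebesgue_rVS0 : lebesgue_rVS set0 = 0%E.
Proof. exact: measure0. Qed.

Let lebesgue_rVS_ge0 A : (0 <= lebesgue_rVS A)%E.
Proof. exact: measure_ge0. Qed.

Let lebesgue_rVS_sigma_additive : semi_sigma_additive lebesgue_rVS.
Proof. exact: measure_semi_sigma_additive. Qed.

HB.instance Definition _ := isMeasure.Build _ _ _ lebesgue_rVS
  lebesgue_rVS0 lebesgue_rVS_ge0 lebesgue_rVS_sigma_additive.

Let lebesgue_rVS_sigma_finite : sigma_finite setT lebesgue_rVS.
Proof.
have [F TF Foo] : sigma_finite setT (@lebesgue_measure R \x mu)%E.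
  have /sigma_finiteP[F [TF ndF Foo]] := sigma_finiteT (@lebesgue_measure R).
  have /sigma_finiteP[G [TG ndG Goo]] := sigma_finiteT mu.
  exists (fun k => F k `*` G k).
    rewrite -setXTT TF TG predeqE => -[x y]; split.
      move=> [/= [k _ Fkx] [l _ Gly]]; exists (maxn k l) => //; split.
      - by move: x Fkx; exact/subsetPset/ndF/leq_maxl.
      - by move: y Gly; exact/subsetPset/ndG/leq_maxr.
    by move=> [k _ []/= ? ?]; split; exists k.
  move=> k; have [? ?] := Foo k; have [? ?] := Goo k.
  split; first exact: measurableX.
  by rewrite product_measure1E// lte_mul_pinfty// ge0_fin_numE.
exists (fun k => @uncons_rV m @^-1` F k).
  by rewrite -preimage_bigcup -TF preimage_setT.
move=> k; have [mFk Fkoo] := Foo k; split.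
  by rewrite -[X in measurable X]setTI; exact: measurable_uncons_rV.
rewrite /lebesgue_rVS /pushforward -comp_preimage.
rewrite (_ : _ \o _ = id) ?preimage_id//.
by apply/funext => p; exact: cons_rVK.
Qed.

HB.instance Definition _ := Measure_isSigmaFinite.Build _ _ _ lebesgue_rVS
  lebesgue_rVS_sigma_finite.

End step.

(* Lebesgue measure on R^m, as the m-fold product of the one on R. *)
Fixpoint lebesgue_rV m : {sigma_finite_measure set 'rV[R]_m -> \bar R} :=
  if m is m'.+1 then lebesgue_rVS (lebesgue_rV m') else \d_(0 : 'rV[R]_0).

Lemma lebesgue_rV_box m (A : 'I_m -> set R') : (forall i, measurable (A i)) ->
  lebesgue_rV m [set x | forall i, A i (x ord0 i)] =
  (\prod_(i < m) lebesgue_measure (A i))%E.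
Proof.
elim: m => [|m IH] in A * => mA.
  by rewrite big_ord0 /= diracE mem_set// => -[].
have mA' : measurable
    [set x : 'rV[R]_m | forall i : 'I_m, A (lift ord0 i) (x ord0 i)].
  have -> : [set x : 'rV[R]_m | forall i : 'I_m, A (lift ord0 i) (x ord0 i)] =
      \bigcap_i (fun x : 'rV[R]_m => x ord0 i : R') @^-1` A (lift ord0 i).
    by apply/seteqP; split => x /= Ax i; [move=> _|]; exact: Ax.
  apply: fin_bigcap_measurable => // i _.
  by rewrite -[X in measurable X]setTI; exact: measurable_coord.
rewrite big_ord_recl /= /lebesgue_rVS /pushforward -IH//.
rewrite -product_measure1E//.
congr (_ _); apply/seteqP; split => -[a v] /=.
  move=> Aav; split => /= [|i].
    by have := Aav ord0; rewrite cons_rV0.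
  by have := Aav (lift ord0 i); rewrite cons_rVS.
move=> [/= Aa Av] i; have [j ->|->] := unliftP ord0 i.
  by rewrite cons_rVS.
by rewrite cons_rV0.
Qed.
End lebesgue_rV.

(* The norm `|x| of the library on 'rV[R]_m is the sup norm. *)
Definition eucl_norm {R : realType} m (x : 'rV[R]_m) : R :=
  Num.sqrt (\sum_i x ord0 i ^+ 2).

Definition cosh {R : realType} (t : R) : R := (expR t + expR (- t)) / 2.
Definition sinh {R : realType} (t : R) : R := (expR t - expR (- t)) / 2.
Definition tanh {R : realType} (t : R) : R := sinh t / cosh t.

(* exp (i theta) for real theta *)
Definition cis {R : realType} (theta : R) : R[i] := cos theta +i* sin theta.

Definition cintegral d (T : measurableType d) (R : realType)
    (mu : {measure set T -> \bar R}) (D : set T) (f : T -> R[i]) : R[i] :=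
  (\int[mu]_(x in D) complex.Re (f x)) +i* (\int[mu]_(x in D) complex.Im (f x)).

Section distributions.
Context {R : realType}.
Variable m : nat.
Local Notation V := 'rV[R]_m.

Definition partial (i : 'I_m) (f : V -> R[i]) : V -> R[i] := fun x =>
  'D_(delta_mx ord0 i) (@complex.Re R \o f) x +i*
  'D_(delta_mx ord0 i) (@complex.Im R \o f) x.

(* A multi-index is given as the list of the variables to differentiate in. *)
Definition partials (l : seq 'I_m) (f : V -> R[i]) : V -> R[i] :=
  foldr partial f l.

(* The directional derivative 'D_v is total: its existence is required
   separately. *)
Definition smooth_on (U : set V) (f : V -> R[i]) :=
  forall (l : seq 'I_m) (x : V), U x ->
    [/\ {for x, continuous (@complex.Re R \o partials l f)},
        {for x, continuous (@complex.Im R \o partials l f)} &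
        forall i, derivable (@complex.Re R \o partials l f) x (delta_mx ord0 i) /\
                  derivable (@complex.Im R \o partials l f) x (delta_mx ord0 i)].

Definition rapidly_decreasing (f : V -> R[i]) :=
  forall (k : nat) (l : seq 'I_m), exists C : R, forall x : V,
    eucl_norm x ^+ k * Normc.normc (partials l f x) <= C.

Record schwartz := Schwartz {
  schwartz_fun :> V -> R[i];
  schwartz_smooth : smooth_on setT schwartz_fun;
  schwartz_decr : rapidly_decreasing schwartz_fun }.

Definition tsupport (f : V -> R[i]) : set V := closure [set x | f x != 0].

Definition fourier (f : V -> R[i]) : V -> R[i] := fun xi =>
  ((2 * pi) `^ (- (m%:R / 2)))%:C *
  cintegral (lebesgue_rV m) setT
    (fun x => f x * cis (- \sum_i x ord0 i * xi ord0 i)).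

(* K is given on the open set U by a C^oo function; the test functions on U
   are the Schwartz functions with compact support contained in U. *)
Definition smooth_distribution_on (K : schwartz -> R[i]) (U : set V) :=
  exists2 f : V -> R[i], smooth_on U f &
    forall phi : schwartz, compact (tsupport phi) -> tsupport phi `<=` U ->
      K phi = cintegral (lebesgue_rV m) U (fun x => f x * phi x).

(* The largest open set on which K is given by a C^oo function is the union of
   all such open sets. *)
Definition singular_support (K : schwartz -> R[i]) : set V :=
  ~` \bigcup_(U in [set U | open U /\ smooth_distribution_on K U]) U.

End distributions.
Arguments schwartz R m : clear implicits.

Section fundamental_solution.
Context {R : realType}.
Variables n s : nat.

Definition P (x : 'rV[R]_(n + n)) : R :=
  \sum_(j < n) (x ord0 (lshift n j) ^+ 2 - x ord0 (rshift n j) ^+ 2).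

Definition q (xi : 'rV[R]_(n + n)) (theta : 'rV[R]_s) : R[i] :=
  'i%C / ((2 * pi) `^ (n%:R + s%:R / 2))%:C *
  cintegral lebesgue_measure `[0, +oo[
    (fun t => ((eucl_norm theta * cosh t ^+ n)^-1)%:C *
              cis (tanh t / eucl_norm theta * P xi)).

(* q is relevant only for theta != 0; the set theta = 0, where division by zero
   makes q vanish, is Lebesgue negligible. A point of R^(2n+s) is
   row_mx xi theta. *)
Definition K0s (phi : schwartz R (n + n + s)) : R[i] :=
  cintegral (lebesgue_rV (n + n + s)) setT
    (fun w => q (lsubmx w) (rsubmx w) * fourier phi w).

End fundamental_solution.

(* Main.v *)
(* On the open set U where |P(x)| > 4|z|, let sg be the sign of P(x).  Replace
   i P(xi) by (i P(xi) - e |xi|^2) / (1 + e^2): for fixed th <> 0 the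
   integral in (x, z), xi and t then converges absolutely, so that by Fubini and
   the formula for complex Gaussians
     K phi = lim_(e -> 0) c_e int phi(x, z) J_e(x, z) dx dz,
     J_e = int |th|^(n-1) (sinh t)^(-n)
              exp (- i z.th - |th| coth t (i P(x) + e |x|^2) / 4) dth dt,  t > 0.
   The limit is justified by |int (cosh t)^(-n) e^(lam tanh t) dt| <= C (1 + |lam|)^(-1/4)
   on Re lam <= 0.  The weight of J_e is homogeneous in th, so multiplying the
   phase by r > 0 multiplies J_e by r^(-(n+s-1)); as an integral of exp (- c X)
   is holomorphic in c, the phase may be rotated by a right angle at the cost
   of a constant factor.  At e = 0 this leaves the kernel
     int |th|^(n-1) (sinh t)^(-n) exp (- sg z.th - |th| coth t |P(x)| / 4) dth dt,
   which converges absolutely on U, since there |z| < |P(x)| / 4, and can be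
   differentiated under the integral sign. *)
Require Import Defs.
From HB Require Import structures.
From mathcomp Require Import all_boot all_order all_algebra.
From mathcomp Require Import all_classical all_reals all_analysis.
From mathcomp Require Import measurable_realfun complex ring lra.
Import Order.TTheory GRing.Theory Num.Theory.
Import numFieldNormedType.Exports.

Set Implicit Arguments.
Unset Strict Implicit.
Unset Printing Implicit Defensive.

Local Open Scope classical_set_scope.
Local Open Scope complex_scope.
Local Open Scope ring_scope.

(** At e = 0 absolute convergence fails twice: q carries the factor 1/|th|, not integrable near th =
    0 when s = 1, and J_e loses all decay in th. Hence the limit e -> 0 is taken separately on two
    sides. On the Fourier side the decay (1 + |P(xi)| / |th|)^(-1/4) turns 1/|th| into |th|^(-3/4)
    once xi is integrated out. Any exponent strictly between 0 and 1/2 would do: positive to help at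
    th = 0, below 1/2 so that its power of 1 / |a^2 + r| is locally integrable in a, uniformly in r.
    On the kernel side the rotation has to come before the limit. For e > 0 the term e |x|^2 keeps
    the real part of the phase positive at the oscillating end of the quarter turn, and |P(x)| > 4
    |z| does so at the other end. After the turn e survives only in the imaginary part of the phase,
    so no bound depends on it any more. The rotation uses no contour: by homogeneity the derivative
    in the angle is a multiple of the integral itself, which therefore solves a linear differential
    equation of first order. The same argument gives the modulus of complex Gaussian integrals. *)

Local Notation Re := (@complex.Re _).
Local Notation Im := (@complex.Im _).
Local Notation normc := (@Normc.normc _).

(** * Complex-valued functions: arithmetic, integrals, derivatives *)

Section complex_arith.
Context {R : realType}.
Implicit Types x y z : R[i].

Lemma ReM x y : Re (x * y) = Re x * Re y - Im x * Im y.
Proof. by case: x => a b; case: y. Qed.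

Lemma ImM x y : Im (x * y) = Re x * Im y + Im x * Re y.
Proof. by case: x => a b; case: y. Qed.

Lemma ReD x y : Re (x + y) = Re x + Re y.
Proof. by case: x => a b; case: y. Qed.

Lemma ImD x y : Im (x + y) = Im x + Im y.
Proof. by case: x => a b; case: y. Qed.

Lemma ReN x : Re (- x) = - Re x.
Proof. by case: x. Qed.

Lemma ImN x : Im (- x) = - Im x.
Proof. by case: x. Qed.

Lemma Re_sum I (r : seq I) (p : pred I) (F : I -> R[i]) :
  Re (\sum_(i <- r | p i) F i) = \sum_(i <- r | p i) Re (F i).
Proof.
elim: r => [|i r IH]; first by rewrite !big_nil.
by rewrite !big_cons; case: (p i); rewrite ?ReD IH.
Qed.

Lemma Im_sum I (r : seq I) (p : pred I) (F : I -> R[i]) :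
  Im (\sum_(i <- r | p i) F i) = \sum_(i <- r | p i) Im (F i).
Proof.
elim: r => [|i r IH]; first by rewrite !big_nil.
by rewrite !big_cons; case: (p i); rewrite ?ImD IH.
Qed.

Definition cplxE := (ReM, ImM, ReD, ImD, ReN, ImN).

Lemma complexP x y : Re x = Re y -> Im x = Im y -> x = y.
Proof. by case: x => a b; case: y => c d /= -> ->. Qed.

Lemma normcE z : normc z = Num.sqrt (Re z ^+ 2 + Im z ^+ 2).
Proof. by case: z. Qed.

Lemma normc_ge0 z : 0 <= normc z.
Proof. by rewrite normcE sqrtr_ge0. Qed.

Lemma normc_real (a : R) : normc a%:C = `|a|.
Proof. by rewrite normcE /= expr0n /= addr0 sqrtr_sqr. Qed.

Lemma sqr_normcE z : normc z ^+ 2 = Re z ^+ 2 + Im z ^+ 2.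
Proof. by rewrite normcE sqr_sqrtr // addr_ge0 // sqr_ge0. Qed.

Lemma normc_le z (c : R) : 0 <= c -> Re z ^+ 2 + Im z ^+ 2 <= c ^+ 2 ->
  normc z <= c.
Proof. by move=> c0 h; rewrite -(ler_pXn2r (n := 2)) ?nnegrE ?normc_ge0 // sqr_normcE. Qed.

Lemma normRe_le z : `|Re z| <= normc z.
Proof. by rewrite normcE -sqrtr_sqr ler_wsqrtr // lerDl sqr_ge0. Qed.

Lemma normIm_le z : `|Im z| <= normc z.
Proof. by rewrite normcE -sqrtr_sqr ler_wsqrtr // lerDr sqr_ge0. Qed.

Lemma normc_leD z : normc z <= `|Re z| + `|Im z|.
Proof.
apply: normc_le; first by rewrite addr_ge0.
by rewrite sqrrD !real_normK ?num_real // lerD2r lerDl mulrn_wge0 // mulr_ge0.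
Qed.

Lemma normc_prod I (r : seq I) (p : pred I) (F : I -> R[i]) :
  normc (\prod_(i <- r | p i) F i) = \prod_(i <- r | p i) normc (F i).
Proof.
elim: r => [|i r IH]; first by rewrite !big_nil Normc.normc1.
by rewrite !big_cons; case: (p i); rewrite ?Normc.normcM IH.
Qed.

Lemma normc_cis (t : R) : normc (cis t) = 1.
Proof. by rewrite normcE /= cos2Dsin2 sqrtr1. Qed.

Lemma cisD (s t : R) : cis (s + t) = cis s * cis t.
Proof. by apply: complexP; rewrite cplxE /= ?cosD ?sinD // addrC. Qed.

Lemma cis0 : cis (0 : R) = 1.
Proof. by apply: complexP; rewrite /= ?cos0 ?sin0. Qed.

Lemma cisNK (t : R) : cis (- t) * cis t = 1.
Proof. by rewrite -cisD addNr cis0. Qed.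

Definition cexp z : R[i] := (expR (Re z))%:C * cis (Im z).

Lemma Re_cexp z : Re (cexp z) = expR (Re z) * cos (Im z).
Proof. by rewrite cplxE /= mul0r subr0. Qed.

Lemma Im_cexp z : Im (cexp z) = expR (Re z) * sin (Im z).
Proof. by rewrite cplxE /= mul0r addr0. Qed.

Lemma cexpD x y : cexp (x + y) = cexp x * cexp y.
Proof. by rewrite /cexp !cplxE expRD cisD rmorphM mulrACA. Qed.

Lemma cexp0 : cexp 0 = 1.
Proof. by rewrite /cexp /= expR0 cis0 mul1r. Qed.

Lemma cexp_sum I (r : seq I) (p : pred I) (F : I -> R[i]) :
  cexp (\sum_(i <- r | p i) F i) = \prod_(i <- r | p i) cexp (F i).
Proof.
elim: r => [|i r IH]; first by rewrite !big_nil cexp0.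
by rewrite !big_cons; case: (p i); rewrite ?cexpD IH.
Qed.

Lemma normc_cexp z : normc (cexp z) = expR (Re z).
Proof. by rewrite Normc.normcM normc_real normc_cis mulr1 ger0_norm // expR_ge0. Qed.

Lemma cexp_real (a : R) : cexp a%:C = (expR a)%:C.
Proof. by rewrite /cexp /= cis0 mulr1. Qed.

Lemma cexp_imag (a : R) : cexp (0 +i* a) = cis a.
Proof. by rewrite /cexp /= expR0 mul1r. Qed.

End complex_arith.

Section complex_limits.
Context {R : realType}.

Definition ccvg (u : nat -> R[i]) (l : R[i]) :=
  (Re \o u @ \oo --> Re l) /\ (Im \o u @ \oo --> Im l).

Lemma ccvg_unique u l l' : ccvg u l -> ccvg u l' -> l = l'.
Proof.
move=> [a b] [c d]; apply: complexP.
  exact: (@cvg_unique _ (@Rhausdorff R) _ _ _ _ a c).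
exact: (@cvg_unique _ (@Rhausdorff R) _ _ _ _ b d).
Qed.

Lemma ccvg_cst l : ccvg (fun=> l) l.
Proof. by split; exact: cvg_cst. Qed.

Lemma ccvgM u v l m : ccvg u l -> ccvg v m -> ccvg (fun k => u k * v k) (l * m).
Proof.
move=> [a b] [c d]; split.
  rewrite ReM; under eq_cvg do rewrite /= ReM.
  by apply: cvgB; apply: cvgM.
rewrite ImM; under eq_cvg do rewrite /= ImM.
by apply: cvgD; apply: cvgM.
Qed.

Lemma ccvg_real (u : nat -> R) (l : R) : u @ \oo --> l -> ccvg (fun k => (u k)%:C) l%:C.
Proof. by move=> h; split => //; exact: cvg_cst. Qed.

Lemma ccvg_cexp u l : ccvg u l -> ccvg (fun k => cexp (u k)) (cexp l).
Proof.
move=> [a b]; split.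
  rewrite Re_cexp (_ : Re \o _ = (fun k => expR (Re (u k)) * cos (Im (u k)))).
  apply: cvgM; [apply: (cvg_comp _ _ a)|apply: (cvg_comp _ _ b)];
    [exact: continuous_expR|exact: continuous_cos].
  by apply/funext => k; exact: Re_cexp.
rewrite Im_cexp (_ : Im \o _ = (fun k => expR (Re (u k)) * sin (Im (u k)))).
apply: cvgM; [apply: (cvg_comp _ _ a)|apply: (cvg_comp _ _ b)];
  [exact: continuous_expR|exact: continuous_sin].
by apply/funext => k; exact: Im_cexp.
Qed.

End complex_limits.

Lemma measurable_sqrt {R : realType} : measurable_fun setT (@Num.sqrt R).
Proof. exact: continuous_measurable_fun (@sqrt_continuous R). Qed.

Section complex_integral.
Context {R : realType} d {T : measurableType d}.
Variable mu : {measure set T -> \bar R}.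
Implicit Types f g : T -> R[i].

Definition cmeas f := measurable_fun setT (Re \o f) /\ measurable_fun setT (Im \o f).

Definition cintegrable f :=
  mu.-integrable setT (EFin \o (Re \o f)) /\ mu.-integrable setT (EFin \o (Im \o f)).

Definition cint f := cintegral mu setT f.

Lemma cintegrable_meas f : cintegrable f -> cmeas f.
Proof.
by move=> [a b]; split; apply/measurable_EFinP; [exact: measurable_int a|exact: measurable_int b].
Qed.

Lemma cmeas_cst c : cmeas (fun=> c).
Proof. by split; exact: measurable_cst. Qed.

Lemma cmeasM f g : cmeas f -> cmeas g -> cmeas (fun x => f x * g x).
Proof.
move=> [a b] [c e]; split.
  rewrite (_ : _ \o _ = (fun x => Re (f x) * Re (g x) - Im (f x) * Im (g x))).
    by apply: measurable_funB; apply: measurable_funM.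
  by apply/funext => x /=; rewrite cplxE.
rewrite (_ : _ \o _ = (fun x => Re (f x) * Im (g x) + Im (f x) * Re (g x))).
  by apply: measurable_funD; apply: measurable_funM.
by apply/funext => x /=; rewrite cplxE.
Qed.

Lemma cmeasD f g : cmeas f -> cmeas g -> cmeas (fun x => f x + g x).
Proof.
move=> [a b] [c e]; split.
  rewrite (_ : _ \o _ = (fun x => Re (f x) + Re (g x))).
    exact: measurable_funD.
  by apply/funext => x /=; rewrite cplxE.
rewrite (_ : _ \o _ = (fun x => Im (f x) + Im (g x))).
  exact: measurable_funD.
by apply/funext => x /=; rewrite cplxE.
Qed.

Lemma cmeas_real (f : T -> R) : measurable_fun setT f -> cmeas (fun x => (f x)%:C).
Proof. by move=> mf; split => //; exact: measurable_cst. Qed.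

Lemma cmeas_pair (f g : T -> R) : measurable_fun setT f -> measurable_fun setT g ->
  cmeas (fun x => f x +i* g x).
Proof. by move=> mf; split. Qed.

Lemma cmeas_cexp f : cmeas f -> cmeas (fun x => cexp (f x)).
Proof.
move=> [a b]; split.
  rewrite (_ : _ \o _ = (fun x => expR (Re (f x)) * cos (Im (f x)))).
    apply: measurable_funM; first exact: measurableT_comp.
    by apply: measurableT_comp => //; exact: (continuous_measurable_fun (@continuous_cos R)).
  by apply/funext => x; exact: Re_cexp.
rewrite (_ : _ \o _ = (fun x => expR (Re (f x)) * sin (Im (f x)))).
  apply: measurable_funM; first exact: measurableT_comp.
  by apply: measurableT_comp => //; exact: (continuous_measurable_fun (@continuous_sin R)).
by apply/funext => x; exact: Im_cexp.
Qed.

Lemma cmeas_normc f : cmeas f -> measurable_fun setT (fun x => normc (f x)).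
Proof.
move=> [a b]; under eq_fun do rewrite normcE.
apply: (measurableT_comp measurable_sqrt).
by apply: measurable_funD; exact: measurable_funX.
Qed.

Lemma cintegrable_le f (g : T -> R) : cmeas f ->
  mu.-integrable setT (EFin \o g) -> (forall x, normc (f x) <= g x) -> cintegrable f.
Proof.
move=> [a b] ig fg; split.
  apply: le_integrable ig => //; first exact/measurable_EFinP.
  move=> x _ /=; rewrite lee_fin (le_trans (normRe_le _)) // (le_trans (fg x)) //.
  exact: ler_norm.
apply: le_integrable ig => //; first exact/measurable_EFinP.
move=> x _ /=; rewrite lee_fin (le_trans (normIm_le _)) // (le_trans (fg x)) //.
exact: ler_norm.
Qed.

Lemma cintegrable_normc f : cintegrable f ->
  mu.-integrable setT (EFin \o (fun x => normc (f x))).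
Proof.
move=> cf; have mf := cintegrable_meas cf; case: cf => a b.
apply: (@le_integrable _ _ _ mu _ measurableT _
  ((EFin \o (Num.norm \o (Re \o f))) \+ (EFin \o (Num.norm \o (Im \o f))))).
- by apply/measurable_EFinP; exact: cmeas_normc.
- move=> x _ /=; rewrite lee_fin ger0_norm ?normc_ge0 //.
  by rewrite (le_trans (normc_leD _)) // ler_norm.
- by apply: integrableD => //; exact: integrable_norm.
Qed.

Lemma eq_cint f g : f =1 g -> cint f = cint g.
Proof. by move=> fg; congr cint; exact/funext. Qed.

Lemma cintegrableZ c f : cintegrable f -> cintegrable (fun x => c * f x).
Proof.
move=> cf; apply: (@cintegrable_le _ (fun x => normc c * normc (f x))).
- by apply: cmeasM; [exact: cmeas_cst|exact: cintegrable_meas].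
- by apply: (integrableZl measurableT (normc c) (cintegrable_normc cf)).
- by move=> x; rewrite Normc.normcM.
Qed.

Lemma cintegrableD f g : cintegrable f -> cintegrable g ->
  cintegrable (fun x => f x + g x).
Proof.
move=> cf cg; apply: (@cintegrable_le _ (fun x => normc (f x) + normc (g x))).
- by apply: cmeasD; exact: cintegrable_meas.
- rewrite (_ : _ \o _ = (EFin \o (fun x => normc (f x))) \+ (EFin \o (fun x => normc (g x)))) //.
  by apply: integrableD => //; exact: cintegrable_normc.
- by move=> x; exact: le_normcD.
Qed.

Lemma cintD f g : cintegrable f -> cintegrable g ->
  cint (fun x => f x + g x) = cint f + cint g.
Proof.
move=> [a b] [c e]; apply: complexP; rewrite cplxE /=.
  by under eq_Rintegral do rewrite ReD; rewrite RintegralD.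
by under eq_Rintegral do rewrite ImD; rewrite RintegralD.
Qed.

Lemma integrable_RZ (r : R) (h : T -> R) : mu.-integrable setT (EFin \o h) ->
  mu.-integrable setT (EFin \o (fun x => r * h x)).
Proof. by move=> ih; exact: (integrableZl measurableT r ih). Qed.

Lemma cintZ c f : cintegrable f -> cint (fun x => c * f x) = c * cint f.
Proof.
move=> [a b]; apply: complexP; rewrite cplxE /=.
  under eq_Rintegral do rewrite ReM.
  by rewrite RintegralB // ?RintegralZl //; exact: integrable_RZ.
under eq_Rintegral do rewrite ImM.
by rewrite RintegralD // ?RintegralZl //; exact: integrable_RZ.
Qed.

(** The factor 2 comes from bounding the real and the imaginary part separately; later only the
    finiteness of the bound and its uniformity in parameters count. *)
Lemma normc_cint_le f (g : T -> R) : cmeas f ->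
  mu.-integrable setT (EFin \o g) -> (forall x, normc (f x) <= g x) ->
  normc (cint f) <= 2 * \int[mu]_x g x.
Proof.
move=> mf ig fg; have [a b] := cintegrable_le mf ig fg.
rewrite (le_trans (normc_leD _)) // mulr_natl mulr2n lerD //=.
  rewrite (le_trans (le_normr_Rintegral _ a)) //.
  apply: le_Rintegral => //; first exact: integrable_norm.
  by move=> x _; rewrite (le_trans (normRe_le _)).
rewrite (le_trans (le_normr_Rintegral _ b)) //.
apply: le_Rintegral => //; first exact: integrable_norm.
by move=> x _; rewrite (le_trans (normIm_le _)).
Qed.

Lemma cint_dct (f_ : nat -> T -> R[i]) f (g : T -> R) :
  (forall k, cmeas (f_ k)) -> (forall x, ccvg (f_^~ x) (f x)) ->
  mu.-integrable setT (EFin \o g) -> (forall k x, normc (f_ k x) <= g x) ->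
  ccvg (fun k => cint (f_ k)) (cint f).
Proof.
move=> mf ff ig fg.
have main (p : R[i] -> R) : (forall z, `|p z| <= normc z) ->
    (forall k, measurable_fun setT (p \o f_ k)) ->
    (forall x, (p \o f_^~ x) k @[k --> \oo] --> p (f x)) ->
    (fun k => \int[mu]_x p (f_ k x)) @ \oo --> \int[mu]_x p (f x).
  move=> pn mp pf.
  have mpf : measurable_fun setT (p \o f).
    by apply: (measurable_fun_cvg mp) => x _; exact: pf.
  have [] := @dominated_convergence _ _ _ mu setT measurableT
    (fun k => EFin \o (p \o f_ k)) (EFin \o (p \o f)) (EFin \o g).
  - by move=> k; exact/measurable_EFinP.
  - exact/measurable_EFinP.
  - apply: aeW => x _; apply: cvg_EFin; first exact: nearW.
    exact: pf.
  - by [].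
  - by apply: aeW => x k _; rewrite lee_fin (le_trans (pn _)).
  - by move=> ipf _ cv; apply: fine_cvg; rewrite fineK ?integrable_fin_num.
split; apply: main => //.
- exact: normRe_le.
- by move=> k; case: (mf k).
- by move=> x; case: (ff x).
- exact: normIm_le.
- by move=> k; case: (mf k).
- by move=> x; case: (ff x).
Qed.

End complex_integral.

Section complex_fubini.
Context {R : realType} d1 d2 {T1 : measurableType d1} {T2 : measurableType d2}.
Variable m1 : {sigma_finite_measure set T1 -> \bar R}.
Variable m2 : {sigma_finite_measure set T2 -> \bar R}.

(** No section is assumed integrable: each integral is [fine] of a difference of two Tonelli
    integrals, which are measurable in x in any case. *)
Lemma measurable_Rint_section (g : T1 * T2 -> R) : measurable_fun setT g ->
  measurable_fun setT (fun x => \int[m2]_y g (x, y)).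
Proof.
move=> mg; rewrite /Rintegral.
apply: (@measurableT_comp _ _ _ _ _ _ fine) => //.
rewrite (_ : (fun x => _) = (fun x => \int[m2]_y ((EFin \o g)^\+ (x, y)) -
   \int[m2]_y ((EFin \o g)^\- (x, y)))%E).
  apply: emeasurable_funB.
    apply: (@measurable_fun_fubini_tonelli_F _ _ _ _ _ m2 ((EFin \o g)^\+)%E) => //.
    by apply: measurable_funepos; exact/measurable_EFinP.
  apply: (@measurable_fun_fubini_tonelli_F _ _ _ _ _ m2 ((EFin \o g)^\-)%E) => //.
  by apply: measurable_funeneg; exact/measurable_EFinP.
apply/funext => x; rewrite [LHS]integralE.
by congr (_ - _)%E; apply: eq_integral => y _; rewrite ?funeposE ?funenegE.
Qed.

Lemma cmeas_section (f : T1 * T2 -> R[i]) x : cmeas f -> cmeas (fun y => f (x, y)).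
Proof.
move=> [a b]; split.
  exact: (measurableT_comp a (measurable_pair1 x)).
exact: (measurableT_comp b (measurable_pair1 x)).
Qed.

Lemma cmeas_cint_section (f : T1 * T2 -> R[i]) : cmeas f ->
  cmeas (fun x => cint m2 (fun y => f (x, y))).
Proof.
move=> [a b]; split.
  exact: (measurable_Rint_section a).
exact: (measurable_Rint_section b).
Qed.

Lemma integrable_prod (g1 : T1 -> R) (g2 : T2 -> R) :
  m1.-integrable setT (EFin \o g1) -> m2.-integrable setT (EFin \o g2) ->
  (m1 \x m2)%E.-integrable setT (EFin \o (fun p => g1 p.1 * g2 p.2)).
Proof.
move=> i1 i2.
have mg1 : measurable_fun setT g1 by apply/measurable_EFinP; exact: measurable_int i1.
have mg2 : measurable_fun setT g2 by apply/measurable_EFinP; exact: measurable_int i2.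
apply/integrable12ltyP.
  apply/measurable_EFinP; apply: measurable_funM.
    by apply: (measurableT_comp mg1).
  by apply: (measurableT_comp mg2).
have -> : (fun x => \int[m2]_y `|(EFin \o (fun p : T1 * T2 => (g1 p.1 * g2 p.2)%R)) (x, y)|)%E =
  (fun x => `|g1 x|%:E * \int[m2]_y `|(g2 y)%:E|)%E.
  apply/funext => x /=.
  under eq_integral do rewrite normrM EFinM.
  by rewrite ge0_integralZl //; apply/measurable_EFinP; exact: measurableT_comp.
rewrite ge0_integralZr //; last 2 first.
- by apply/measurable_EFinP; exact: measurableT_comp.
- exact: integral_ge0.
case/integrableP: i1 => _ i1; case/integrableP: i2 => _ i2.
by apply: lte_mul_pinfty => //; [exact: integral_ge0|rewrite ge0_fin_numE // integral_ge0].
Qed.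

(** Asking for all sections, and not almost all, to be integrable makes the inner integral finite at
    each point, so that passing to real values through [fine] loses nothing. *)
Lemma cfubini1 (f : T1 * T2 -> R[i]) : cintegrable (m1 \x m2)%E f ->
  (forall x, cintegrable m2 (fun y => f (x, y))) ->
  cint (m1 \x m2)%E f = cint m1 (fun x => cint m2 (fun y => f (x, y))).
Proof.
move=> [a b] s; apply: complexP => /=; rewrite /Rintegral.
  rewrite -[in LHS](integral12_prod_meas1 a); congr fine; apply: eq_integral => x _.
  by rewrite /fubini_F fineK // integrable_fin_num //; case: (s x).
rewrite -[in LHS](integral12_prod_meas1 b); congr fine; apply: eq_integral => x _.
by rewrite /fubini_F fineK // integrable_fin_num //; case: (s x).
Qed.

Lemma cfubini2 (f : T1 * T2 -> R[i]) : cintegrable (m1 \x m2)%E f ->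
  (forall y, cintegrable m1 (fun x => f (x, y))) ->
  cint (m1 \x m2)%E f = cint m2 (fun y => cint m1 (fun x => f (x, y))).
Proof.
move=> [a b] s; apply: complexP => /=; rewrite /Rintegral.
  rewrite -[in LHS](integral21_prod_meas1 a); congr fine; apply: eq_integral => x _.
  by rewrite /fubini_G fineK // integrable_fin_num //; case: (s x).
rewrite -[in LHS](integral21_prod_meas1 b); congr fine; apply: eq_integral => x _.
by rewrite /fubini_G fineK // integrable_fin_num //; case: (s x).
Qed.

(** A majorant of product form gives at once the integrability on the product and that of every
    section in either variable. *)
Lemma cfubini_dom (f : T1 * T2 -> R[i]) (g1 : T1 -> R) (g2 : T2 -> R) :
  cmeas f -> m1.-integrable setT (EFin \o g1) -> m2.-integrable setT (EFin \o g2) ->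
  (forall x y, normc (f (x, y)) <= g1 x * g2 y) ->
  cint m1 (fun x => cint m2 (fun y => f (x, y))) =
  cint m2 (fun y => cint m1 (fun x => f (x, y))) /\
  cint (m1 \x m2)%E f = cint m1 (fun x => cint m2 (fun y => f (x, y))).
Proof.
move=> mf i1 i2 fg.
have If : cintegrable (m1 \x m2)%E f.
  by apply: (cintegrable_le mf (integrable_prod i1 i2)) => -[x y] /=.
have e1 : cint (m1 \x m2)%E f = cint m1 (fun x => cint m2 (fun y => f (x, y))).
  apply: cfubini1 => // x; apply: (cintegrable_le _ (integrable_RZ (g1 x) i2)) => //.
  exact: cmeas_section.
split => //; rewrite -e1 cfubini2 // => y.
apply: (cintegrable_le _ (integrable_RZ (g2 y) i1)) => [|x]; last by rewrite mulrC.
case: mf => a b; split.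
  exact: (measurableT_comp a (measurable_pair2 y)).
exact: (measurableT_comp b (measurable_pair2 y)).
Qed.

End complex_fubini.

Section complex_derive.
Context {R : realType}.
Implicit Types (u v : R -> R[i]) (x : R) (l m : R[i]).

Definition is_cderive u x l :=
  is_derive x (1 : R) (fun t => Re (u t)) (Re l) /\
  is_derive x (1 : R) (fun t => Im (u t)) (Im l).

Lemma is_cderiveD u v x l m : is_cderive u x l -> is_cderive v x m ->
  is_cderive (fun t => u t + v t) x (l + m).
Proof.
move=> [a b] [c e]; split.
  by rewrite ReD; under eq_fun do rewrite ReD; exact: is_deriveD.
by rewrite ImD; under eq_fun do rewrite ImD; exact: is_deriveD.
Qed.

Lemma is_cderiveM u v x l m : is_cderive u x l -> is_cderive v x m ->
  is_cderive (fun t => u t * v t) x (l * v x + u x * m).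
Proof.
move=> [a b] [c e]; split.
  rewrite !cplxE; under eq_fun do rewrite ReM.
  apply: (is_derive_eq (is_deriveB (is_deriveM a c) (is_deriveM b e))).
  by rewrite /GRing.scale /=; ring.
rewrite !cplxE; under eq_fun do rewrite ImM.
apply: (is_derive_eq (is_deriveD (is_deriveM a e) (is_deriveM b c))).
by rewrite /GRing.scale /=; ring.
Qed.

Lemma is_cderive_cst c x : is_cderive (fun=> c) x 0.
Proof. by split; exact: is_derive_cst. Qed.

Lemma is_cderiveZ c u x l : is_cderive u x l -> is_cderive (fun t => c * u t) x (c * l).
Proof.
move=> h; have := is_cderiveM (is_cderive_cst c x) h.
by rewrite mul0r add0r.
Qed.

Lemma is_cderive_real (f : R -> R) x (l : R) : is_derive x 1 f l ->
  is_cderive (fun t => (f t)%:C) x l%:C.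
Proof. by move=> h; split => //=; exact: is_derive_cst. Qed.

Lemma is_cderive_cexp u x l : is_cderive u x l ->
  is_cderive (fun t => cexp (u t)) x (l * cexp (u x)).
Proof.
move=> [a b]; split.
  rewrite ReM Re_cexp Im_cexp.
  under eq_fun do rewrite Re_cexp.
  have h1 := is_derive1_comp (is_derive_expR (Re (u x))) a.
  have h2 := is_derive1_comp (is_derive_cos (Im (u x))) b.
  apply: (is_derive_eq (is_deriveM h1 h2)).
  by rewrite /GRing.scale /=; ring.
rewrite ImM Re_cexp Im_cexp.
under eq_fun do rewrite Im_cexp.
have h1 := is_derive1_comp (is_derive_expR (Re (u x))) a.
have h2 := is_derive1_comp (is_derive_sin (Im (u x))) b.
apply: (is_derive_eq (is_deriveM h1 h2)).
by rewrite /GRing.scale /=; ring.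
Qed.

Lemma is_derive0_eq (f : R -> R) (a b : R) : a <= b ->
  (forall x : R, a <= x <= b -> is_derive x (1 : R) f 0) -> f a = f b.
Proof.
rewrite le_eqVlt => /predU1P[-> //|ab] h.
have [||c _] := @MVT R f (fun=> 0) a b ab.
- by move=> x xab; apply: h; apply: subset_itv_oo_cc xab.
- by apply: derivable_within_continuous => x /[!in_itv] xab; case: (h x xab).
- by rewrite mul0r => /eqP; rewrite subr_eq0 => /eqP.
Qed.

Lemma is_cderive0_eq u a b : a <= b ->
  (forall x, a <= x <= b -> is_cderive u x 0) -> u a = u b.
Proof.
by move=> ab h; apply: complexP; [apply: (is_derive0_eq (f := fun t => Re (u t)) ab)|
  apply: (is_derive0_eq (f := fun t => Im (u t)) ab)] => x /h[].
Qed.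

Lemma is_cderive_unique u x l m : is_cderive u x l -> is_cderive u x m -> l = m.
Proof.
move=> [[a1 a2] [b1 b2]] [[c1 c2] [e1 e2]]; apply: complexP.
  by rewrite -a2 -c2.
by rewrite -b2 -e2.
Qed.

Lemma is_cderive_cint d (T : measurableType d) (mu : {measure set T -> \bar R})
    (f f' : R -> T -> R[i]) (G : T -> R) (a u v : R) :
  u < a < v -> (forall x, u < x < v -> cintegrable mu (f x)) ->
  (forall x y, u < x < v -> is_cderive (f^~ y) x (f' x y)) ->
  mu.-integrable setT (EFin \o G) ->
  (forall x y, u < x < v -> normc (f' x y) <= G y) ->
  is_cderive (fun x => cint mu (f x)) a (cint mu (f' a)).
Proof.
move=> auv If df iG fG.
have G0 y : 0 <= G y by exact: le_trans (normc_ge0 _) (fG a y auv).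
have main (p : R[i] -> R) : (forall z, `|p z| <= normc z) ->
    (forall x, u < x < v -> mu.-integrable setT (EFin \o (p \o f x))) ->
    (forall x y, u < x < v -> is_derive x (1 : R) (fun t => p (f t y)) (p (f' x y))) ->
    is_derive a (1 : R) (fun x => \int[mu]_y p (f x y)) (\int[mu]_y p (f' a y)).
  move=> pn ipf dpf.
  have dE x y : u < x < v -> partial1of2 (fun x y => p (f x y)) x y = p (f' x y).
    by move=> xuv; rewrite partial1of2E; case: (dpf x y xuv).
  have aI : [set` `]u, v[] a by rewrite /= in_itv.
  have h1 x : [set` `]u, v[] x -> mu.-integrable setT (EFin \o (fun y => p (f x y))).
    by rewrite /= in_itv /=; exact: ipf.
  have h2 x y : [set` `]u, v[] x -> setT y -> derivable ((fun x y => p (f x y))^~ y) x 1.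
    by rewrite /= in_itv /= => xuv _; case: (dpf x y xuv).
  have h3 x y : [set` `]u, v[] x -> setT y ->
      `|partial1of2 (fun x y => p (f x y)) x y| <= G y.
    by rewrite /= in_itv /= => xuv _; rewrite dE // (le_trans (pn _)) // fG.
  apply: DeriveDef.
    exact: (derivable_under_integral measurableT aI h1 h2 G0 iG h3).
  rewrite -derive1E (differentiation_under_integral measurableT aI h1 h2 G0 iG h3).
  by apply: eq_Rintegral => y _; rewrite dE.
split; apply: main.
- exact: normRe_le.
- by move=> x /If[].
- by move=> x y /df -/(_ y)[].
- exact: normIm_le.
- by move=> x /If[].
- by move=> x y /df -/(_ y)[].
Qed.

End complex_derive.

(** * The integral of a derivative over the whole line *)

Section ftc_line.
Context {R : realType}.
Local Notation mu := (@lebesgue_measure R).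

Lemma Rintegral_is_derive (F f : R -> R) (a b : R) : a <= b ->
  (forall x : R, is_derive x (1 : R) F (f x)) -> continuous f ->
  \int[mu]_(x in `[a, b]) f x = F b - F a.
Proof.
rewrite le_eqVlt => /predU1P[->|ab] dF cf.
  by rewrite set_itv1 Rintegral_set1 subrr.
have cF : continuous F.
  by move=> x; apply/differentiable_continuous/derivable1_diffP; case: (dF x).
rewrite /Rintegral (continuous_FTC2 ab (F := F)) //=.
- by apply: continuous_subspaceT => x; exact: cf.
- split => [x _||]; first by case: (dF x).
    by apply: cvg_at_right_filter; exact: cF.
  by apply: cvg_at_left_filter; exact: cF.
- by move=> x _; rewrite derive1E; case: (dF x).
Qed.

Lemma integrable_itv_continuous (f : R -> R) (a b : R) : continuous f ->
  mu.-integrable `[a, b] (EFin \o f).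
Proof.
move=> cf; apply: continuous_compact_integrable; first exact: segment_compact.
by apply: continuous_subspaceT => x; exact: cf.
Qed.

(** Truncate f to [-k, k]. The truncated integrals tend to the full one by dominated convergence,
    and they equal F k - F (- k), which tends to 0. *)
Lemma Rintegral_derive_eq0 (F f : R -> R) :
  (forall x : R, is_derive x (1 : R) F (f x)) -> continuous f ->
  mu.-integrable setT (EFin \o f) ->
  (fun k => F k%:R) @ \oo --> (0 : R) -> (fun k => F (- k%:R)) @ \oo --> (0 : R) ->
  \int[mu]_x f x = 0.
Proof.
move=> dF cf If F1 F2.
pose f_ (k : nat) := f \_ `[- k%:R : R, k%:R].
have mf : measurable_fun setT f by apply/measurable_EFinP; exact: measurable_int If.
have c1 : ccvg (fun k => cint mu (fun x => (f_ k x)%:C)) (cint mu (fun x => (f x)%:C)).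
  apply: (@cint_dct _ _ _ mu _ _ (fun x => `|f x|)).
  - move=> k; apply: cmeas_real; apply/(measurable_restrictT _ _).1 => //.
    exact: measurable_funTS.
  - move=> x; apply: ccvg_real; apply: cvg_near_cst.
    exists (Num.bound `|x|) => // k /= xk; rewrite /f_ patchE mem_set //=.
    rewrite in_itv /= -ler_norml (le_trans (ltW (archi_boundP _))) // ler_nat //.
  - exact: integrable_norm.
  - move=> k x; rewrite normc_real /f_ patchE; case: ifP => // _.
    by rewrite normr0.
have c2 : ccvg (fun k => cint mu (fun x => (f_ k x)%:C)) 0.
  have e k : cint mu (fun x => (f_ k x)%:C) = (F k%:R - F (- k%:R))%:C.
    apply: complexP => /=; last first.
      by under eq_Rintegral do rewrite /=; rewrite Rintegral_cst // mul0r.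
    rewrite -Rintegral_mkcond (Rintegral_is_derive _ dF) //.
    by rewrite ge0_cp // ler0n.
  rewrite (_ : (fun _ => _) = (fun k => (F k%:R - F (- k%:R))%:C)); last exact/funext.
  by apply: ccvg_real; rewrite -[X in _ --> X](subr0 0); apply: cvgB.
have := ccvg_unique c1 c2 => /(congr1 (@complex.Re R)) /=.
by [].
Qed.

End ftc_line.

(** * Changes of variables and integration on row vectors *)

Section transfer.
Context {R : realType} d1 d2 {T : measurableType d1} {S : measurableType d2}.
Variables (mu : {measure set T -> \bar R}) (nu : {measure set S -> \bar R}).
Variables (p : S -> T) (c : R).

(** A change of variables x = p y with constant Jacobian c. Nonnegative functions suffice: the
    statements on integrability and on real and complex integrals below follow from this one. *)
Definition ge0_transfer := forall f : T -> \bar R, measurable_fun setT f ->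
  (forall x, 0 <= f x)%E -> (\int[mu]_x f x = c%:E * \int[nu]_y f (p y))%E.

Hypotheses (c0 : 0 < c) (mp : measurable_fun setT p) (H : ge0_transfer).

Lemma integrable_transfer (f : T -> R) : measurable_fun setT f ->
  nu.-integrable setT (EFin \o (f \o p)) <-> mu.-integrable setT (EFin \o f).
Proof.
move=> mf.
have mfe : measurable_fun setT (EFin \o f) by exact/measurable_EFinP.
have mfp : measurable_fun setT (EFin \o (f \o p)).
  by apply/measurable_EFinP; exact: measurableT_comp.
have E := H (f := fun x => `|(f x)%:E|%E).
have {}E : (\int[mu]_x `|(EFin \o f) x| = c%:E * \int[nu]_y `|(EFin \o (f \o p)) y|)%E.
  by apply: E => //; exact: measurableT_comp.
split=> /integrableP[_ h]; apply/integrableP; split => //.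
  by rewrite E lte_mul_pinfty // ?lee_fin ?ltW.
have : (0 <= \int[nu]_y `|(EFin \o (f \o p)) y|)%E by exact: integral_ge0.
move: h; rewrite E; case: (\int[nu]_y `|(EFin \o (f \o p)) y|)%E => [r _ _||] //.
  by rewrite ltry.
by rewrite mulry gtr0_sg // mul1e.
Qed.

Lemma Rint_transfer (f : T -> R) : measurable_fun setT f ->
  nu.-integrable setT (EFin \o (f \o p)) ->
  \int[mu]_x f x = c * \int[nu]_y f (p y).
Proof.
move=> mf If; have Jf := (integrable_transfer mf).1 If.
have mfe : measurable_fun setT (EFin \o f) by exact/measurable_EFinP.
apply: EFin_inj; rewrite EFinM /Rintegral !fineK ?integrable_fin_num //.
rewrite [LHS]integralE (H (measurable_funepos mfe)) // (H (measurable_funeneg mfe)) //.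
have e (A B : \bar R) : B \is a fin_num -> (c%:E * (A - B) = c%:E * A - c%:E * B)%E.
  by move=> Bf; rewrite muleBr // fin_num_adde_defl // fin_numN.
rewrite [in RHS]integralE [RHS]e //.
  by congr (_ - _)%E; congr (_ * _)%E; apply: eq_integral => y _;
    rewrite ?funeposE ?funenegE.
exact: (integrable_neg_fin_num measurableT If).
Qed.

Lemma cint_transfer (f : T -> R[i]) : cmeas f -> cintegrable nu (f \o p) ->
  cintegrable mu f /\ cint mu f = c%:C * cint nu (f \o p).
Proof.
move=> [a b] [ia ib]; split.
  by split; apply/integrable_transfer.
by apply: complexP; rewrite cplxE /= ?mul0r ?subr0 ?addr0; exact: Rint_transfer.
Qed.

End transfer.

Lemma ge0_transfer_pushforward {R : realType} d1 d2 {T : measurableType d1} {S : measurableType d2}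
  (nu : {measure set S -> \bar R}) (p : S -> T) : measurable_fun setT p ->
  forall f : T -> \bar R, measurable_fun setT f ->
  (forall x, 0 <= f x)%E -> (\int[pushforward nu p]_x f x = \int[nu]_y f (p y))%E.
Proof.
by move=> mp f mf f0; rewrite ge0_integral_pushforward.
Qed.

Section lebesgue_affine.
Context {R : realType}.
Local Notation R' := (measurableTypeR R).
Local Notation mu := (@lebesgue_measure R).

(** The image of Lebesgue measure under x -> r x + b, multiplied by r, gives every half-open
    interval its length, so it is Lebesgue measure. *)
Lemma ge0_integral_lebesgue_affine (r b : R) : 0 < r ->
  forall f : R' -> \bar R, measurable_fun setT f -> (forall x, 0 <= f x)%E ->
  (\int[mu]_x f (r * x + b)%R = (r^-1)%:E * \int[mu]_x f x)%E.
Proof.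
move=> r0 f mf f0.
pose p : R' -> R' := fun x => r * x + b.
have mp : measurable_fun setT p by apply: measurable_funD => //; exact: measurable_funM.
have rn : (0 <= r) := ltW r0.
pose nu0 : {measure set R' -> \bar R} := mscale (NngNum rn) (pushforward mu p).
pose nu := nu0 mp.
have E A : measurable A -> mu A = nu A.
  apply: lebesgue_measure_unique => X [[c d] _ <-] /=.
  rewrite /mscale /= /pushforward.
  rewrite (_ : p @^-1` _ = `](c - b) / r, (d - b) / r]%classic); last first.
    apply/seteqP; split => x /=; rewrite !in_itv /= /p ltr_pdivrMr // ler_pdivlMr //.
      by rewrite ltrBlDr lerBrDr [x * r]mulrC.
    by rewrite ltrBlDr lerBrDr [x * r]mulrC.
  rewrite !lebesgue_measure_itv /= !lte_fin.
  have -> : ((c - b) / r < (d - b) / r) = (c < d).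
    by rewrite ltr_pM2r ?invr_gt0 // ltrD2r.
  case: ifP => // _; last by rewrite mule0.
  rewrite -!EFinD -EFinM; congr EFin; field.
  by rewrite gt_eqF.
have -> : (\int[mu]_x f x = \int[nu]_x f x)%E.
  by apply: eq_measure_integral => A mA _; exact: E.
rewrite ge0_integral_mscale //= ge0_transfer_pushforward //.
by rewrite muleA -EFinM mulVf ?mul1e // gt_eqF.
Qed.

End lebesgue_affine.

Section rV_integral.
Context {R : realType}.
Local Notation L := (@lebesgue_rV R).
Local Notation R' := (measurableTypeR R).
Local Notation mu := (@lebesgue_measure R).

Lemma integral_rV0 (f : 'rV[R]_0 -> \bar R) : measurable_fun setT f ->
  (\int[L 0]_x f x = f (0 : 'rV[R]_0)%R)%E.
Proof. by move=> mf; rewrite integral_dirac // /dirac indicE in_setT mul1e. Qed.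

Lemma ge0_integral_rVS m : ge0_transfer (L m.+1) (mu \x L m)%E (@cons_rV R m) 1.
Proof.
move=> f mf f0; rewrite mul1e.
rewrite -(@ge0_transfer_pushforward _ _ _ _ _ (mu \x L m)%E (@cons_rV R m)) //.
exact: measurable_cons_rV.
Qed.

Local Opaque lebesgue_rV.

Lemma ge0_integral_rVS2 m (f : 'rV[R]_m.+1 -> \bar R) : measurable_fun setT f ->
  (forall x, 0 <= f x)%E ->
  (\int[L m.+1]_x f x = \int[mu]_a \int[L m]_v f (cons_rV (a, v)))%E.
Proof.
move=> mf f0; rewrite ge0_integral_rVS // mul1e.
have mfc : measurable_fun setT (fun y => f (@cons_rV R m y)).
  by apply: (measurableT_comp mf); exact: measurable_cons_rV.
by rewrite (fubini_tonelli1 (fun y => f (@cons_rV R m y))).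
Qed.

Lemma measurable_affine_rV m (r : R) (b : 'rV[R]_m) :
  measurable_fun setT (fun v : 'rV[R]_m => r *: v + b).
Proof.
apply: measurable_fun_rV => i.
under eq_fun do rewrite !mxE.
by apply: measurable_funD => //; apply: measurable_funM => //; exact: measurable_coord.
Qed.

Lemma cons_rV_affine m (r : R) (b : 'rV[R]_m.+1) a (v : 'rV[R]_m) :
  r *: cons_rV (a, v) + b =
  cons_rV (r * a + b ord0 ord0, r *: v + \row_j b ord0 (lift ord0 j)).
Proof.
apply/rowP => i; have [j ->|->] := unliftP ord0 i.
  by rewrite [LHS]mxE [X in X + _]mxE !cons_rVS /= !mxE.
by rewrite [LHS]mxE [X in X + _]mxE !cons_rV0.
Qed.

Lemma ge0_integral_rV_affine m (r : R) (b : 'rV[R]_m) : 0 < r ->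
  forall f : 'rV[R]_m -> \bar R, measurable_fun setT f -> (forall x, 0 <= f x)%E ->
  (\int[L m]_x f (r *: x + b)%R = (r^-1 ^+ m)%:E * \int[L m]_x f x)%E.
Proof.
move=> r0; elim: m b => [|m IH] b f mf f0.
  rewrite expr0 mul1e !integral_rV0 //.
    by congr f; rewrite [LHS]thinmx0.
  by apply: (measurableT_comp mf); exact: measurable_affine_rV.
have mfc : measurable_fun setT (fun y => f (@cons_rV R m y)).
  by apply: (measurableT_comp mf); exact: measurable_cons_rV.
pose g (a : R') := (\int[L m]_v f (cons_rV (a, v)))%E.
have mg : measurable_fun setT g.
  exact: (@measurable_fun_fubini_tonelli_F _ _ _ _ _ (L m) (fun y => f (@cons_rV R m y))).
have g0 a : (0 <= g a)%E by exact: integral_ge0.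
rewrite (ge0_integral_rVS2 (f := fun x => f (r *: x + b))) //; last first.
  by apply: (measurableT_comp mf); exact: measurable_affine_rV.
rewrite ge0_integral_rVS2 //.
transitivity (\int[mu]_a ((r^-1 ^+ m)%:E * g (r * a + b ord0 ord0)%R))%E.
  apply: eq_integral => a _; under eq_integral => v _ do rewrite cons_rV_affine.
  apply: (IH _ (fun v => f (cons_rV (r * a + b ord0 ord0, v)))) => //.
  exact: (measurableT_comp mfc (measurable_pair1 _)).
have mp : measurable_fun setT (fun x : R' => (r * x + b ord0 ord0 : R')).
  by apply: measurable_funD => //; exact: measurable_funM.
have gE : (\int[mu]_a \int[L m]_v f (cons_rV (a, v)) = \int[mu]_a g a)%E by [].
rewrite gE; clearbody g.
pose h (a : R') := g (r * a + b ord0 ord0)%R.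
have mh : measurable_fun setT h by exact: (measurableT_comp mg mp).
have h0 a : (0 <= h a)%E by exact: g0.
have Z : (\int[mu]_a ((r^-1 ^+ m)%:E * h a) = (r^-1 ^+ m)%:E * \int[mu]_a h a)%E.
  apply: ge0_integralZl => //.
  by rewrite lee_fin exprn_ge0 // invr_ge0 ltW.
rewrite [LHS]Z /h.
rewrite (@ge0_integral_lebesgue_affine R r (b ord0 ord0) r0 g) //.
by rewrite muleA -EFinM -exprSr.
Qed.

Lemma rV_affine_transfer m (r : R) (b : 'rV[R]_m) : 0 < r ->
  ge0_transfer (L m) (L m) (fun x => r *: x + b) (r ^+ m).
Proof.
move=> r0 f mf f0; rewrite ge0_integral_rV_affine // muleA -EFinM exprVn divff ?mul1e //.
by rewrite expf_neq0 // gt_eqF.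
Qed.

Lemma measurable_row_mx m1 m2 :
  measurable_fun setT (fun p : 'rV[R]_m1 * 'rV[R]_m2 => row_mx p.1 p.2).
Proof.
apply: measurable_fun_rV => i; rewrite -(splitK i); case: (fintype.split i) => j /=.
  rewrite (_ : (fun _ => _) = (fun x : 'rV[R]_m1 => x ord0 j) \o fst).
    by apply: measurableT_comp; [exact: measurable_coord|exact: measurable_fst].
  by apply/funext => p; rewrite /= row_mxEl.
rewrite (_ : (fun _ => _) = (fun x : 'rV[R]_m2 => x ord0 j) \o snd).
  by apply: measurableT_comp; [exact: measurable_coord|exact: measurable_snd].
by apply/funext => p; rewrite /= row_mxEr.
Qed.

Lemma row_mx_cons_rV m1 m2 a (u : 'rV[R]_m1) (v : 'rV[R]_m2) :
  row_mx (cons_rV (a, u)) v = cons_rV (a, row_mx u v) :> 'rV[R]_(m1 + m2).+1.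
Proof.
apply/rowP => i; have [j ->|->] := unliftP ord0 i.
  rewrite cons_rVS /= -(splitK j); case: (fintype.split j) => k /=.
    rewrite (_ : lift ord0 _ = lshift m2 (lift ord0 k)); last exact/val_inj.
    by rewrite (@row_mxEl _ 1 m1.+1) row_mxEl cons_rVS.
  rewrite (_ : lift ord0 _ = rshift m1.+1 k); last exact/val_inj.
  by rewrite (@row_mxEr _ 1 m1.+1) row_mxEr.
rewrite cons_rV0 (_ : ord0 = lshift m2 (ord0 : 'I_m1.+1)); last exact/val_inj.
by rewrite (@row_mxEl _ 1 m1.+1) cons_rV0.
Qed.

Lemma ge0_integral_row_mx m1 m2 (f : 'rV[R]_(m1 + m2) -> \bar R) :
  measurable_fun setT f -> (forall x, 0 <= f x)%E ->
  (\int[L (m1 + m2)]_x f x = \int[L m1]_u \int[L m2]_v f (row_mx u v))%E.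
Proof.
elim: m1 f => [|m1 IH] f mf f0.
  rewrite [in RHS]integral_rV0.
    by apply: eq_integral => v _; rewrite row_thin_mx.
  apply: (@measurable_fun_fubini_tonelli_F _ _ _ _ _ (L m2) (fun p => f (row_mx p.1 p.2))) => //.
  by apply: (measurableT_comp mf); exact: (@measurable_row_mx 0 m2).
rewrite (@ge0_integral_rVS2 (m1 + m2)) // ge0_integral_rVS2; last 2 first.
- apply: (@measurable_fun_fubini_tonelli_F _ _ _ _ _ (L m2) (fun p => f (row_mx p.1 p.2))) => //.
  by apply: (measurableT_comp mf); exact: (@measurable_row_mx m1.+1 m2).
- by move=> u; exact: integral_ge0.
apply: eq_integral => a _.
pose fa (x : 'rV[R]_(m1 + m2)) := f (@cons_rV R (m1 + m2) (a, x)).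
have mfa : measurable_fun setT fa.
  apply: (measurableT_comp mf).
  apply: (measurableT_comp (@measurable_cons_rV R (m1 + m2))).
  exact: measurable_pair1.
have fa0 x : (0 <= fa x)%E by exact: f0.
have -> := IH fa mfa fa0.
by apply: eq_integral => u _; apply: eq_integral => v _; rewrite row_mx_cons_rV.
Qed.

Lemma row_mx_transfer m1 m2 :
  ge0_transfer (L (m1 + m2)) (L m1 \x L m2)%E (fun p => row_mx p.1 p.2) 1.
Proof.
move=> f mf f0; rewrite mul1e ge0_integral_row_mx //.
rewrite (fubini_tonelli1 (fun p => f (row_mx p.1 p.2))) //.
by apply: (measurableT_comp mf); exact: measurable_row_mx.
Qed.

Lemma measurable_prod_rV m (g : 'I_m -> R -> R) : (forall i, measurable_fun setT (g i)) ->
  measurable_fun setT (fun v : 'rV[R]_m => \prod_i g i (v ord0 i)).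
Proof.
move=> mg; apply: measurable_prod => i _.
by apply: (measurableT_comp (mg i)); exact: measurable_coord.
Qed.

Lemma prod_cons_rV m (K : comNzRingType) (g : 'I_m.+1 -> R -> K) a (v : 'rV[R]_m) :
  \prod_i g i (cons_rV (a, v) ord0 i) = g ord0 a * \prod_i g (lift ord0 i) (v ord0 i).
Proof.
rewrite big_ord_recl cons_rV0; congr (_ * _).
by apply: eq_bigr => i _; rewrite cons_rVS.
Qed.

Lemma integrable_prod_rV m (g : 'I_m -> R -> R) :
  (forall i, mu.-integrable setT (EFin \o g i)) ->
  (L m).-integrable setT (EFin \o (fun v : 'rV[R]_m => \prod_i g i (v ord0 i))).
Proof.
elim: m g => [|m IH] g ig.
  rewrite (_ : EFin \o _ = EFin \o cst 1); last first.
    by apply/funext => v /=; rewrite big_ord0.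
  exact: finite_measure_integrable_cst.
have mg i : measurable_fun setT (g i) by apply/measurable_EFinP; exact: measurable_int (ig i).
apply/(integrable_transfer ltr01 (@measurable_cons_rV R m) (@ge0_integral_rVS m)).
  exact: measurable_prod_rV.
have -> : EFin \o ((fun v : 'rV[R]_m.+1 => \prod_i g i (v ord0 i)) \o @cons_rV R m) =
    EFin \o (fun p : R' * 'rV[R]_m => g ord0 p.1 * \prod_i g (lift ord0 i) (p.2 ord0 i)).
  by apply/funext => -[a v] /=; rewrite prod_cons_rV.
by apply: (@integrable_prod _ _ _ _ _ mu (L m) (g ord0) (fun v : 'rV[R]_m => \prod_i g (lift ord0 i) (v ord0 i))) => //;
  exact: (IH (fun i => g (lift ord0 i)) (fun i => ig _)).
Qed.

Lemma cmeas_prod d (T : measurableType d) I (r : seq I) (F : I -> T -> R[i]) :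
  (forall i, cmeas (F i)) -> cmeas (fun x => \prod_(i <- r) F i x).
Proof.
move=> mF; elim: r => [|i r IH].
  by under eq_fun do rewrite big_nil; exact: cmeas_cst.
by under eq_fun do rewrite big_cons; exact: cmeasM.
Qed.

Lemma cmeas_comp d1 d2 (T : measurableType d1) (S : measurableType d2) (f : T -> R[i]) (p : S -> T) :
  cmeas f -> measurable_fun setT p -> cmeas (fun y => f (p y)).
Proof.
by move=> [a b] mp; split; [exact: (measurableT_comp a)|exact: (measurableT_comp b)].
Qed.

Lemma cint_prod_rV m (g : 'I_m -> R' -> R[i]) : (forall i, cintegrable mu (g i)) ->
  cint (L m) (fun v : 'rV[R]_m => \prod_i g i (v ord0 i)) = \prod_i cint mu (g i).
Proof.
elim: m g => [|m IH] g ig.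
  rewrite big_ord0; apply: complexP => /=.
    under eq_Rintegral do rewrite big_ord0 /=.
    by rewrite /Rintegral integral_rV0.
  under eq_Rintegral do rewrite big_ord0 /=.
  by rewrite /Rintegral integral_rV0.
have mg i : cmeas (g i) by exact: cintegrable_meas (ig i).
pose F (p : R' * 'rV[R]_m) := g ord0 p.1 * \prod_(i < m) g (lift ord0 i) (p.2 ord0 i).
have mF : cmeas F.
  apply: cmeasM.
    exact: (cmeas_comp (mg ord0) measurable_fst).
  apply: cmeas_prod => i; apply: (cmeas_comp (mg (lift ord0 i))).
  exact: (measurableT_comp (measurable_coord i) measurable_snd).
have i1 := cintegrable_normc (ig ord0).
have i2 := integrable_prod_rV (fun i => cintegrable_normc (ig (lift ord0 i))).
have FE : (fun v : 'rV[R]_m.+1 => \prod_i g i (v ord0 i)) \o @cons_rV R m = F.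
  by apply/funext => -[a v]; rewrite /= prod_cons_rV.
have bF a v : normc (F (a, v)) <= normc (g ord0 a) * \prod_i normc (g (lift ord0 i) (v ord0 i)).
  by rewrite /F Normc.normcM normc_prod.
have [_ E1] := cfubini_dom mF i1 i2 bF.
have mP : cmeas (fun v : 'rV[R]_m.+1 => \prod_i g i (v ord0 i)).
  by apply: cmeas_prod => i; apply: (cmeas_comp (mg i)); exact: measurable_coord.
have [|_ ->] := cint_transfer ltr01 (@measurable_cons_rV R m) (@ge0_integral_rVS m) mP.
- by rewrite FE; apply: (cintegrable_le mF (integrable_prod i1 i2)) => -[a v]; exact: bF.
rewrite mul1r FE E1 big_ord_recl /=.
rewrite -(IH (fun i => g (lift ord0 i))) //.
transitivity (cint mu (fun a => cint (L m) (fun v : 'rV[R]_m => \prod_i g (lift ord0 i) (v ord0 i)) * g ord0 a)).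
  apply: eq_cint => a; rewrite [RHS]mulrC -cintZ //.
  apply: (@cintegrable_le _ _ _ _ _ (fun v : 'rV[R]_m => \prod_i normc (g (lift ord0 i) (v ord0 i)))) => //.
    by apply: cmeas_prod => i; apply: (cmeas_comp (mg (lift ord0 i))); exact: measurable_coord.
  by move=> v; rewrite normc_prod.
by rewrite cintZ // mulrC.
Qed.

(** The sigma-algebra on row vectors is generated by the coordinates, so open sets must be shown to
    belong to it: each is a countable union of boxes with rational centres and radii 1 / (k + 1). *)
Lemma continuous_measurable_rV m (f : 'rV[R]_m -> R) : continuous f ->
  measurable_fun setT f.
Proof.
move=> cf; apply: (measurability _ (@RGenOpens.measurableE R)) => _ [_ [a [b ->] <-]].
rewrite setTI; set U := _ @^-1` _.
have oU : open U by apply: open_comp => [x _|]; [exact: cf|exact: interval_open].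
pose box (q : 'rV[rat]_m) (k : nat) : set 'rV[R]_m :=
  [set x | forall i, `|x ord0 i - ratr (q ord0 i)| < k.+1%:R^-1].
have -> : U = \bigcup_q \bigcup_(k in [set k | box q k `<=` U]) box q k.
  apply/seteqP; split => [x Ux|x [q _ [k bU]]]; last exact: bU.
  have /nbhs_ballP[e /= e0 eU] : nbhs x U by exact: open_nbhs_nbhs.
  (* Half of e: both x and y are within the radius of the rational centre, and the two distances add
     up. *)
  have [k ke] : exists k : nat, k.+1%:R^-1 < e / 2.
    exists (Num.bound (e / 2)^-1); rewrite invf_plt ?posrE ?divr_gt0 //.
    rewrite (lt_trans (archi_boundP _)) ?invr_ge0 ?divr_ge0 ?(ltW e0) // ltr_nat //.
  have /choice[q hq] : forall i, exists q : rat, `|x ord0 i - ratr q| < k.+1%:R^-1.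
    move=> i.
    have [|q] := @rat_in_itvoo R (x ord0 i - k.+1%:R^-1) (x ord0 i + k.+1%:R^-1).
      by rewrite ltrBlDr -addrA ltrDl addr_gt0 // invr_gt0.
    rewrite in_itv /= => /andP[h1 h2]; exists q.
    by rewrite distrC ltr_distl h1.
  exists (\row_i q i) => //; exists k => /=; last by move=> i; rewrite mxE.
  move=> y yb; apply: eU; split => // i j; rewrite (ord1 i).
  have := yb j; have := hq j; rewrite mxE => h1 h2.
  rewrite /ball /=.
  rewrite (le_lt_trans (ler_distD (ratr (q j)) _ _)) //.
  rewrite [ltRHS](splitr e) ltrD //; first exact: lt_trans h1 ke.
  by rewrite distrC; exact: lt_trans h2 ke.
apply: countable_bigcupT_measurable => [|q]; first exact: countableP.
apply: bigcup_measurable => k _.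
have -> : box q k = \bigcap_i ((fun x : 'rV[R]_m => `|x ord0 i - ratr (q ord0 i)|) @^-1` `]-oo, k.+1%:R^-1[%classic).
  apply/seteqP; split => x /= h i; first by move=> _; rewrite /= in_itv /=; exact: h.
  by have := h i I; rewrite /= in_itv.
apply: fin_bigcap_measurable => // i _.
rewrite -[X in measurable X]setTI.
have mc : measurable_fun setT (fun x : 'rV[R]_m => `|x ord0 i - ratr (q ord0 i)|).
  apply: measurableT_comp => //; apply: measurable_funB => //; exact: measurable_coord.
by apply: mc.
Qed.

End rV_integral.

(** * Integrable weights, the Euclidean norm and exponential decay *)

Section weights.
Context {R : realType}.
Local Notation L := (@lebesgue_rV R).
Local Notation R' := (measurableTypeR R).
Local Notation mu := (@lebesgue_measure R).

Lemma integrable_oneDsqrV : mu.-integrable setT (EFin \o (fun x : R' => (1 + x ^+ 2)^-1)).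
Proof.
have c1 : continuous (fun x : R => (1 + x ^+ 2)^-1) by exact: continuous_oneDsqrV.
have p0 (x : R) : 0 <= (1 + x ^+ 2)^-1 by rewrite invr_ge0 addr_ge0 // sqr_ge0.
apply/integrableP; split.
  by apply/measurable_EFinP; exact: continuous_measurable_fun.
under eq_integral do rewrite gee0_abs ?lee_fin //.
have := @ge0_symfun_integralT R (fun x => (1 + x ^+ 2)^-1) p0 c1.
move=> -> ; last by move=> x /=; rewrite sqrrN.
have -> : [set x : R | 0 <= x] = `[0, +oo[%classic.
  by apply/seteqP; split => x /=; rewrite in_itv /= andbT.
by rewrite (integral0y_oneDsqr R) -EFinM ltry.
Qed.

(** The common integrable majorant on R^m. Its product form, in place of a power of the norm,
    reduces its integral to dimension one and makes it split along [row_mx]. *)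
Definition rV_weight m (v : 'rV[R]_m) : R := \prod_i (1 + v ord0 i ^+ 2)^-1.

Lemma oneDsqr_gt0' (x : R) : 0 < 1 + x ^+ 2.
Proof. by rewrite ltr_wpDr // sqr_ge0. Qed.

Lemma rV_weight_gt0 m (v : 'rV[R]_m) : 0 < rV_weight v.
Proof. by apply: prodr_gt0 => i _; rewrite invr_gt0 oneDsqr_gt0'. Qed.

Lemma integrable_rV_weight m : (L m).-integrable setT (EFin \o @rV_weight m).
Proof.
exact: (@integrable_prod_rV R m (fun _ x => (1 + x ^+ 2)^-1) (fun _ => integrable_oneDsqrV)).
Qed.

Lemma rV_weight_row_mx m1 m2 (u : 'rV[R]_m1) (v : 'rV[R]_m2) :
  rV_weight (row_mx u v) = rV_weight u * rV_weight v.
Proof.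
rewrite /rV_weight big_split_ord /=.
by congr (_ * _); apply: eq_bigr => i _; rewrite ?row_mxEl ?row_mxEr.
Qed.

Lemma eucl_norm_ge0 m (v : 'rV[R]_m) : 0 <= eucl_norm v.
Proof. by rewrite sqrtr_ge0. Qed.

Lemma sqr_eucl_norm m (v : 'rV[R]_m) : eucl_norm v ^+ 2 = \sum_i v ord0 i ^+ 2.
Proof. by rewrite sqr_sqrtr // sumr_ge0 // => i _; rewrite sqr_ge0. Qed.

Lemma eucl_norm_coord m (v : 'rV[R]_m) i : `|v ord0 i| <= eucl_norm v.
Proof.
rewrite -sqrtr_sqr ler_wsqrtr // (bigD1 i) //= lerDl sumr_ge0 // => j _.
exact: sqr_ge0.
Qed.

Lemma eucl_norm0 m : eucl_norm (0 : 'rV[R]_m) = 0.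
Proof. by rewrite /eucl_norm big1 ?sqrtr0 // => i _; rewrite mxE expr0n. Qed.

Lemma eucl_norm_eq0 m (v : 'rV[R]_m) : (eucl_norm v == 0) = (v == 0).
Proof.
apply/eqP/eqP => [h|->]; last exact: eucl_norm0.
apply/rowP => i; rewrite mxE; apply/eqP; rewrite -normr_le0.
by rewrite -h; exact: eucl_norm_coord.
Qed.

Lemma eucl_normZ m (r : R) (v : 'rV[R]_m) : eucl_norm (r *: v) = `|r| * eucl_norm v.
Proof.
rewrite -sqrtr_sqr /eucl_norm -sqrtrM ?sqr_ge0 // mulr_sumr; congr Num.sqrt.
by apply: eq_bigr => i _; rewrite mxE exprMn.
Qed.

Lemma measurable_eucl_norm m : measurable_fun setT (@eucl_norm R m).
Proof.
apply: (measurableT_comp measurable_sqrt).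
apply: measurable_sum => i; apply: measurable_funX; exact: measurable_coord.
Qed.

(** With a = |u| and b = |v|, each term satisfies x y <= (a b / 2) (x^2 / a^2 + y^2 / b^2), the
    difference being a square over 2 a b; the right-hand sides sum to a b. *)
Lemma cauchy_schwarz_rV m (u v : 'rV[R]_m) :
  `|\sum_i u ord0 i * v ord0 i| <= eucl_norm u * eucl_norm v.
Proof.
have [/eqP u0|un] := eqVneq (eucl_norm u) 0.
  rewrite eucl_norm_eq0 in u0; rewrite (eqP u0) big1 ?normr0 ?mulr_ge0 ?eucl_norm_ge0 //.
  by move=> i _; rewrite mxE mul0r.
have [/eqP v0|vn] := eqVneq (eucl_norm v) 0.
  rewrite eucl_norm_eq0 in v0; rewrite (eqP v0) big1 ?normr0 ?mulr_ge0 ?eucl_norm_ge0 //.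
  by move=> i _; rewrite mxE mulr0.
have u0 : 0 < eucl_norm u by rewrite lt_neqAle eq_sym un eucl_norm_ge0.
have v0 : 0 < eucl_norm v by rewrite lt_neqAle eq_sym vn eucl_norm_ge0.
set a := eucl_norm u; set b := eucl_norm v.
rewrite (le_trans (ler_norm_sum _ _ _)) //.
have key i : `|u ord0 i * v ord0 i| <= a * b / 2 * (u ord0 i ^+ 2 / a ^+ 2 + v ord0 i ^+ 2 / b ^+ 2).
  rewrite normrM -(real_normK (num_real (u ord0 i))) -(real_normK (num_real (v ord0 i))).
  set x := `|u _ _|; set y := `|v _ _|.
  have -> : a * b / 2 * (x ^+ 2 / a ^+ 2 + y ^+ 2 / b ^+ 2) =
      x * y + (x * b - y * a) ^+ 2 / (2 * a * b).
    by field; rewrite un vn.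
  by rewrite lerDl mulr_ge0 ?sqr_ge0 // invr_ge0 !mulr_ge0 // ltW.
rewrite (le_trans (ler_sum _ (fun i _ => key i))) //.
rewrite -mulr_sumr big_split /= -!mulr_suml -!sqr_eucl_norm !divff ?expf_neq0 //.
by have -> : a * b / 2 * (1 + 1) = a * b by field.
Qed.

Lemma exprn_le_expR (k : nat) (c : R) : 0 < c ->
  exists C : R, 0 < C /\ forall x : R, 0 <= x -> x ^+ k <= C * expR (c * x).
Proof.
move=> c0; case: k => [|k].
  by exists 1; split => // x x0; rewrite expr0 mul1r -expR0 ler_expR mulr_ge0 // ltW.
exists (k.+1`!%:R / c ^+ k.+1); split; first by rewrite divr_gt0 ?exprn_gt0 // ltr0n fact_gt0.
move=> x x0.
have h := @expR_ge1Dxn R (c * x) k (mulr_ge0 (ltW c0) x0).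
have f0 : 0 < k.+1`!%:R :> R by rewrite ltr0n fact_gt0.
have : (c * x) ^+ k.+1 / k.+1`!%:R <= expR (c * x).
  by apply: le_trans h; rewrite lerDr.
rewrite ler_pdivrMr // exprMn => h2.
by rewrite mulrAC ler_pdivlMr ?exprn_gt0 // mulrC [_%:R * _]mulrC.
Qed.

Lemma exprn_expRN_le (k : nat) (c : R) : 0 < c ->
  exists C : R, 0 < C /\ forall x : R, 0 <= x -> x ^+ k * expR (- (c * x)) <= C.
Proof.
move=> c0; have [C [C0 h]] := exprn_le_expR k c0; exists C; split => // x x0.
by rewrite expRN ler_pdivrMr ?expR_gt0 // h.
Qed.

Lemma poly_expRN_le (k : nat) (c : R) : 0 < c ->
  exists C : R, 0 < C /\ forall x : R, 0 <= x -> (1 + x) ^+ k * expR (- (c * x)) <= C.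
Proof.
move=> c0; have [C [C0 h]] := exprn_expRN_le k c0.
exists (C * expR c); split; first by rewrite mulr_gt0 // expR_gt0.
move=> x x0; have := h (1 + x) (addr_ge0 ler01 x0).
have -> : expR (- (c * x)) = expR (- (c * (1 + x))) * expR c.
  by rewrite -expRD; congr expR; ring.
by rewrite mulrA ler_pM2r ?expR_gt0.
Qed.

Lemma rV_weightV_le m (v : 'rV[R]_m) : (rV_weight v)^-1 <= (1 + eucl_norm v) ^+ (2 * m).
Proof.
have -> : (1 + eucl_norm v) ^+ (2 * m) = \prod_(i < m) (1 + eucl_norm v) ^+ 2.
  by rewrite prodr_const card_ord exprM.
rewrite /rV_weight prodfV invrK.
apply: ler_prod => i _; rewrite ltW ?oneDsqr_gt0' //=.
have h := eucl_norm_coord v i.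
rewrite -(real_normK (num_real (v ord0 i))) sqrrD expr1n mul1r.
rewrite -addrA lerD2l (le_trans _ (_ : eucl_norm v ^+ 2 <= _)) //.
  by rewrite ler_pXn2r ?nnegrE // eucl_norm_ge0.
by rewrite lerDr mulrn_wge0 // eucl_norm_ge0.
Qed.

Lemma expR_eucl_norm_le m k (c : R) : 0 < c ->
  exists C : R, 0 < C /\ forall v : 'rV[R]_m,
    (1 + eucl_norm v) ^+ k * expR (- (c * eucl_norm v)) <= C * rV_weight v.
Proof.
move=> c0; have [C [C0 h]] := poly_expRN_le (2 * m + k) c0; exists C; split => // v.
have w0 := rV_weight_gt0 v.
rewrite -ler_pdivrMr // mulrC; apply: le_trans (h _ (eucl_norm_ge0 v)).
rewrite exprD -mulrA ler_wpM2r ?rV_weightV_le // mulr_ge0 ?expR_ge0 // exprn_ge0 //.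
by rewrite addr_ge0 // eucl_norm_ge0.
Qed.

Lemma expR_sqr_le k (c : R) : 0 < c ->
  exists C : R, 0 < C /\ forall x : R, (1 + `|x|) ^+ k * expR (- (c * x ^+ 2)) <= C / (1 + x ^+ 2).
Proof.
move=> c0; have [C [C0 h]] := poly_expRN_le (k + 2) c0.
exists (C * expR c); split; first by rewrite mulr_gt0 // expR_gt0.
move=> x; rewrite ler_pdivlMr ?oneDsqr_gt0' //.
apply: (@le_trans _ _ ((1 + `|x|) ^+ (k + 2) * expR (- (c * `|x|)) * expR c)); last first.
  by rewrite ler_pM2r ?expR_gt0 // h.
set y := `|x|; have y0 : 0 <= y by rewrite normr_ge0.
have xy : x ^+ 2 = y ^+ 2 by rewrite real_normK // num_real.
have h1 : 1 + x ^+ 2 <= (1 + y) ^+ 2.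
  by rewrite xy sqrrD expr1n mul1r addrAC lerDl mulrn_wge0.
(* From y <= y^2 + 1: a Gaussian is at most a constant times an exponential. *)
have h2 : expR (- (c * x ^+ 2)) <= expR (- (c * y)) * expR c.
  rewrite -expRD ler_expR xy.
  have : c * y <= c * (y ^+ 2 + 1).
    rewrite ler_pM2l //.
    have : 0 <= (y - 1) ^+ 2 by exact: sqr_ge0.
    have : 0 <= y ^+ 2 by exact: sqr_ge0.
    rewrite sqrrB1; lra.
  lra.
have h3 := ler_pM (ltW (oneDsqr_gt0' x)) (expR_ge0 _) h1 h2.
rewrite exprD -!mulrA ler_wpM2l ?exprn_ge0 ?addr_ge0 //.
by rewrite mulrC [in leRHS]mulrA -expr2.
Qed.

End weights.

(** * Rotation of homogeneous oscillatory integrals *)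

Section rotation.
Context {R : realType}.

Lemma is_derive_mull (c x : R) : is_derive x (1 : R) (fun t => c * t) c.
Proof.
apply: (is_derive_eq (is_deriveM (is_derive_cst c x (1 : R)) (is_derive_id x (1 : R)))).
by rewrite /GRing.scale /= mulr0 addr0 mulr1.
Qed.

Lemma is_derive_near_eq (f g : R -> R) (u a v l : R) : u < a < v ->
  (forall x, u < x < v -> f x = g x) -> is_derive a (1 : R) f l -> is_derive a (1 : R) g l.
Proof.
move=> auv fg; apply: near_eq_is_derive.
have : a \in `]u, v[ by rewrite in_itv.
move=> /near_in_itvoo; apply: filterS => x.
by rewrite in_itv /= => /fg.
Qed.

Lemma is_cderive_near_eq (f g : R -> R[i]) (u a v : R) l : u < a < v ->
  (forall x, u < x < v -> f x = g x) -> is_cderive f a l -> is_cderive g a l.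
Proof.
move=> auv fg [h1 h2]; split.
  by apply: (is_derive_near_eq auv _ h1) => x /fg ->.
by apply: (is_derive_near_eq auv _ h2) => x /fg ->.
Qed.

Lemma is_cderive_cis (x : R) : is_cderive (@cis R) x ('i%C * cis x).
Proof.
split; rewrite !cplxE /= ?mul0r ?mul1r ?add0r ?sub0r.
  exact: is_derive_cos.
exact: is_derive_sin.
Qed.

Lemma is_cderive_id (x : R) : is_cderive (fun t : R => t%:C) x 1.
Proof. by apply: is_cderive_real; exact: is_derive_id. Qed.

(** Covers three parameters that enter through a factor z x of the phase: the angle (z = cis), the
    dilation of the phase (z = r cis t) and the Fourier variable of a Gaussian (z = x). *)
Lemma is_cderive_cint_cexp d (T : measurableType d) (mu : {measure set T -> \bar R})
    (V X : T -> R[i]) (z z' : R -> R[i]) (B : R) (G0 G1 : T -> R) (u a v : R) :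
  u < a < v -> cmeas V -> cmeas X ->
  (forall x, u < x < v -> is_cderive z x (z' x)) ->
  (forall x, u < x < v -> normc (z' x) <= B) ->
  mu.-integrable setT (EFin \o G0) -> mu.-integrable setT (EFin \o G1) ->
  (forall x y, u < x < v -> normc (V y * cexp (- (z x * X y))) <= G0 y) ->
  (forall x y, u < x < v -> normc (X y * (V y * cexp (- (z x * X y)))) <= G1 y) ->
  is_cderive (fun x => cint mu (fun y => V y * cexp (- (z x * X y)))) a
    (- z' a * cint mu (fun y => X y * (V y * cexp (- (z a * X y))))).
Proof.
move=> auv mV mX dz Bz i0 i1 b0 b1.
have mE x : cmeas (fun y => V y * cexp (- (z x * X y))).
  apply: cmeasM => //; apply: cmeas_cexp.
  rewrite (_ : (fun y => _) = (fun y => (- z x) * X y)); last by apply/funext => y; rewrite mulNr.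
  by apply: cmeasM => //; exact: cmeas_cst.
rewrite -cintZ; last first.
  by apply: (cintegrable_le _ i1) => [|y]; [exact: cmeasM|exact: b1].
apply: (is_cderive_cint (f' := fun x y => - z' x * (X y * (V y * cexp (- (z x * X y)))))
  (G := fun y => B * G1 y) auv).
- by move=> x xuv; apply: (cintegrable_le (mE x) i0) => y; exact: b0.
- move=> x y xuv.
  have h := is_cderiveM (is_cderive_cst (- X y) x) (dz x xuv).
  have := is_cderiveZ (V y) (is_cderive_cexp h).
  rewrite mul0r add0r /=.
  rewrite (_ : (fun t => V y * cexp (- X y * z t)) = (fun x => V y * cexp (- (z x * X y)))); last first.
    by apply/funext => t; rewrite mulNr mulrC [X y * _]mulrC mulrC.
  rewrite (_ : V y * _ = - z' x * (X y * (V y * cexp (- (z x * X y))))) //.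
  by rewrite [z x * X y]mulrC -[- (X y * z x)]mulNr; ring.
- exact: integrable_RZ.
- move=> x y xuv; rewrite Normc.normcM normcN.
  by apply: ler_pM; [exact: normc_ge0|exact: normc_ge0|exact: Bz|exact: b1].
Qed.

(** If Re w >= M and |Im w| <= C M, then turning w by an angle below e leaves a real part of at
    least 3 M / 4 - M / 4 = M / 2. The size of e depends on C alone. *)
Lemma cos_sin_near0 (C : R) : exists e : R, 0 < e /\
  forall h, `|h| < e -> 3 / 4 <= cos h /\ C * `|sin h| <= 1 / 4.
Proof.
have c1 := @continuous_cos R 0; have c2 := @continuous_sin R 0.
rewrite /continuous_at cos0 in c1; rewrite /continuous_at sin0 in c2.
have C0 : 0 < 1 / (4 * (`|C| + 1)).
  by rewrite divr_gt0 // mulr_gt0 // ltr_pwDr.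
have q0 : 0 < 1 / 4 :> R by rewrite divr_gt0.
move/cvgrPdist_lt : c1 => /(_ _ q0) n1.
move/cvgrPdist_lt : c2 => /(_ _ C0) n2.
have /nbhs_ballP[e /= e0 h] : nbhs (0 : R) ([set t | `|1 - cos t| < 1 / 4] `&`
    [set t | `|0 - sin t| < 1 / (4 * (`|C| + 1))]) by exact: filterI.
exists e; split => // t te.
have [] := h t; first by rewrite /ball /= sub0r normrN.
move=> h1 h2; split.
  by move: h1 => /=; rewrite ltr_norml => /andP[_]; lra.
move: h2 => /=; rewrite sub0r normrN ltr_pdivlMr ?mulr_gt0 ?ltr_pwDr // => h2.
have : C * `|sin t| <= (`|C| + 1) * `|sin t|.
  by rewrite ler_wpM2r // (le_trans (ler_norm _)) // lerDl.
lra.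
Qed.

(* Let F t be the integral at angle t and J t the one with an extra factor X y.
   Differentiating the scaling hypothesis at r = 1 gives cis t * J t = N * F t,
   whence F' = - i * cis t * J = - i * N * F. *)
Lemma rotation_eq d (T : measurableType d) (mu : {measure set T -> \bar R})
    (W M : T -> R) (X : T -> R[i]) (C N t0 t1 : R) :
  measurable_fun setT W -> (forall y, 0 <= W y) -> (forall y, 0 <= M y) -> cmeas X ->
  (forall c, 0 < c -> mu.-integrable setT (EFin \o (fun y => W y * expR (- (c * M y))))) ->
  (forall y, normc (X y) <= C * M y) ->
  (forall t y, t0 <= t <= t1 -> M y <= Re (cis t * X y)) ->
  (forall t r, t0 <= t <= t1 -> 0 < r ->
    cint mu (fun y => (W y)%:C * cexp (- (r%:C * cis t * X y))) =
    (r `^ (- N))%:C * cint mu (fun y => (W y)%:C * cexp (- (cis t * X y)))) ->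
  t0 <= t1 ->
  cint mu (fun y => (W y)%:C * cexp (- (cis t1 * X y))) =
  cis (- (N * (t1 - t0))) * cint mu (fun y => (W y)%:C * cexp (- (cis t0 * X y))).
Proof.
move=> mW W0 M0 mX iW XC ReX sc t01.
pose F t := cint mu (fun y => (W y)%:C * cexp (- (cis t * X y))).
pose J t := cint mu (fun y => X y * ((W y)%:C * cexp (- (cis t * X y)))).
have q4 : 0 < 1 / 4 :> R by rewrite divr_gt0.
have [K [K0 hK]] := @exprn_expRN_le R 1 _ q4.
(* Derivatives at t require a domination for all nearby angles, also outside [t0, t1], where only
   the lower bound M / 2 is left. [G1] spends half of that decay on the additional factor X. *)
pose G0 y := W y * expR (- (1 / 2 * M y)).
pose G1 y := (`|C| * K) * (W y * expR (- (1 / 4 * M y))).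
have i0 : mu.-integrable setT (EFin \o G0) by apply: iW; rewrite divr_gt0.
have i1 : mu.-integrable setT (EFin \o G1).
  by apply: integrable_RZ; apply: iW; rewrite divr_gt0.
have b0 (z : R[i]) y : M y / 2 <= Re (z * X y) ->
    normc ((W y)%:C * cexp (- (z * X y))) <= G0 y.
  move=> h; rewrite Normc.normcM normc_real ger0_norm // normc_cexp ler_wpM2l //.
  by rewrite ler_expR ReN lerN2; lra.
have b1 (z : R[i]) y : M y / 2 <= Re (z * X y) ->
    normc (X y * ((W y)%:C * cexp (- (z * X y)))) <= G1 y.
  move=> h; rewrite Normc.normcM.
  apply: le_trans (ler_pM (normc_ge0 _) (normc_ge0 _) (XC y) (b0 z y h)) _.
  rewrite /G0 /G1.
  have -> : expR (- (1 / 2 * M y)) = expR (- (1 / 4 * M y)) * expR (- (1 / 4 * M y)).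
    by rewrite -expRD; congr expR; lra.
  have hy := hK (M y) (M0 y); rewrite expr1 in hy.
  set E := expR _ in hy *.
  have E0 : 0 <= E by exact: expR_ge0.
  rewrite (_ : C * M y * (W y * (E * E)) = C * (M y * E) * (W y * E)); last by ring.
  rewrite ler_wpM2r ?mulr_ge0 //.
  apply: (@le_trans _ _ (`|C| * (M y * E))).
    by rewrite ler_wpM2r ?mulr_ge0 // ler_norm.
  by rewrite ler_wpM2l.
have [e [e0 he]] := cos_sin_near0 C.
have near_t t x y : t0 <= t <= t1 -> t - e < x < t + e -> M y / 2 <= Re (cis x * X y).
  move=> tt /andP[x1 x2].
  have [|c1 c2] := he (x - t); first by rewrite ltr_norml; apply/andP; split; lra.
  have -> : cis x = cis (x - t) * cis t by rewrite -cisD subrK.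
  rewrite -mulrA ReM /=; set w := cis t * X y.
  have w1 : M y <= Re w by exact: ReX.
  have w2 : `|Im w| <= C * M y.
    apply: le_trans (normIm_le _) _; rewrite Normc.normcM normc_cis mul1r; exact: XC.
  have s1 : sin (x - t) * Im w <= M y / 4.
    apply: le_trans (ler_norm _) _; rewrite normrM.
    apply: (@le_trans _ _ (`|sin (x - t)| * (C * M y))); first by rewrite ler_wpM2l.
    rewrite mulrA [_ * C]mulrC (le_trans (ler_wpM2r (M0 y) c2)) //; lra.
  have s2 : 3 / 4 * M y <= cos (x - t) * Re w.
    by apply: ler_pM => //; rewrite ?divr_ge0.
  have := M0 y; lra.
have mWC : cmeas (fun y => (W y)%:C) by exact: cmeas_real.
have dF t : t0 <= t <= t1 -> is_cderive F t (- ('i%C * cis t) * J t).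
  move=> tt.
  apply: (@is_cderive_cint_cexp _ _ mu (fun y => (W y)%:C) X (@cis R)
     (fun t => 'i%C * cis t) 1 G0 G1 (t - e) t (t + e)) => //.
  - by apply/andP; split; lra.
  - by move=> x _; exact: is_cderive_cis.
  - by move=> x _; rewrite Normc.normcM normc_cis mulr1 normcE /= expr0n expr1n /= add0r sqrtr1.
  - by move=> x y xt; apply: b0; exact: near_t tt xt.
  - by move=> x y xt; apply: b1; exact: near_t tt xt.
have dr t : t0 <= t <= t1 -> cis t * J t = N%:C * F t.
  move=> tt.
  have hx x y : 1 / 2 < x < 2 -> M y / 2 <= Re (x%:C * cis t * X y).
    move=> /andP[x1 x2]; rewrite -mulrA ReM /= mul0r subr0.
    apply: (@le_trans _ _ (x * M y)); last by rewrite ler_pM2l ?ReX //; lra.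
    by rewrite mulrC ler_wpM2r //; lra.
  have h1 : is_cderive (fun r : R => cint mu (fun y => (W y)%:C * cexp (- (r%:C * cis t * X y)))) 1
      (- cis t * cint mu (fun y => X y * ((W y)%:C * cexp (- (1%:C * cis t * X y))))).
    apply: (@is_cderive_cint_cexp _ _ mu (fun y => (W y)%:C) X (fun r => r%:C * cis t)
      (fun=> cis t) 1 G0 G1 (1 / 2) 1 2) => //.
    - by apply/andP; split; lra.
    - move=> x _; have := is_cderiveM (is_cderive_id x) (is_cderive_cst (cis t) x).
      by rewrite mulr0 addr0 mul1r.
    - by move=> x _; rewrite normc_cis.
    - by move=> x y xx; apply: b0; exact: hx.
    - by move=> x y xx; apply: b1; exact: hx.
  have h2 : is_cderive (fun r : R => cint mu (fun y => (W y)%:C * cexp (- (r%:C * cis t * X y)))) 1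
      ((- N)%:C * F t).
    have p1 := is_derive1_powR (- N) (@ltr01 R).
    have := is_cderiveM (is_cderive_real p1) (is_cderive_cst (F t) 1).
    rewrite powR1 mulr1 mulr0 addr0.
    apply: (@is_cderive_near_eq _ _ 0 1 2); first by apply/andP; split; lra.
    by move=> x /andP[x0 _]; rewrite [RHS]sc.
  have := is_cderive_unique h1 h2.
  rewrite rmorphN !mulNr => /eqP; rewrite eqr_opp => /eqP <-.
  by congr (_ * _); apply: eq_cint => y; rewrite mul1r.
have dcis (x : R) : is_cderive (fun x => cis (N * x)) x (N%:C * ('i%C * cis (N * x))).
  have dN : is_derive x (1 : R) (fun x => N * x) N.
    exact: is_derive_mull.
  split; rewrite !cplxE /= ?mul0r ?mul1r ?add0r ?sub0r ?addr0.
    apply: (is_derive_eq (is_derive1_comp (is_derive_cos (N * x)) dN)).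
    by ring.
  apply: (is_derive_eq (is_derive1_comp (is_derive_sin (N * x)) dN)).
  by ring.
have E : cis (N * t0) * F t0 = cis (N * t1) * F t1.
  apply: (is_cderive0_eq (u := fun t => cis (N * t) * F t) t01) => x xt.
  have e1 : - ('i%C * cis x) * J x = - ('i%C * (N%:C * F x)).
    by rewrite mulNr -mulrA dr.
  have := is_cderiveM (dcis x) (dF x xt).
  by rewrite e1 (_ : _ + _ = 0) //; ring.
have -> : - (N * (t1 - t0)) = - (N * t1) + N * t0 by ring.
by rewrite cisD -/(F t0) -mulrA E mulrA cisNK mul1r.
Qed.

End rotation.

(** * Complex Gaussians and their Fourier transform *)

Section gaussian.
Context {R : realType}.
Local Notation R' := (measurableTypeR R).
Local Notation mu := (@lebesgue_measure R).

Lemma lebesgue_affine_transfer (r b : R) : 0 < r ->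
  ge0_transfer mu mu (fun x : R' => r * x + b : R') r.
Proof.
move=> r0 f mf f0; rewrite (@ge0_integral_lebesgue_affine R r b r0 f) //.
by rewrite muleA -EFinM divff ?mul1e // gt_eqF.
Qed.

Lemma normc_cis_polar (a : R[i]) : 0 < Re a ->
  exists2 t : R, - (pi / 2) < t < pi / 2 & a = (normc a)%:C * cis t.
Proof.
move=> a0; exists (atan (Im a / Re a)); first by rewrite atan_gtNpi2 atan_ltpi2.
set y := Im a / Re a.
have s0 : 0 < Num.sqrt (1 + y ^+ 2) by rewrite sqrtr_gt0 oneDsqr_gt0'.
have c0 : cos (atan y) = (Num.sqrt (1 + y ^+ 2))^-1 by exact: cos_atan.
have s1 : sin (atan y) = y * cos (atan y).
  have h := atanK y; rewrite /tan in h.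
  by rewrite -{2}h divfK // c0 invr_neq0 // gt_eqF.
have n0 : normc a = Re a * Num.sqrt (1 + y ^+ 2).
  rewrite normcE -{2}(ger0_norm (ltW a0)) -sqrtr_sqr -sqrtrM ?sqr_ge0 //; congr Num.sqrt.
  by rewrite /y; field; rewrite gt_eqF.
apply: complexP; rewrite cplxE /= mul0r ?subr0 ?addr0 ?s1 c0 n0.
  by rewrite mulfK // gt_eqF.
move: s0; set S := Num.sqrt _ => s0.
by rewrite /y; field; rewrite !gt_eqF.
Qed.

Lemma cmeas_gauss (a : R[i]) : cmeas (fun x : R' => cexp (- (a * (x ^+ 2)%:C))).
Proof.
apply: cmeas_cexp; rewrite (_ : (fun x => _) = (fun x : R' => (- a) * (x ^+ 2)%:C)).
  by apply: cmeasM; [exact: cmeas_cst|apply: cmeas_real; exact: measurable_funX].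
by apply/funext => x; rewrite mulNr.
Qed.

Lemma normc_gauss (a : R[i]) (x : R) :
  normc (cexp (- (a * (x ^+ 2)%:C))) = expR (- (Re a * x ^+ 2)).
Proof. by rewrite normc_cexp ReN ReM /= mulr0 subr0. Qed.

Lemma integrable_expRN_sqr (k : nat) (c : R) : 0 < c ->
  mu.-integrable setT (EFin \o (fun x : R' => (1 + `|x|) ^+ k * expR (- (c * x ^+ 2)))).
Proof.
move=> c0; have [C [C0 h]] := @expR_sqr_le R k c c0.
apply: le_integrable (integrable_RZ C (@integrable_oneDsqrV R)) => //.
  apply/measurable_EFinP; apply: measurable_funM.
    by apply: measurable_funX; apply: measurable_funD => //; exact: measurableT_comp.
  apply: measurableT_comp => //; apply: measurableT_comp => //.
  by apply: measurable_funM => //; exact: measurable_funX.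
move=> x _ /=; rewrite lee_fin ger0_norm ?mulr_ge0 ?expR_ge0 ?exprn_ge0 ?addr_ge0 //.
by rewrite (le_trans (h x)) // ler_norm.
Qed.

Lemma cintegrable_gauss (a : R[i]) : 0 < Re a ->
  cintegrable mu (fun x : R' => cexp (- (a * (x ^+ 2)%:C))).
Proof.
move=> a0; apply: (cintegrable_le (cmeas_gauss a) (integrable_expRN_sqr 0 a0)) => x.
by rewrite normc_gauss expr0 mul1r.
Qed.

Definition gaussI (a : R[i]) := cint mu (fun x : R' => cexp (- (a * (x ^+ 2)%:C))).

Lemma gaussI_scale (a : R[i]) (r : R) : 0 < Re a -> 0 < r ->
  gaussI (r%:C * a) = (r `^ (- (1 / 2)))%:C * gaussI a.
Proof.
move=> a0 r0; have s0 : 0 < Num.sqrt r by rewrite sqrtr_gt0.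
have mp : measurable_fun setT (fun x : R' => Num.sqrt r * x + 0 : R').
  by apply: measurable_funD => //; exact: measurable_funM.
have E (x : R) : r%:C * a * (x ^+ 2)%:C = a * ((Num.sqrt r * x + 0) ^+ 2)%:C.
  by rewrite addr0 exprMn sqr_sqrtr ?(ltW r0) // rmorphM /=; ring.
have [|_ h] := cint_transfer s0 mp (lebesgue_affine_transfer 0 s0) (cmeas_gauss a).
  rewrite (_ : _ \o _ = (fun x : R' => cexp (- (r%:C * a * (x ^+ 2)%:C)))).
    by apply: cintegrable_gauss; rewrite ReM /= mul0r subr0 mulr_gt0.
  by apply/funext => x; rewrite E.
rewrite {2}/gaussI h mulrA -rmorphM /=.
have -> : r `^ (- (1 / 2)) * Num.sqrt r = 1.
  rewrite powRN mul1r powR12_sqrt ?(ltW r0) // mulVf // gt_eqF //.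
by rewrite mul1r; apply: eq_cint => x /=; rewrite E.
Qed.

Lemma gaussI_real (r : R) : 0 < r -> gaussI r%:C = (Num.sqrt (pi / r))%:C.
Proof.
move=> r0.
have g1 : gaussI 1 = (Num.sqrt pi)%:C.
  have E (x : R) : cexp (- (1 * (x ^+ 2)%:C)) = (gauss_fun x)%:C.
    by rewrite mul1r -rmorphN /= cexp_real.
  rewrite /gaussI (eq_cint mu E); apply: complexP => /=; rewrite /Rintegral.
    by rewrite integralT_gauss.
  by rewrite integral0.
rewrite -[r%:C]mulr1 gaussI_scale //= ?ltr01 // g1 -rmorphM; congr (_%:C).
by rewrite powRN mul1r powR12_sqrt ?(ltW r0) // sqrtrM ?pi_ge0 // sqrtrV ?(ltW r0) // mulrC.
Qed.

Lemma le_cos_le (x y : R) : 0 <= x -> x <= y -> y <= pi -> cos y <= cos x.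
Proof.
move=> x0; rewrite le_eqVlt => /predU1P[-> //|xy] yp.
rewrite ltW // ltr_cos // in_itv /= ?yp ?x0 /= ?(le_trans x0 (ltW xy)) //.
by rewrite (le_trans (ltW xy)).
Qed.

(** By [gaussI_scale] the Gaussian integral is homogeneous of degree -1/2 in a, so [rotation_eq]
    moves a to the positive real axis at the cost of a factor of modulus 1. *)
Lemma normc_gaussI (a : R[i]) : 0 < Re a -> normc (gaussI a) = Num.sqrt (pi / normc a).
Proof.
move=> a0; have [t /andP[t1 t2] ea] := normc_cis_polar a0.
have n0 : 0 < normc a.
  by rewrite (lt_le_trans a0) // (le_trans (ler_norm _)) // normRe_le.
have p0 := pi_ge0 R.
have cpos : 0 < cos t by apply: cos_gt0_pihalf; rewrite t1.
pose w (y : R') := y ^+ 2.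
(* Along the arc from the real axis to the argument t of a, the cosine is smallest at t; this gives
   the lower bound cos t * y^2 for the real part of the phase. *)
have key (u v : R) : u <= v -> (forall x, u <= x <= v -> cos t <= cos x) ->
    gaussI (cis v) = cis (- (1 / 2 * (v - u))) * gaussI (cis u).
  move=> uv h.
  have := @rotation_eq R _ R' mu (fun=> 1) (fun y => cos t * y ^+ 2) (fun y => (y ^+ 2)%:C)
    (cos t)^-1 (1 / 2) u v.
  rewrite /gaussI; under eq_cint do rewrite mul1r.
  move=> -> //.
  - by under eq_cint do rewrite mul1r.
  - by move=> y; rewrite mulr_ge0 ?sqr_ge0 // ltW.
  - by apply: cmeas_real; exact: measurable_funX.
  - move=> c c0; have := integrable_expRN_sqr 0 (mulr_gt0 c0 cpos).
    have e (y : R) : (1 + `|y|) ^+ 0 * expR (- (c * cos t * y ^+ 2)) =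
        1 * expR (- (c * (cos t * y ^+ 2))) by rewrite expr0 -[in LHS]mulrA.
    by apply: eq_integrable => // x _; congr EFin; exact: e.
  - by move=> y; rewrite normc_real ger0_norm ?sqr_ge0 // mulrA mulVf ?gt_eqF // mul1r.
  - move=> x y xuv; rewrite ReM /= mulr0 subr0 ler_wpM2r ?sqr_ge0 //.
    exact: h.
  - move=> x r xuv r0.
    under eq_cint do rewrite mul1r.
    under [in RHS]eq_cint do rewrite mul1r.
    by apply: gaussI_scale => //=; exact: lt_le_trans (h x xuv).
have g0 : gaussI (cis 0) = (Num.sqrt pi)%:C by rewrite cis0 gaussI_real // divr1.
have gt : normc (gaussI (cis t)) = Num.sqrt pi.
  have [t0|t0] := leP 0 t.
    rewrite (key 0 t) // ?Normc.normcM ?normc_cis ?mul1r ?g0 ?normc_real ?ger0_norm ?sqrtr_ge0 //.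
    by move=> x /andP[x0 xt]; apply: le_cos_le => //; lra.
  have := key t 0 (ltW t0).
  rewrite g0 => /(_ _)/(congr1 (@Normc.normc R)).
  rewrite Normc.normcM normc_cis mul1r normc_real ger0_norm ?sqrtr_ge0 // => -> //.
  by move=> x /andP[x0 xt]; rewrite -(cosN t) -(cosN x); apply: le_cos_le; lra.
rewrite {1}ea (gaussI_scale (a := cis t) cpos n0) Normc.normcM normc_real ger0_norm ?powR_ge0 // gt.
by rewrite powRN mul1r powR12_sqrt ?(ltW n0) // [RHS]sqrtrM ?pi_ge0 // sqrtrV ?(ltW n0) // mulrC.
Qed.

Lemma Re_cint d (T : measurableType d) (nu : {measure set T -> \bar R}) f :
  Re (cint nu f) = \int[nu]_x Re (f x).
Proof. by []. Qed.

Lemma Im_cint d (T : measurableType d) (nu : {measure set T -> \bar R}) f :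
  Im (cint nu f) = \int[nu]_x Im (f x).
Proof. by []. Qed.

Lemma Re_conj (z : R[i]) : Re z^* = Re z.
Proof. by case: z. Qed.

Lemma Im_conj (z : R[i]) : Im z^* = - Im z.
Proof. by case: z. Qed.

(** The coefficients of x_j and x_(n+j) are conjugate to each other. Their Gaussian integrals are
    conjugate too, so the product is a squared modulus and no branch of the complex square root has
    to be chosen. *)
Lemma gaussI_mulJ (a b : R) : 0 < a ->
  gaussI (a -i* b) * gaussI (a +i* b) = (pi / normc (a +i* b))%:C.
Proof.
move=> a0.
have E (x : R) : cexp (- ((a -i* b) * (x ^+ 2)%:C)) = (cexp (- ((a +i* b) * (x ^+ 2)%:C)))^*.
  rewrite /cexp; apply: complexP; rewrite !cplxE /= ?mulr0 ?subr0 ?add0r ?mul0r ?subr0 ?addr0 //.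
    by rewrite mulNr !opprK cosN.
  by rewrite mulNr !opprK sinN mulrN opprK.
have -> : gaussI (a -i* b) = (gaussI (a +i* b))^*.
  rewrite /gaussI (eq_cint mu E); apply: complexP.
    by rewrite Re_conj !Re_cint; apply: eq_Rintegral => x _; exact: Re_conj.
  have [_ h] := @cintegrable_gauss (a +i* b) a0.
  rewrite Im_conj !Im_cint -mulN1r -(RintegralZl (-1) measurableT h).
  by apply: eq_Rintegral => x _; rewrite mulN1r; exact: Im_conj.
have := @normc_gaussI (a +i* b) a0 => /(congr1 (fun x => x ^+ 2)).
rewrite sqr_sqrtr ?divr_ge0 ?pi_ge0 ?normc_ge0 // sqr_normcE => <-.
by case: (gaussI _) => u v /=; apply: complexP => /=; ring.
Qed.

End gaussian.

(** * The Fourier transform of a complex Gaussian in one variable *)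

Section gaussian_fourier.
Context {R : realType}.
Local Notation R' := (measurableTypeR R).
Local Notation mu := (@lebesgue_measure R).

Lemma is_cderive_continuous (f f' : R -> R[i]) : (forall x, is_cderive f x (f' x)) ->
  continuous (fun x : R => Re (f x)) /\ continuous (fun x : R => Im (f x)).
Proof.
move=> df; split=> x; apply/differentiable_continuous/derivable1_diffP.
  by case: (df x) => -[].
by case: (df x) => _ -[].
Qed.

Lemma cint_derive_eq0 (f f' f'' : R -> R[i]) : (forall x, is_cderive f x (f' x)) ->
  (forall x, is_cderive f' x (f'' x)) -> cintegrable mu f' ->
  ccvg (fun k => f k%:R) 0 -> ccvg (fun k => f (- k%:R)) 0 -> cint mu f' = 0.
Proof.
move=> d1 d2 [i1 i2] [a1 a2] [b1 b2].
have [c1 c2] := is_cderive_continuous d2.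
apply: complexP.
  apply: (@Rintegral_derive_eq0 R (fun x => Re (f x)) (fun x => Re (f' x))) => //.
  by move=> x; case: (d1 x).
apply: (@Rintegral_derive_eq0 R (fun x => Im (f x)) (fun x => Im (f' x))) => //.
by move=> x; case: (d1 x).
Qed.

Lemma ccvg0_norm (u : nat -> R[i]) (g : nat -> R) :
  (forall k, normc (u k) <= g k) -> g @ \oo --> (0 : R) -> ccvg u 0.
Proof.
move=> ug g0.
have main (p : R[i] -> R) : (forall z, `|p z| <= normc z) -> (fun k => p (u k)) @ \oo --> (0 : R).
  move=> hp; apply: norm_cvg0.
  apply: (@squeeze_cvgr _ _ _ _ (cst 0) _ _ _ _ _ g0); last exact: cvg_cst.
  apply: nearW => k /=; rewrite normr_ge0 /=.
  exact: le_trans (hp _) (ug k).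
by split; apply: main; [exact: normRe_le|exact: normIm_le].
Qed.

Lemma cvg_expRN_sqr (c : R) : 0 < c -> (fun k : nat => expR (- (c * k%:R ^+ 2))) @ \oo --> (0 : R).
Proof.
move=> c0; have [C [C0 h]] := @expR_sqr_le R 0 c c0.
(* The comparison is 1 / (1 + k^2) <= 2 / (k + 1). *)
have hC : (fun k : nat => C * 2 * harmonic k) @ \oo --> (0 : R).
  by rewrite -[X in _ --> X](mulr0 (C * 2)); apply: cvgMr; exact: cvg_harmonic.
apply: (@squeeze_cvgr _ _ _ _ (cst 0) _ _ _ _ _ hC); last exact: cvg_cst.
apply: nearW => k /=; rewrite expR_ge0 /=.
have := h k%:R; rewrite expr0 mul1r => /le_trans; apply.
rewrite -mulrA ler_pM2l // ler_pdivlMr ?ltr0n // mulrC ler_pdivrMr ?oneDsqr_gt0' //.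
rewrite -natr1; set t : R := k%:R.
by have := sqr_ge0 (t - 1 / 4); rewrite sqrrB; lra.
Qed.

Lemma normc_cexp_gauss (a : R[i]) (x y : R) :
  normc (cexp (- (a * (y ^+ 2)%:C)) * cexp (- (x%:C * ('i%C * y%:C)))) = expR (- (Re a * y ^+ 2)).
Proof.
rewrite Normc.normcM normc_gauss normc_cexp !cplxE /=.
by rewrite !(mul0r, mulr0, subr0, add0r, oppr0, mul1r, addr0) expR0 mulr1.
Qed.

(** As a function g of the frequency z the integral solves 2 a g' = - z g: differentiate under the
    integral, then use that the derivative of exp (- a y^2 - i z y) in y integrates to 0. Hence exp
    (z^2 / (4 a)) g z is constant. *)
Lemma gauss_fourier (a : R[i]) (x : R) : 0 < Re a ->
  cint mu (fun y : R' => cexp (- (a * (y ^+ 2)%:C)) * cis (- (x * y))) =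
  gaussI a * cexp (- ((x ^+ 2)%:C / (4 * a))).
Proof.
move=> a0.
have an0 : a != 0 by apply/eqP => e; move: a0; rewrite e /= ltxx.
pose V (y : R') := cexp (- (a * (y ^+ 2)%:C)).
pose X (y : R') : R[i] := 'i%C * y%:C.
have VX z y : V y * cexp (- (z%:C * X y)) = V y * cis (- (z * y)).
  congr (_ * _); rewrite -cexp_imag; congr cexp; apply: complexP;
  rewrite !cplxE /= ?cplxE /=; ring.
pose g z := cint mu (fun y : R' => V y * cexp (- (z%:C * X y))).
have mX : cmeas X by apply: cmeasM; [exact: cmeas_cst|exact: cmeas_real].
have nV z y : normc (V y * cexp (- (z%:C * X y))) = expR (- (Re a * y ^+ 2)).
  exact: normc_cexp_gauss.
have nX y : normc (X y) = `|y|.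
  by rewrite Normc.normcM normc_real normcE /= expr0n expr1n add0r sqrtr1 mul1r.
have i0 := integrable_expRN_sqr 0 a0.
have i1 := integrable_expRN_sqr 1 a0.
have b0 (z : R) (y : R') : normc (V y * cexp (- (z%:C * X y))) <= (1 + `|y|) ^+ 0 * expR (- (Re a * y ^+ 2)).
  by rewrite nV expr0 mul1r.
have b1 (z : R) (y : R') : normc (X y * (V y * cexp (- (z%:C * X y)))) <= (1 + `|y|) ^+ 1 * expR (- (Re a * y ^+ 2)).
  by rewrite Normc.normcM nV nX expr1 ler_wpM2r ?expR_ge0 // lerDr.
have mE z : cmeas (fun y => V y * cexp (- (z%:C * X y))).
  apply: cmeasM; first exact: cmeas_gauss.
  apply: cmeas_cexp; rewrite (_ : (fun y => _) = (fun y => (- z%:C) * X y)).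
    by apply: cmeasM => //; exact: cmeas_cst.
  by apply/funext => y; rewrite mulNr.
have iE z : cintegrable mu (fun y => V y * cexp (- (z%:C * X y))).
  exact: (cintegrable_le (mE z) i0 (b0 z)).
have iXE z : cintegrable mu (fun y => X y * (V y * cexp (- (z%:C * X y)))).
  by apply: (cintegrable_le _ i1 (b1 z)); apply: cmeasM.
pose J z := cint mu (fun y => X y * (V y * cexp (- (z%:C * X y)))).
have dg z : is_cderive g z (- 1 * J z).
  apply: (@is_cderive_cint_cexp _ _ R' mu V X (fun x => x%:C) (fun=> 1) 1 _ _ (z - 1) z (z + 1)
    _ _ mX _ _ i0 i1).
  - by apply/andP; split; lra.
  - exact: cmeas_gauss.
  - by move=> t _; exact: is_cderive_id.
  - by move=> t _; rewrite Normc.normc1.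
  - by move=> t y _; exact: b0.
  - by move=> t y _; exact: b1.
have JE z : 2 * a * J z = z%:C * g z.
  pose u (y : R) := cexp (- (a * (y ^+ 2)%:C) - z%:C * X y).
  have uE y : V y * cexp (- (z%:C * X y)) = u y by rewrite -cexpD.
  pose l (y : R) : R[i] := - (2 * a) * y%:C + - (z%:C * 'i%C).
  have dl y : is_cderive l y (- (2 * a) * 1 + 0).
    apply: is_cderiveD; last exact: is_cderive_cst.
    by apply: is_cderiveZ; exact: is_cderive_id.
  have du y : is_cderive u y (l y * u y).
    apply: is_cderive_cexp.
    have dsq : is_cderive (fun y : R => y%:C * y%:C) y (1 * y%:C + y%:C * 1).
      by apply: is_cderiveM; exact: is_cderive_id.
    have d1 := is_cderiveZ (- a) dsq.
    have d2 := is_cderiveZ (- (z%:C * 'i%C)) (is_cderive_id y).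
    have := is_cderiveD d1 d2.
    rewrite (_ : (fun t => _) = (fun y => - (a * (y ^+ 2)%:C) - z%:C * X y)); last first.
      by apply/funext => t; rewrite expr2 rmorphM /X; ring.
    by rewrite (_ : _ + _ = l y) // /l; ring.
  have dlu y : is_cderive (fun y => l y * u y) y ((- (2 * a) * 1 + 0) * u y + l y * (l y * u y)).
    exact: is_cderiveM.
  have luE y : l y * u y = (2 * a * 'i%C) * (X y * (V y * cexp (- (z%:C * X y)))) +
      (- (z%:C * 'i%C)) * (V y * cexp (- (z%:C * X y))).
    rewrite uE /l /X.
    have ii : 'i%C * 'i%C = -1 :> R[i] by rewrite -expr2 sqr_i.
    transitivity ((2 * a * ('i%C * 'i%C)) * y%:C * u y + - (z%:C * 'i%C) * u y); last by ring.
    by rewrite ii; ring.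
  have i2 : cintegrable mu (fun y => l y * u y).
    rewrite (funext luE); apply: cintegrableD; exact: cintegrableZ.
  have uk y : normc (u y) <= expR (- (Re a * y ^+ 2)) by rewrite -uE nV.
  have := @cint_derive_eq0 u _ _ du dlu i2.
  rewrite (eq_cint mu luE) cintD ?cintZ //; try exact: cintegrableZ.
  rewrite -/(J z) -/(g z) => h0.
  have {h0} : 2 * a * 'i%C * J z + - (z%:C * 'i%C) * g z = 0.
    apply: h0.
      by apply: (ccvg0_norm (fun k => uk k%:R)); exact: cvg_expRN_sqr.
    apply: (ccvg0_norm (fun k => uk (- k%:R))).
    by under eq_cvg do rewrite sqrrN; exact: cvg_expRN_sqr.
  have i0' : 'i%C != 0 :> R[i] by rewrite eq_complex /= eqxx oner_eq0.
  move=> h; apply: (mulfI i0'); apply/eqP; rewrite -subr_eq0 -h; apply/eqP; ring.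
pose E z := cexp ((z ^+ 2)%:C / (4 * a)) * g z.
have dE z : is_cderive E z 0.
  have dsq : is_cderive (fun y : R => y%:C * y%:C) z (1 * z%:C + z%:C * 1).
    by apply: is_cderiveM; exact: is_cderive_id.
  have d1 := is_cderive_cexp (is_cderiveZ (4 * a)^-1 dsq).
  have := is_cderiveM d1 (dg z).
  rewrite (_ : (fun t => _) = E); last first.
    by apply/funext => t; rewrite /E expr2 rmorphM mulrC [_^-1 * _]mulrC mulrC.
  rewrite (_ : _ + _ = 0) //.
  have -> : J z = z%:C * g z / (2 * a).
    by rewrite -JE mulrC mulKf // mulf_neq0 // pnatr_eq0.
  by field; rewrite an0.
have Eq : E x = E 0.
  have [x0|x0] := leP 0 x.
    by rewrite (is_cderive0_eq x0 (fun z _ => dE z)).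
  by rewrite (is_cderive0_eq (ltW x0) (fun z _ => dE z)).
have g0 : g 0 = gaussI a.
  by apply: eq_cint => y; rewrite mul0r oppr0 cexp0 mulr1.
move: Eq; rewrite /E expr0n /= mul0r cexp0 mul1r g0 => <-.
rewrite mulrAC -cexpD subrr cexp0 mul1r.
by apply: eq_cint => y; rewrite VX.
Qed.

End gaussian_fourier.

Lemma cis_sum {R : realType} I (r : seq I) (p : pred I) (F : I -> R) :
  cis (\sum_(i <- r | p i) F i) = \prod_(i <- r | p i) cis (F i).
Proof.
elim: r => [|i r IH]; first by rewrite !big_nil cis0.
by rewrite !big_cons; case: (p i); rewrite ?cisD IH.
Qed.

(** * The Gaussian attached to a form of signature (n, n) *)

Section gaussian_tensor.
Context {R : realType}.
Variable n : nat.
Local Notation L := (@lebesgue_rV R).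

(* The coefficients of [lam e] are -1/(e + i) and -1/(e - i), so the Fourier
   transform of exp (lam e) has exponent [- acoef e / 4]. *)
Definition lam (e : R) (xi : 'rV[R]_(n + n)) : R[i] :=
  ((- (e * eucl_norm xi ^+ 2)) +i* P xi) * ((1 + e ^+ 2)^-1)%:C.

Definition acoef (e : R) (x : 'rV[R]_(n + n)) : R[i] := (e * eucl_norm x ^+ 2) +i* P x.

Lemma P_le_sqr_norm (x : 'rV[R]_(n + n)) : `|P x| <= eucl_norm x ^+ 2.
Proof.
rewrite sqr_eucl_norm big_split_ord /= -big_split /= (le_trans (ler_norm_sum _ _ _)) //.
apply: ler_sum => i _; set a := x _ _ ^+ 2; set b := x _ _ ^+ 2.
have a0 : 0 <= a by exact: sqr_ge0.
have b0 : 0 <= b by exact: sqr_ge0.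
by rewrite ler_norml; apply/andP; split; lra.
Qed.

Let al (e : R) (i : 'I_(n + n)) : R[i] :=
  match fintype.split i with inl _ => e +i* 1 | inr _ => e -i* 1 end.

Let al_l e (j : 'I_n) : al e (lshift n j) = e +i* 1.
Proof. by rewrite /al (unsplitK (inl j : 'I_n + 'I_n)). Qed.

Let al_r e (j : 'I_n) : al e (rshift n j) = e -i* 1.
Proof. by rewrite /al (unsplitK (inr j : 'I_n + 'I_n)). Qed.

Let acoefE e x : acoef e x = \sum_i (x ord0 i ^+ 2)%:C * al e i.
Proof.
rewrite big_split_ord /=.
under eq_bigr do rewrite al_l; under [X in _ + X]eq_bigr do rewrite al_r.
apply: complexP.
  rewrite ReD !Re_sum /= sqr_eucl_norm big_split_ord /= mulrDr !mulr_sumr.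
  by congr (_ + _); apply: eq_bigr => i _; rewrite mul0r subr0 mulrC.
rewrite ImD !Im_sum /= /P big_split /=.
by congr (_ + _); apply: eq_bigr => i _; rewrite !(mul0r, addr0, mulr1, mulrN1).
Qed.

Let alM e j : (al e j)^-1 = (al e j)^* * ((1 + e ^+ 2)^-1)%:C.
Proof.
have h : al e j * (al e j)^* = (1 + e ^+ 2)%:C.
  by rewrite /al; case: fintype.split => _; apply: complexP => /=; ring.
have n0 : al e j != 0.
  apply/eqP => e0; move: h; rewrite e0 mul0r => /(congr1 (@complex.Re R)) /=.
  by have := oneDsqr_gt0' e; lra.
apply: (mulfI n0); rewrite mulfV // mulrA h -rmorphM /= mulfV //.
by rewrite gt_eqF // oneDsqr_gt0'.
Qed.

Let lamE e x : lam e x = - \sum_i (x ord0 i ^+ 2)%:C / al e i.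
Proof.
under eq_bigr do rewrite alM mulrA.
rewrite -mulr_suml -mulNr; congr (_ * _).
have := acoefE e x => /(congr1 (@conjc R)); rewrite rmorph_sum /= => h.
under eq_bigr do rewrite -[X in X * _]conjc_real -rmorphM /=.
rewrite -h; apply: complexP => /=; by rewrite ?opprK.
Qed.

Lemma Re_lam_le0 e x : 0 <= e -> Re (lam e x) <= 0.
Proof.
move=> e0; rewrite ReM /= mulr0 subr0 mulNr oppr_le0; apply: mulr_ge0.
  by apply: mulr_ge0 => //; exact: sqr_ge0.
by rewrite invr_ge0 ltW // oneDsqr_gt0'.
Qed.

Lemma normc_lam_ge e x : `|P x| / (1 + e ^+ 2) <= normc (lam e x).
Proof.
rewrite Normc.normcM normc_real [X in _ <= _ * X]ger0_norm ?invr_ge0 ?(ltW (oneDsqr_gt0' e)) //.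
rewrite ler_wpM2r ?invr_ge0 ?(ltW (oneDsqr_gt0' e)) //.
exact: (normIm_le (_ +i* P x)).
Qed.

(** A product of 2n one-dimensional transforms with coefficients tau / (e + i) and tau / (e - i).
    The exponents add up to [acoef], whose coefficients are e + i and e - i, and by [gaussI_mulJ]
    each conjugate pair contributes the real constant pi sqrt (1 + e^2) / tau. *)
Lemma gauss_tensor (e tau : R) (x : 'rV[R]_(n + n)) : 0 < e -> 0 < tau ->
  cint (L (n + n)) (fun xi : 'rV[R]_(n + n) =>
    cexp (tau%:C * lam e xi) * cis (- \sum_i x ord0 i * xi ord0 i)) =
  ((pi * Num.sqrt (1 + e ^+ 2) / tau) ^+ n)%:C * cexp (- (acoef e x / (4 * tau%:C))).
Proof.
move=> e0 t0.
pose a i := tau%:C / al e i.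
have aE i : a i = (al e i)^* * (tau / (1 + e ^+ 2))%:C.
  by rewrite /a alM mulrCA -rmorphM.
have r0 : 0 < tau / (1 + e ^+ 2) by rewrite divr_gt0 // oneDsqr_gt0'.
have Rea i : 0 < Re (a i).
  rewrite aE ReM /= mulr0 subr0 mulr_gt0 //.
  by rewrite /al; case: fintype.split.
have tc0 : tau%:C != 0 :> R[i] by rewrite eq_complex /= gt_eqF.
pose g (i : 'I_(n + n)) (y : R) := cexp (- (a i * (y ^+ 2)%:C)) * cis (- (x ord0 i * y)).
have gE (xi : 'rV[R]_(n + n)) : cexp (tau%:C * lam e xi) * cis (- \sum_i x ord0 i * xi ord0 i) =
    \prod_i g i (xi ord0 i).
  rewrite big_split /=; congr (_ * _).
    rewrite -cexp_sum; congr cexp; rewrite lamE mulrN mulr_sumr -sumrN.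
    by apply: eq_bigr => i _; rewrite /a mulrAC mulrA.
  by rewrite -cis_sum sumrN.
rewrite (eq_cint _ gE) (cint_prod_rV (g := g)); last first.
  move=> i; apply: (cintegrable_le _ (integrable_expRN_sqr 0 (Rea i))) => [|y].
    apply: cmeasM; first exact: cmeas_gauss.
    rewrite (_ : (fun x => _) = (fun y => cexp (0 +i* (- (x ord0 i * y))))).
      apply: cmeas_cexp; apply: cmeas_pair => //.
      by apply: measurableT_comp => //; exact: measurable_funM.
    by apply/funext => y; rewrite cexp_imag.
  by rewrite Normc.normcM normc_cis mulr1 normc_gauss expr0 mul1r.
have hi i : cint lebesgue_measure (g i) = gaussI (a i) * cexp (- ((x ord0 i ^+ 2)%:C * al e i / (4 * tau%:C))).
  rewrite gauss_fourier //; congr (_ * cexp (- _)).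
  have n0 : al e i != 0.
    apply/eqP => h; have := Rea i; rewrite aE h => /=.
    by rewrite oppr0 !mul0r subrr ltxx.
  by rewrite /a; field; rewrite n0 tc0.
rewrite (eq_bigr _ (fun i _ => hi i)) big_split /= -cexp_sum sumrN -mulr_suml -acoefE.
congr (_ * _).
rewrite big_split_ord /= -big_split /=.
have key (j : 'I_n) : gaussI (a (lshift n j)) * gaussI (a (rshift n j)) =
    (pi * Num.sqrt (1 + e ^+ 2) / tau)%:C.
  rewrite !aE al_l al_r.
  set t := tau / (1 + e ^+ 2); have tp : 0 < t := r0.
  have -> : (e +i* 1)^* * t%:C = (e * t) -i* t by apply: complexP => /=; ring.
  have -> : (e -i* 1)^* * t%:C = (e * t) +i* t by apply: complexP => /=; ring.
  rewrite gaussI_mulJ; last exact: mulr_gt0.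
  have -> : normc ((e * t) +i* t) = Num.sqrt (1 + e ^+ 2) * t.
    rewrite normcE /= (_ : (e * t) ^+ 2 + t ^+ 2 = (1 + e ^+ 2) * t ^+ 2); last by ring.
    by rewrite sqrtrM ?(ltW (oneDsqr_gt0' e)) // sqrtr_sqr (ger0_norm (ltW tp)).
  have s0 : 0 < Num.sqrt (1 + e ^+ 2) by rewrite sqrtr_gt0 oneDsqr_gt0'.
  have s2 : 1 + e ^+ 2 = Num.sqrt (1 + e ^+ 2) ^+ 2 by rewrite sqr_sqrtr // ltW // oneDsqr_gt0'.
  have -> : pi / (Num.sqrt (1 + e ^+ 2) * t) = pi * Num.sqrt (1 + e ^+ 2) / tau.
    rewrite /t {2}s2; field.
    by rewrite !gt_eqF.
  by [].
rewrite (eq_bigr _ (fun j _ => key j)) prodr_const card_ord.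
by rewrite -rmorphXn.
Qed.

Lemma normc_gauss_tensor (e tau : R) (xi : 'rV[R]_(n + n)) :
  normc (cexp (tau%:C * lam e xi)) = expR (- (tau * e / (1 + e ^+ 2) * eucl_norm xi ^+ 2)).
Proof.
rewrite normc_cexp !cplxE /=; congr expR; field.
by rewrite gt_eqF // oneDsqr_gt0'.
Qed.

End gaussian_tensor.

(** * Fourier transforms of test functions *)

Section fourier_decay.
Context {R : realType}.
Variable m : nat.
Local Notation V := 'rV[R]_m.
Local Notation L := (@lebesgue_rV R m).
Implicit Types (f : V -> R[i]) (v w x : V).

Definition test_fun f := smooth_on setT f /\ compact (tsupport f).

Lemma compact_le_bound (K : set V) (g : V -> R) : compact K -> continuous g ->
  exists C : R, 0 < C /\ forall v, K v -> g v <= C.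
Proof.
move=> cK cg; have [K0|/set0P K0] := eqVneq K set0.
  by exists 1; split => // v; rewrite K0.
have [|c _ h] := compact_EVT_max K0 cK (f := g).
  by apply: continuous_subspaceT => x; exact: cg.
exists (`|g c| + 1); split; first by rewrite ltr_pwDr.
move=> v Kv; rewrite (le_trans (h v _)) ?inE // (le_trans (ler_norm _)) //.
by rewrite lerDl.
Qed.

Lemma coord_continuous_rV (i : 'I_m) : continuous (fun v : V => v ord0 i).
Proof. by move=> v; exact: coord_continuous. Qed.

Lemma cont_mul (g h : V -> R) : continuous g -> continuous h -> continuous (fun v => g v * h v).
Proof. by move=> cg ch v; exact: (cvgM (cg v) (ch v)). Qed.

Lemma cont_add (g h : V -> R) : continuous g -> continuous h -> continuous (fun v => g v + h v).
Proof. by move=> cg ch v; exact: (cvgD (cg v) (ch v)). Qed.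

Lemma cont_cst (c : R) : continuous (fun _ : V => c).
Proof. by move=> v; exact: cst_continuous. Qed.

Lemma continuous_prod I (r : seq I) (F : I -> V -> R) : (forall i, continuous (F i)) ->
  continuous (fun v => \prod_(i <- r) F i v).
Proof.
move=> cF; elim: r => [|i r IH].
  rewrite (_ : (fun v => _) = cst 1); first exact: cont_cst.
  by apply/funext => v; rewrite big_nil.
rewrite (_ : (fun v => _) = (fun v => F i v * \prod_(j <- r) F j v)).
  exact: cont_mul.
by apply/funext => v; rewrite big_cons.
Qed.

Lemma continuous_weightV : continuous (fun v : V => (rV_weight v)^-1).
Proof.
rewrite (_ : (fun v => _) = (fun v : V => \prod_i (1 + v ord0 i * v ord0 i))); last first.
  by apply/funext => v; rewrite /rV_weight prodfV invrK.
apply: (@continuous_prod _ _ (fun i (v : V) => 1 + v ord0 i * v ord0 i)) => i.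
apply: cont_add; first exact: cont_cst.
by apply: cont_mul; exact: coord_continuous_rV.
Qed.

Lemma test_fun_continuous f : test_fun f ->
  continuous (fun v => Re (f v)) /\ continuous (fun v => Im (f v)).
Proof. by move=> [sf _]; split => x; have [c1 c2 _] := sf [::] x I. Qed.

Lemma test_fun_cmeas f : test_fun f -> cmeas f.
Proof.
by move=> /test_fun_continuous[c1 c2]; split; exact: continuous_measurable_rV.
Qed.

Lemma tsupport_notin f v : ~ tsupport f v -> f v = 0.
Proof.
by move=> h; apply/eqP/negP => /negP fv; apply: h; apply: subset_closure.
Qed.

Lemma continuous_normc f : continuous (fun v => Re (f v)) -> continuous (fun v => Im (f v)) ->
  continuous (fun v => normc (f v)).
Proof.
move=> c1 c2.
rewrite (_ : (fun v => _) = Num.sqrt \o (fun v => Re (f v) * Re (f v) + Im (f v) * Im (f v))); last first.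
  by apply/funext => v; rewrite /= normcE.
move=> v; apply: continuous_comp; last exact: sqrt_continuous.
exact: (cont_add (cont_mul c1 c1) (cont_mul c2 c2)).
Qed.

Lemma test_fun_bound f : test_fun f ->
  exists C : R, 0 < C /\ forall v, normc (f v) <= C * rV_weight v.
Proof.
move=> tf; have [c1 c2] := test_fun_continuous tf.
have cg : continuous (fun v => normc (f v) * (rV_weight v)^-1).
  exact: (cont_mul (continuous_normc c1 c2) continuous_weightV).
have [C [C0 h]] := compact_le_bound tf.2 cg.
exists C; split => // v; have [sv|nsv] := pselect (tsupport f v).
  by rewrite -ler_pdivrMr ?rV_weight_gt0 // h.
by rewrite (tsupport_notin nsv) Normc.normc0 mulr_ge0 ?ltW ?rV_weight_gt0.
Qed.

Lemma partials_partial (l : seq 'I_m) i f : partials l (partial i f) = partials (rcons l i) f.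
Proof. by elim: l => //= j l ->. Qed.

Lemma test_fun_partial i f : test_fun f -> test_fun (partial i f).
Proof.
move=> [sf kf]; split.
  by move=> l x _; rewrite partials_partial; exact: sf.
apply: (subclosed_compact _ kf); first exact: closed_closure.
rewrite /tsupport [X in _ `<=` X](closure_id _).1; last exact: closed_closure.
apply: closure_subset => x /= px; apply: contrapT => nx.
move/negP: px; apply; apply/eqP.
have near0 : \forall y \near x, f y = 0.
  have : open (~` tsupport f) by apply: closed_openC; exact: closed_closure.
  rewrite openE => /(_ x nx); apply: filterS => y; exact: tsupport_notin.
apply: complexP => /=.
  rewrite (@near_eq_derive _ _ _ _ (fun=> 0)) ?derive_cst //.
  by near=> y; rewrite /= (near near0 y).
rewrite (@near_eq_derive _ _ _ _ (fun=> 0)) ?derive_cst //.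
by near=> y; rewrite /= (near near0 y).
Unshelve. all: by end_near. Qed.

Lemma is_derive_line (g : V -> R) (x e : V) (h : R) : derivable g (x + h *: e) e ->
  is_derive h (1 : R) (fun t : R => g (x + t *: e)) ('D_e g (x + h *: e)).
Proof.
move=> dg.
have E : (fun t : R => t^-1 *: (((fun t : R => g (x + t *: e)) \o shift h) (t *: (1 : R)) - g (x + h *: e))) =
   (fun t : R => t^-1 *: ((g \o shift (x + h *: e)) (t *: e) - g (x + h *: e))).
  apply/funext => t; congr (_ *: (g _ - _)).
  by rewrite /shift /= [t *: 1]mulr1 scalerDl addrCA.
by apply: DeriveDef; rewrite /derivable /derive E.
Qed.

Definition ft f w := cint L (fun x => f x * cis (- \sum_i x ord0 i * w ord0 i)).

Lemma measurable_dot w : measurable_fun setT (fun x : V => \sum_i x ord0 i * w ord0 i).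
Proof.
apply: measurable_sum => i; apply: measurable_funM => //; exact: measurable_coord.
Qed.

Lemma cmeas_cis_dot w : cmeas (fun x : V => cis (- \sum_i x ord0 i * w ord0 i)).
Proof.
rewrite (_ : (fun x => _) = (fun x : V => cexp (0 +i* (- \sum_i x ord0 i * w ord0 i)))).
  apply: cmeas_cexp; apply: cmeas_pair => //.
  by apply: measurableT_comp => //; exact: measurable_dot.
by apply/funext => x; rewrite cexp_imag.
Qed.

(** Makes one weight dominate all small translates of a test function. The constant 3 comes from y^2
    <= 2 (y + h)^2 + 2 h^2. *)
Lemma rV_weight_shift i (h : R) v : `|h| <= 1 ->
  rV_weight (v + h *: delta_mx ord0 i) <= 3 * rV_weight v.
Proof.
move=> h1; rewrite /rV_weight (bigD1 i) //= [in leRHS](bigD1 i) //= mulrA.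
rewrite !mxE !eqxx mulr1.
rewrite (eq_bigr (fun j => (1 + v ord0 j ^+ 2)^-1)); last first.
  by move=> j ji; rewrite !mxE (negbTE ji) andbF mulr0 addr0.
rewrite ler_wpM2r //.
  by apply: prodr_ge0 => j _; rewrite invr_ge0 ltW // oneDsqr_gt0'.
set y := v ord0 i.
rewrite -[X in X <= _]mul1r ler_pdivrMr ?oneDsqr_gt0' // mulrAC ler_pdivlMr ?oneDsqr_gt0' // mul1r.
have : h ^+ 2 <= 1 by rewrite -(real_normK (num_real h)) expr_le1.
have := sqr_ge0 (y + 2 * h); have := sqr_ge0 (y + h).
rewrite !sqrrD; nra.
Qed.

(** Integration by parts is replaced by translation: the transform of f (x + h e) at w is cis (h
    w_i) times that of f, and the rule is the derivative of this identity at h = 0, taken under the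
    integral on the left. *)
Lemma ft_partial i f w : test_fun f ->
  ft (partial i f) w = 'i%C * (w ord0 i)%:C * ft f w.
Proof.
move=> tf; set e : V := delta_mx ord0 i.
pose K (x : V) := cis (- \sum_i x ord0 i * w ord0 i).
have mK : cmeas K by exact: cmeas_cis_dot.
have nK x : normc (K x) = 1 by exact: normc_cis.
have tp := test_fun_partial i tf.
have [C [C0 hC]] := test_fun_bound tf.
have [C' [C'0 hC']] := test_fun_bound tp.
have mshift h : measurable_fun setT (fun x : V => x + h *: e).
  have := @measurable_affine_rV R m 1 (h *: e).
  by under eq_fun do rewrite scale1r.
pose u (h : R) (x : V) := f (x + h *: e) * K x.
have u0 h : `|h| <= 1 -> forall x, normc (u h x) <= C * 3 * rV_weight x.
  move=> h1 x; rewrite Normc.normcM nK mulr1 (le_trans (hC _)) // -mulrA ler_pM2l //.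
  exact: rV_weight_shift.
have iw c := integrable_RZ c (@integrable_rV_weight R m).
have mu' h : cmeas (u h).
  by apply: cmeasM => //; apply: (cmeas_comp (test_fun_cmeas tf)).
have uE h : cint L (u h) = cis (h * w ord0 i) * ft f w.
  have mfK : cmeas (fun x : V => f x * K x).
    by apply: cmeasM => //; exact: test_fun_cmeas.
  have dotE x : K (1 *: x + h *: e) = cis (- (h * w ord0 i)) * K x.
    rewrite /K -cisD; congr cis; rewrite -opprD; congr (- _).
    under eq_bigr do rewrite scale1r !mxE mulrDl.
    rewrite big_split /= addrC; congr (_ + _).
    rewrite (bigD1 i) //= !eqxx mulr1 big1 ?addr0 // => j ji.
    by rewrite (negbTE ji) mulr0 mul0r.
  have E : (fun x => f x * K x) \o (fun x : V => 1 *: x + h *: e) =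
      (fun x => cis (- (h * w ord0 i)) * u h x).
    by apply/funext => x; rewrite /= dotE /u scale1r; ring.
  have mp := @measurable_affine_rV R m 1 (h *: e).
  have tr := @rV_affine_transfer R m 1 (h *: e) ltr01.
  have c1 : 0 < 1 ^+ m :> R by rewrite expr1n.
  have j : cintegrable L ((fun x => f x * K x) \o (fun x : V => 1 *: x + h *: e)).
    have [a1 a2] : cintegrable L (fun x => f x * K x).
      by apply: (cintegrable_le mfK (iw C)) => x; rewrite Normc.normcM nK mulr1.
    by split; [exact: ((integrable_transfer c1 mp tr mfK.1).2 a1)|
      exact: ((integrable_transfer c1 mp tr mfK.2).2 a2)].
  have iu : cintegrable L (u h).
    have := cintegrableZ (cis (h * w ord0 i)) j; rewrite E.
    rewrite (_ : (fun x => _) = u h) //; apply/funext => x.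
    by rewrite mulrA [_ * cis (- _)]mulrC cisNK mul1r.
  have [_] := cint_transfer c1 mp tr mfK j.
  rewrite expr1n mul1r E cintZ // /ft => ->.
  by rewrite mulrA [_ * cis (- _)]mulrC cisNK mul1r.
have d1 : is_cderive (fun h => cint L (u h)) 0 (cint L (fun x => partial i f (x + 0 *: e) * K x)).
  apply: (@is_cderive_cint _ _ _ L u (fun h x => partial i f (x + h *: e) * K x)
    (fun x => C' * 3 * rV_weight x) 0 (-1) 1) => //.
  - by rewrite ltrN10 ltr01.
  - move=> h /andP[h1 h2]; apply: (cintegrable_le (mu' h) (iw (C * 3))).
    by apply: u0; rewrite ler_norml !ltW.
  - move=> h x _.
    have dl : is_cderive (fun t : R => f (x + t *: e)) h (partial i f (x + h *: e)).
      have [_ _ /(_ i)[q1 q2]] := tf.1 [::] (x + h *: e) I.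
      by split; apply: is_derive_line.
    have := is_cderiveM dl (is_cderive_cst (K x) h).
    by rewrite mulr0 addr0.
  - move=> h x /andP[h1 h2]; rewrite Normc.normcM nK mulr1 (le_trans (hC' _)) //.
    rewrite -mulrA ler_pM2l //.
    by apply: rV_weight_shift; rewrite ler_norml !ltW.
have d2 : is_cderive (fun h => cint L (u h)) 0 ('i%C * (w ord0 i)%:C * ft f w).
  rewrite (funext uE).
  have := is_cderiveM (is_cderive_cexp (is_cderiveZ ('i%C * (w ord0 i)%:C) (is_cderive_id 0)))
    (is_cderive_cst (ft f w) 0).
  rewrite (_ : 0%:C = 0 :> R[i]) // !mulr0 cexp0 addr0 !mulr1.
  rewrite (_ : (fun t => _) = (fun h => cis (h * w ord0 i) * ft f w)) //.
  apply/funext => h; congr (_ * _); rewrite -cexp_imag; congr cexp.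
  by apply: complexP; rewrite !cplxE /=; ring.
rewrite -(is_cderive_unique d1 d2); apply: eq_cint => x.
by rewrite scale0r addr0.
Qed.

Lemma cmeas_ft f : test_fun f -> cmeas (ft f).
Proof.
move=> tf.
apply: (@cmeas_cint_section _ _ _ _ _ L (fun p : V * V => f p.2 * cis (- \sum_i p.2 ord0 i * p.1 ord0 i))).
apply: cmeasM; first by apply: (cmeas_comp (test_fun_cmeas tf)); exact: measurable_snd.
rewrite (_ : (fun x : (V * V)%type => cis (- \sum_i x.2 ord0 i * x.1 ord0 i)) =
  (fun p : V * V => cexp (0 +i* (- \sum_i p.2 ord0 i * p.1 ord0 i)))).
  apply: cmeas_cexp; apply: cmeas_pair => //.
  apply: measurableT_comp => //; apply: measurable_sum => i; apply: measurable_funM.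
    exact: (measurableT_comp (measurable_coord i) measurable_snd).
  exact: (measurableT_comp (measurable_coord i) measurable_fst).
by apply/funext => x; rewrite cexp_imag.
Qed.

Lemma ft_bounded f : test_fun f -> exists C : R, 0 < C /\ forall w, normc (ft f w) <= C.
Proof.
move=> tf; have [C [C0 h]] := test_fun_bound tf.
have iw := integrable_RZ C (@integrable_rV_weight R m).
exists (2 * \int[L]_x (C * rV_weight x) + 1); split.
  rewrite ltr_wpDl // mulr_ge0 //; apply: Rintegral_ge0 => x _.
  by rewrite mulr_ge0 ?ltW ?rV_weight_gt0.
move=> w; rewrite -[leLHS]addr0 lerD //.
apply: normc_cint_le => //.
  by apply: cmeasM; [exact: test_fun_cmeas|exact: cmeas_cis_dot].
by move=> x; rewrite Normc.normcM normc_cis mulr1.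
Qed.

(** Multiplying the transform by 1 + w_k^2 costs two derivatives in direction k. The induction runs
    over the coordinates still to be treated, for all test functions at once. *)
Lemma ft_decay f : test_fun f ->
  exists C : R, 0 < C /\ forall w, normc (ft f w) <= C * rV_weight w.
Proof.
suff h (ks : seq 'I_m) g : test_fun g ->
    exists C : R, 0 < C /\ forall w, (\prod_(k <- ks) (1 + w ord0 k ^+ 2)) * normc (ft g w) <= C.
  move=> tf; have [C [C0 hC]] := h (index_enum 'I_m) f tf.
  exists C; split => // w; rewrite -ler_pdivrMr ?rV_weight_gt0 // mulrC.
  by rewrite /rV_weight prodfV invrK; exact: hC.
elim: ks g => [|k ks IH] g tg.
  have [C [C0 hC]] := ft_bounded tg; exists C; split => // w.
  by rewrite big_nil mul1r.
have [C1 [C10 h1]] := IH g tg.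
have t2 := test_fun_partial k (test_fun_partial k tg).
have [C2 [C20 h2]] := IH _ t2.
exists (C1 + C2); split; first exact: addr_gt0.
move=> w; rewrite big_cons -mulrA mulrDl mul1r lerD //.
apply: le_trans (h2 w); rewrite ft_partial; last exact: test_fun_partial.
rewrite ft_partial // !Normc.normcM !normc_real.
have -> : normc ('i%C : R[i]) = 1 by rewrite normcE /= expr0n expr1n add0r sqrtr1.
rewrite !mul1r mulrCA; set A := \prod_(k <- ks) _.
by rewrite [`|_| * (`|_| * _)]mulrA -expr2 real_normK ?num_real.
Qed.

Lemma fourierE f w : fourier f w = ((2 * pi) `^ (- (m%:R / 2)))%:C * ft f w.
Proof. by []. Qed.

End fourier_decay.

(** * The oscillatory integral defining q *)

Section hyperbolic.
Context {R : realType}.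
Implicit Types t : R.

Lemma cosh_gt0 t : 0 < cosh t.
Proof. by rewrite /cosh divr_gt0 // addr_gt0 // expR_gt0. Qed.

Lemma cosh_ge1 t : 1 <= cosh t.
Proof.
rewrite /cosh ler_pdivlMr // mul1r expRN; set x := expR t.
have x0 : 0 < x by exact: expR_gt0.
rewrite -subr_ge0 (_ : _ - 2 = (x - 1) ^+ 2 / x); last by field; rewrite gt_eqF.
by rewrite divr_ge0 ?sqr_ge0 // ltW.
Qed.

Lemma cosh2D t : cosh t ^+ 2 = 1 + sinh t ^+ 2.
Proof.
rewrite /cosh /sinh expRN; have x0 : 0 < expR t by exact: expR_gt0.
by field; rewrite gt_eqF.
Qed.

Lemma sinh_gt0 t : 0 < t -> 0 < sinh t.
Proof.
by move=> t0; rewrite /sinh divr_gt0 // subr_gt0 ltr_expR gt0_cp.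
Qed.

Lemma cosh_le_expR t : 0 <= t -> cosh t <= expR t.
Proof.
move=> t0; rewrite /cosh ler_pdivrMr // mulr_natr mulr2n lerD2l ler_expR.
by rewrite ge0_cp.
Qed.

Lemma norm_sinh_le t : `|sinh t| <= cosh t.
Proof.
rewrite -(ler_pXn2r (n := 2)) ?nnegrE ?(ltW (cosh_gt0 t)) // real_normK ?num_real //.
by rewrite cosh2D lerDr.
Qed.

Lemma expR_le_cosh t : expR t <= 2 * cosh t.
Proof. by rewrite /cosh mulrC divfK // lerDl expR_ge0. Qed.

Lemma tanh_gt0 t : 0 < t -> 0 < tanh t.
Proof. by move=> t0; rewrite /tanh divr_gt0 ?sinh_gt0 ?cosh_gt0. Qed.

Lemma is_derive_cosh t : is_derive t (1 : R) (@cosh R) (sinh t).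
Proof.
have h1 := is_derive_expR t.
have h2 := is_derive1_comp (is_derive_expR (-1 * t)) (is_derive_mull (-1) t).
have e : (fun x : R => 2^-1 * (expR x + expR (-1 * x))) = @cosh R.
  by apply/funext => x; rewrite /cosh mulrC mulN1r.
rewrite -e; have h3 := is_deriveD h1 h2.
apply: is_derive_eq; rewrite /GRing.scale /= /sinh mulN1r mulrN1 mulrC.
by [].
Qed.

Lemma is_derive_sinh t : is_derive t (1 : R) (@sinh R) (cosh t).
Proof.
have h1 := is_derive_expR t.
have h2 := is_derive1_comp (is_derive_expR (-1 * t)) (is_derive_mull (-1) t).
have e : (fun x : R => 2^-1 * (expR x - expR (-1 * x))) = @sinh R.
  by apply/funext => x; rewrite /sinh mulrC mulN1r.
rewrite -e; have h3 := is_deriveB h1 h2.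
apply: is_derive_eq; rewrite /GRing.scale /= /cosh mulN1r mulrN1 opprK mulrC.
by [].
Qed.

Lemma is_derive_tanh t : is_derive t (1 : R) (@tanh R) (cosh t ^- 2).
Proof.
have c0 : cosh t != 0 by rewrite gt_eqF // cosh_gt0.
apply: (is_derive_eq (is_deriveM (is_derive_sinh t) (is_deriveV c0 (is_derive_cosh t)))).
rewrite /GRing.scale /=.
have -> : sinh t * (- cosh t ^- 2 * sinh t) + (cosh t)^-1 * cosh t = 1 - sinh t ^+ 2 / cosh t ^+ 2.
  by field.
have -> : sinh t ^+ 2 = cosh t ^+ 2 - 1 by rewrite cosh2D addrC addKr.
by field.
Qed.

Lemma continuous_cosh : continuous (@cosh R).
Proof.
move=> t; apply/differentiable_continuous/derivable1_diffP.
by case: (is_derive_cosh t).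
Qed.

Lemma continuous_sinh : continuous (@sinh R).
Proof.
move=> t; apply/differentiable_continuous/derivable1_diffP.
by case: (is_derive_sinh t).
Qed.

Lemma continuous_tanh : continuous (@tanh R).
Proof.
move=> t; apply/differentiable_continuous/derivable1_diffP.
by case: (is_derive_tanh t).
Qed.

End hyperbolic.

Section oscillation.
Context {R : realType}.
Local Notation R' := (measurableTypeR R).
Local Notation mu := (@lebesgue_measure R).

Lemma measurable_cosh : measurable_fun setT (@cosh R : R' -> R').
Proof. exact: (continuous_measurable_fun (@continuous_cosh R)). Qed.

Lemma measurable_sinh : measurable_fun setT (@sinh R : R' -> R').
Proof. exact: (continuous_measurable_fun (@continuous_sinh R)). Qed.

Lemma measurable_tanh : measurable_fun setT (@tanh R : R' -> R').
Proof. exact: (continuous_measurable_fun (@continuous_tanh R)). Qed.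

Lemma measurable_invr : measurable_fun setT (fun x : R => x^-1).
Proof.
rewrite -(setUv [set (0 : R)]); apply/measurable_funU => //.
  exact: measurableC.
split; first exact: measurable_fun_set1.
apply: open_continuous_measurable_fun; first by rewrite openC; exact: closed_eq.
by move=> x /[!inE] /eqP x0; exact: inv_continuous.
Qed.

Lemma cintegral_indic d (T : measurableType d) (nu : {measure set T -> \bar R}) D (f : T -> R[i]) :
  cintegral nu D f = cint nu (fun x => (\1_D x)%:C * f x).
Proof.
apply: complexP => /=.
  rewrite Rintegral_mkcond; apply: eq_Rintegral => x _; rewrite ReM /= mul0r subr0 patchE indicE.
  by case: ifP; rewrite ?mul1r ?mul0r.
rewrite Rintegral_mkcond; apply: eq_Rintegral => x _; rewrite ImM /= mul0r addr0 patchE indicE.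
by case: ifP; rewrite ?mul1r ?mul0r.
Qed.

Lemma integrable_expRN_norm (c : R) : 0 < c ->
  mu.-integrable setT (EFin \o (fun t : R' => expR (- (c * `|t|)))).
Proof.
move=> c0; have [C [C0 h]] := @poly_expRN_le R 2 c c0.
apply: (le_integrable measurableT _ _ (integrable_RZ C (@integrable_oneDsqrV R))).
  apply/measurable_EFinP; apply: measurableT_comp => //; apply: measurableT_comp => //.
  by apply: measurable_funM => //; exact: measurableT_comp.
move=> t _ /=; rewrite lee_fin ger0_norm ?expR_ge0 //.
apply: le_trans (ler_norm _); rewrite ler_pdivlMr ?oneDsqr_gt0' //.
apply: le_trans (h `|t| (normr_ge0 t)); rewrite mulrC ler_wpM2r ?expR_ge0 //.
rewrite -(real_normK (num_real t)) sqrrD expr1n mul1r addrAC lerDl.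
by rewrite mulrn_wge0.
Qed.

Variable n : nat.
Hypothesis n1 : (1 <= n)%N.

Lemma coshXN_le t : (cosh t ^+ n)^-1 <= 2 * expR (- (1 * `|t|)) :> R.
Proof.
have c0 := @cosh_gt0 R t.
have h : (cosh t ^+ n)^-1 <= (cosh t)^-1.
  by rewrite lef_pV2 ?posrE ?exprn_gt0 // -[leLHS]expr1 ler_weXn2l // cosh_ge1.
apply: le_trans h _; rewrite mul1r expRN -[leLHS]mul1r ler_pdivrMr // mulrAC ler_pdivlMr ?expR_gt0 // mul1r.
have [t0|t0] := leP 0 t; first by rewrite ?ger0_norm // expR_le_cosh.
rewrite ltr0_norm // (le_trans (expR_le_cosh _)) // /cosh opprK addrC.
by [].
Qed.

(** The integrand of q without the factor 1/|th|, where a complex l with Re l <= 0 takes the place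
    of i P(xi) / |th|. *)
Definition oscE (l : R[i]) t : R[i] := ((cosh t ^+ n)^-1)%:C * cexp ((tanh t)%:C * l).

Lemma cmeas_oscE l : cmeas (oscE l : R' -> R[i]).
Proof.
apply: cmeasM.
  apply: cmeas_real; apply: (measurableT_comp measurable_invr).
  by apply: measurable_funX; exact: measurable_cosh.
apply: cmeas_cexp; apply: cmeasM; last exact: cmeas_cst.
by apply: cmeas_real; exact: measurable_tanh.
Qed.

Lemma normc_oscE_le l t : Re l <= 0 -> 0 <= t -> normc (oscE l t) <= (cosh t ^+ n)^-1.
Proof.
move=> l0 t0; have c0 := @cosh_gt0 R t.
rewrite Normc.normcM normc_real ger0_norm ?invr_ge0 ?exprn_ge0 ?(ltW c0) //.
rewrite -[leRHS]mulr1 ler_wpM2l ?invr_ge0 ?exprn_ge0 ?(ltW c0) // normc_cexp.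
rewrite -expR0 ler_expR ReM /= mul0r subr0 mulr_ge0_le0 //.
by rewrite /tanh divr_ge0 ?(ltW c0) // /sinh divr_ge0 // subr_ge0 ler_expR ge0_cp.
Qed.

(** The half-line is open because [sinh] will be inverted on it; [cint_obnd_cbnd] restores the
    endpoint 0 present in q. *)
Definition osc l := cint mu (fun t : R' => (\1_`]0%R, +oo[ t)%:C * oscE l t).

Lemma osc_dom l t : Re l <= 0 ->
  normc ((\1_`]0%R, +oo[ t)%:C * oscE l t) <= 2 * expR (- (1 * `|t|)).
Proof.
move=> l0; rewrite Normc.normcM normc_real indicE.
have [|] := boolP (t \in _); last first.
  by move=> _; rewrite normr0 mul0r mulr_ge0 ?expR_ge0.
move=> /set_mem h; have t0 : 0 < t by move: h; rewrite /= in_itv /= andbT.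
rewrite normr1.
rewrite [leLHS]mul1r; apply: (le_trans (normc_oscE_le l0 (ltW t0))); exact: coshXN_le.
Qed.

Lemma cmeas_indicM (D : set R') (f : R' -> R[i]) : measurable D -> cmeas f ->
  cmeas (fun t => (\1_D t)%:C * f t).
Proof. by move=> mD mf; apply: cmeasM => //; apply: cmeas_real; exact: measurable_indic. Qed.

Lemma cintegrable_osc l : Re l <= 0 ->
  cintegrable mu (fun t : R' => (\1_`]0%R, +oo[ t)%:C * oscE l t).
Proof.
move=> l0.
apply: (cintegrable_le (cmeas_indicM _ (cmeas_oscE l)) (integrable_RZ 2 (integrable_expRN_norm ltr01))) => //.
by move=> t; exact: osc_dom.
Qed.

Lemma cvg_osc (u : nat -> R[i]) l : (forall k, Re (u k) <= 0) -> ccvg u l ->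
  ccvg (fun k => osc (u k)) (osc l).
Proof.
move=> u0 ul; apply: (cint_dct (g := fun t : R' => 2 * expR (- (1 * `|t|)))).
- by move=> k; apply: cmeas_indicM => //; exact: cmeas_oscE.
- move=> t; apply: ccvgM; first exact: ccvg_cst.
  apply: ccvgM; first exact: ccvg_cst.
  by apply: ccvg_cexp; apply: ccvgM => //; exact: ccvg_cst.
- by apply: integrable_RZ; exact: integrable_expRN_norm.
- by move=> k t; exact: osc_dom.
Qed.

(* The primitive of (tanh t)' e^(l tanh t) is e^(l tanh t) / l: [oscP] is the
   other factor in the integration by parts. *)
Definition oscP (t : R) : R := cosh t ^+ 2 * (cosh t ^+ n)^-1.
Definition oscP' (t : R) : R := (2 - n%:R) * tanh t * oscP t.

Lemma is_derive_oscP (t : R) : is_derive t (1 : R) oscP (oscP' t).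
Proof.
have c0 : cosh t != 0 by rewrite gt_eqF // cosh_gt0.
have cn0 : cosh t ^+ n != 0 by rewrite expf_neq0.
have h1 := is_deriveX n (is_derive_cosh t).
have h2 := is_deriveX 2 (is_derive_cosh t).
have e (k : nat) : (@cosh R ^+ k) t = cosh t ^+ k by elim: k => // k IH; rewrite !exprS -IH.
have cn0' : (@cosh R ^+ n) t != 0 by rewrite e.
have h := is_deriveM h2 (is_deriveV cn0' h1).
rewrite (_ : oscP = (@cosh R ^+ 2) * (fun y => ((@cosh R ^+ n) y)^-1)); last first.
  apply/funext => x; rewrite /oscP.
  rewrite [RHS](_ : _ = ((@cosh R ^+ 2) x) * ((@cosh R ^+ n) x)^-1) //.
  have ex (k : nat) : (@cosh R ^+ k) x = cosh x ^+ k by elim: k => // k IH; rewrite !exprS -IH.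
  by rewrite !ex.
apply: (is_derive_eq h); rewrite /GRing.scale /= !e /oscP' /oscP /tanh.
case: n n1 cn0 => // k _ _; rewrite -[k.+1.-1]/k expr1 (exprS (cosh t) k).
have ck0 : cosh t ^+ k != 0 by rewrite expf_neq0.
by field; rewrite ck0.
Qed.

Lemma oscP_bounds t : 0 <= t -> 0 <= oscP t <= expR t.
Proof.
move=> t0; have c0 := @cosh_gt0 R t; apply/andP; split.
  by rewrite mulr_ge0 ?sqr_ge0 // invr_ge0 exprn_ge0 // ltW.
apply: le_trans (cosh_le_expR t0); rewrite /oscP ler_pdivrMr ?exprn_gt0 //.
by rewrite expr2 ler_pM2l // -[leLHS]expr1 ler_weXn2l // cosh_ge1.
Qed.

Lemma norm_tanh_le (t : R) : `|tanh t| <= 1.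
Proof.
have c0 := @cosh_gt0 R t.
by rewrite /tanh normrM normfV (gtr0_norm c0) ler_pdivrMr // mul1r norm_sinh_le.
Qed.

Lemma oscP'_le t : 0 <= t -> `|oscP' t| <= (n%:R + 2) * expR t.
Proof.
move=> t0; have /andP[p0 p1] := oscP_bounds t0.
rewrite /oscP' normrM (ger0_norm p0); apply: ler_pM => //.
rewrite normrM -[leRHS]mulr1; apply: ler_pM => //; last exact: norm_tanh_le.
by rewrite (le_trans (ler_normB _ _)) // !normr_nat addrC.
Qed.

Lemma osc_derive l t :
  is_cderive (fun t => cexp ((tanh t)%:C * l) * (oscP t)%:C) t
   (l * oscE l t + cexp ((tanh t)%:C * l) * (oscP' t)%:C).
Proof.
have d1 := is_cderive_cexp (is_cderiveM (is_cderive_real (is_derive_tanh t)) (is_cderive_cst l t)).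
have := is_cderiveM d1 (is_cderive_real (is_derive_oscP t)).
rewrite (_ : _ + _ = l * oscE l t + cexp ((tanh t)%:C * l) * (oscP' t)%:C) //.
congr (_ + _).
rewrite mulr0 addr0 /oscE /oscP.
have -> : ((cosh t ^+ n)^-1)%:C = (cosh t ^- 2)%:C * (cosh t ^+ 2 * (cosh t ^+ n)^-1)%:C :> R[i].
  by rewrite -rmorphM /= mulrA mulVf ?mul1r // expf_neq0 // gt_eqF // cosh_gt0.
by ring.
Qed.

Definition ccont (f : R -> R[i]) :=
  continuous (fun t => Re (f t)) /\ continuous (fun t => Im (f t)).

Lemma ccont_is_cderive (f f' : R -> R[i]) : (forall x, is_cderive f x (f' x)) -> ccont f.
Proof. exact: is_cderive_continuous. Qed.

Lemma ccontM (f g : R -> R[i]) : ccont f -> ccont g -> ccont (fun t => f t * g t).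
Proof.
move=> [a b] [c e]; split.
  under eq_fun do rewrite ReM.
  by move=> t; apply: cvgB; apply: cvgM; [exact: a|exact: c|exact: b|exact: e].
under eq_fun do rewrite ImM.
by move=> t; apply: cvgD; apply: cvgM; [exact: a|exact: e|exact: b|exact: c].
Qed.

Lemma ccontD (f g : R -> R[i]) : ccont f -> ccont g -> ccont (fun t => f t + g t).
Proof.
move=> [a b] [c e]; split.
  under eq_fun do rewrite ReD.
  by move=> t; apply: cvgD; [exact: a|exact: c].
under eq_fun do rewrite ImD.
by move=> t; apply: cvgD; [exact: b|exact: e].
Qed.

Lemma ccont_real (f : R -> R) : continuous f -> ccont (fun t => (f t)%:C).
Proof. by move=> cf; split => //= t; exact: cvg_cst. Qed.

Lemma cintegral_is_cderive (F f : R -> R[i]) (a b : R) : a <= b ->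
  (forall x, is_cderive F x (f x)) -> ccont f -> cintegral mu `[a, b] f = F b - F a.
Proof.
move=> ab dF [c1 c2]; apply: complexP => /=; rewrite cplxE.
  rewrite (Rintegral_is_derive ab (F := fun t => Re (F t)) _ c1) ?ReN //.
  by move=> x; case: (dF x).
rewrite (Rintegral_is_derive ab (F := fun t => Im (F t)) _ c2) ?ImN //.
by move=> x; case: (dF x).
Qed.

Lemma ccont_osc_phase l : ccont (fun t => cexp ((tanh t)%:C * l)).
Proof.
apply: (@ccont_is_cderive _ (fun t => ((cosh t ^- 2)%:C * l + (tanh t)%:C * 0) * cexp ((tanh t)%:C * l))) => t.
exact: is_cderive_cexp (is_cderiveM (is_cderive_real (is_derive_tanh t)) (is_cderive_cst l t)).
Qed.

Lemma continuous_oscP : continuous oscP.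
Proof.
move=> t; apply/differentiable_continuous/derivable1_diffP.
by case: (is_derive_oscP t).
Qed.

Lemma continuous_oscP' : continuous oscP'.
Proof.
move=> t; apply: cvgM; last exact: continuous_oscP.
by apply: cvgM; [exact: cvg_cst|exact: continuous_tanh].
Qed.

Lemma ccont_oscE l : ccont (oscE l).
Proof.
apply: ccontM (ccont_osc_phase l); apply: ccont_real => t.
apply: cvgV; first by rewrite expf_neq0 // gt_eqF // cosh_gt0.
exact: (continuous_comp (@continuous_cosh R t) (@exprn_continuous _ n _)).
Qed.

Lemma integrable_itv_expR (T : R) :
  mu.-integrable setT (EFin \o (fun t : R' => \1_`[0%R, T] t * ((n%:R + 2) * expR t))).
Proof.
have := @integrable_itv_continuous R (fun t => (n%:R + 2) * expR t) 0 T.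
have c : continuous (fun t : R => (n%:R + 2) * expR t).
  by move=> t; apply: cvgM; [exact: cvg_cst|exact: continuous_expR].
move=> /(_ c)/(integrable_mkcond _ _).1 => /(_ (measurable_itv _)).
rewrite (_ : _ \_ _ = EFin \o (fun t : R' => \1_`[0%R, T] t * ((n%:R + 2) * expR t))) //.
apply/funext => t; rewrite patchE /= indicE; case: ifP; rewrite ?mul1r ?mul0r //.
Qed.

(** One integration by parts gains the factor 1 / l. The price is the size of [oscP] = cosh^(2 - n)
    and of its derivative, both at most a multiple of exp t, the true order of growth when n = 1. *)
Lemma osc_head l (T : R) : Re l <= 0 -> 0 <= T ->
  normc l * normc (cint mu (fun t : R' => (\1_`[0%R, T] t)%:C * oscE l t)) <=
  (2 + 2 * (n%:R + 2)) * expR T.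
Proof.
move=> l0 T0.
pose U (t : R) := cexp ((tanh t)%:C * l) * (oscP t)%:C.
pose W (t : R) := cexp ((tanh t)%:C * l) * (oscP' t)%:C.
have nphase (t : R) : 0 <= t -> normc (cexp ((tanh t)%:C * l)) <= 1.
  move=> t0; rewrite normc_cexp -expR0 ler_expR ReM /= mul0r subr0 mulr_ge0_le0 //.
  rewrite /tanh divr_ge0 ?(ltW (cosh_gt0 _)) // /sinh divr_ge0 // subr_ge0 ler_expR.
  by rewrite ge0_cp.
have cW : ccont W by apply: ccontM (ccont_osc_phase l) _; apply: ccont_real; exact: continuous_oscP'.
have mcont (f : R -> R[i]) : ccont f -> cmeas (f : R' -> R[i]).
  by move=> [a b]; split; exact: continuous_measurable_fun.
have nU (t : R) : 0 <= t -> normc (U t) <= expR t.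
  move=> t0; have /andP[p0 p1] := oscP_bounds t0.
  rewrite Normc.normcM normc_real (ger0_norm p0) -[leRHS]mul1r.
  by apply: ler_pM => //; rewrite ?normc_ge0 ?nphase.
have nW (t : R') : normc ((\1_`[0%R, T] t)%:C * W t) <= \1_`[0%R, T] t * ((n%:R + 2) * expR t).
  rewrite Normc.normcM normc_real indicE; have [|_] := boolP (t \in _); last by rewrite normr0 !mul0r.
  move=> /set_mem h; have t0 : 0 <= t by move: h; rewrite /= in_itv /= => /andP[].
  rewrite normr1 !mul1r Normc.normcM normc_real -[leRHS]mul1r.
  by apply: ler_pM; rewrite ?normc_ge0 ?nphase ?oscP'_le.
have mE : cmeas (fun t : R' => (\1_`[0%R, T] t)%:C * W t).
  by apply: cmeas_indicM => //; exact: mcont.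
have iW := cintegrable_le mE (integrable_itv_expR T) nW.
have iE : cintegrable mu (fun t : R' => (\1_`[0%R, T] t)%:C * oscE l t).
  apply: (cintegrable_le (cmeas_indicM _ (cmeas_oscE l)) (integrable_RZ 2 (integrable_expRN_norm ltr01))) => //.
  move=> t; rewrite Normc.normcM normc_real indicE; have [|_] := boolP (t \in _); last first.
    by rewrite normr0 mul0r mulr_ge0 ?expR_ge0.
  move=> /set_mem h; have t0 : 0 <= t by move: h; rewrite /= in_itv /= => /andP[].
  by rewrite normr1 mul1r; apply: le_trans (normc_oscE_le l0 t0) (coshXN_le t).
have key : l * cint mu (fun t : R' => (\1_`[0%R, T] t)%:C * oscE l t) =
    (U T - U 0) - cint mu (fun t : R' => (\1_`[0%R, T] t)%:C * W t).
  apply/eqP; rewrite eq_sym subr_eq -cintZ // -cintD //; last exact: cintegrableZ.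
  apply/eqP; rewrite -(cintegral_is_cderive T0 (osc_derive l)); last first.
    apply: ccontD cW; apply: ccontM (ccont_oscE l); split => t; exact: cvg_cst.
  rewrite cintegral_indic; apply: eq_cint => t; rewrite /W; ring.
rewrite -Normc.normcM key.
apply: le_trans (le_normcD _ _) _; rewrite normcN mulrDl; apply: lerD.
  apply: le_trans (le_normcD _ _) _; rewrite normcN mulr_natl mulr2n; apply: lerD; first exact: nU.
  by apply: le_trans (nU _ (lexx _)) _; rewrite ler_expR.
apply: le_trans (normc_cint_le mE (integrable_itv_expR T) nW) _; rewrite -mulrA ler_pM2l //.
rewrite (_ : (fun _ => _) = ((fun t : R => (n%:R + 2) * expR t) \_ `[0, T])); last first.
  apply/funext => t; rewrite patchE /= indicE; case: ifP; rewrite ?mul1r ?mul0r //.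
rewrite -Rintegral_mkcond (@Rintegral_is_derive R (fun t => (n%:R + 2) * expR t)) //.
- by rewrite lerBlDr lerDl mulr_ge0 ?expR_ge0 // addr_ge0.
- by move=> t; apply: cvgM; [exact: cvg_cst|exact: continuous_expR].
Qed.

Lemma cint_obnd_cbnd (f : R' -> R[i]) :
  cintegrable mu (fun t : R' => (\1_`]0%R, +oo[ t)%:C * f t) ->
  cint mu (fun t : R' => (\1_`]0%R, +oo[ t)%:C * f t) =
  cint mu (fun t : R' => (\1_`[0%R, +oo[ t)%:C * f t).
Proof.
move=> [a b]; rewrite -!cintegral_indic; apply: complexP => /=.
  rewrite Rintegral_itv_obnd_cbnd //.
  apply/(integrable_mkcond _ _) => //; apply: eq_integrable a => // t _.
  rewrite patchE /= ReM /= mul0r subr0 indicE; case: ifP; rewrite ?mul1r ?mul0r //.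
rewrite Rintegral_itv_obnd_cbnd //.
apply/(integrable_mkcond _ _) => //; apply: eq_integrable b => // t _.
rewrite patchE /= ImM /= mul0r addr0 indicE; case: ifP; rewrite ?mul1r ?mul0r //.
Qed.

Definition s4 (y : R) : R := Num.sqrt (Num.sqrt y).

Lemma s4_ge0 y : 0 <= s4 y. Proof. exact: sqrtr_ge0. Qed.

Lemma s4_gt0 y : 0 < y -> 0 < s4 y. Proof. by move=> y0; rewrite !sqrtr_gt0. Qed.

Lemma sqr_s4 y : s4 y ^+ 2 = Num.sqrt y.
Proof. by rewrite sqr_sqrtr // sqrtr_ge0. Qed.

Lemma s4X4 y : 0 <= y -> s4 y ^+ 4 = y.
Proof. by move=> y0; rewrite (exprM _ 2 2) sqr_s4 sqr_sqrtr. Qed.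

Lemma ler_s4 x y : x <= y -> s4 x <= s4 y.
Proof. by move=> xy; rewrite /s4 !ler_wsqrtr. Qed.

Lemma s4_ge1 y : 1 <= y -> 1 <= s4 y.
Proof. by move=> /ler_s4; rewrite /s4 !sqrtr1. Qed.

Lemma s4M x y : 0 <= x -> s4 (x * y) = s4 x * s4 y.
Proof. by move=> x0; rewrite /s4 sqrtrM // sqrtrM // sqrtr_ge0. Qed.

(** Half of the decay exp (- t) yields the factor exp (- T / 2), the other half the convergence of
    the integral. *)
Lemma osc_tail l (T : R) : Re l <= 0 -> 0 <= T ->
  normc (cint mu (fun t : R' => (\1_`]T, +oo[ t)%:C * oscE l t)) <=
  expR (- (2^-1 * T)) * (2 * \int[mu]_t (2 * expR (- (2^-1 * `|t|)))).
Proof.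
move=> l0 T0.
have ig : mu.-integrable setT (EFin \o (fun t : R' => 2 * expR (- (2^-1 * `|t|)))).
  by apply: integrable_RZ; apply: integrable_expRN_norm; rewrite invr_gt0.
have := @normc_cint_le R _ _ mu (fun t : R' => (\1_`]T, +oo[ t)%:C * oscE l t)
  (fun t => expR (- (2^-1 * T)) * (2 * expR (- (2^-1 * `|t|)))).
rewrite RintegralZl // mulrCA; apply.
- by apply: cmeas_indicM => //; exact: cmeas_oscE.
- exact: integrable_RZ.
move=> t; rewrite Normc.normcM normc_real indicE; have [|_] := boolP (t \in _); last first.
  by rewrite normr0 mul0r !mulr_ge0 ?expR_ge0.
move=> /set_mem h; have tT : T < t by move: h; rewrite /= in_itv /= andbT.
have t0 : 0 <= t by rewrite (le_trans T0) // ltW.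
rewrite normr1 mul1r; apply: le_trans (normc_oscE_le l0 t0) _.
apply: le_trans (coshXN_le t) _; rewrite mulrCA ler_pM2l // -expRD ler_expR ger0_norm //.
lra.
Qed.

(* Integrate by parts up to T = ln (1 + |l|) / 2 and bound the tail trivially. *)
Lemma osc_bound : exists C : R, 0 < C /\
  forall l, Re l <= 0 -> normc (osc l) <= C / s4 (1 + normc l).
Proof.
pose I : R := 2 * \int[mu]_t (2 * expR (- (2^-1 * `|t|))).
have I0 : 0 <= I.
  by rewrite mulr_ge0 //; apply: Rintegral_ge0 => t _; rewrite mulr_ge0 ?expR_ge0.
pose H : R := 2 + 2 * (n%:R + 2).
pose J : R := 2 * \int[mu]_t (2 * expR (- (1 * `|t|))).
have J0 : 0 <= J.
  by rewrite mulr_ge0 //; apply: Rintegral_ge0 => t _; rewrite mulr_ge0 ?expR_ge0.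
have H0 : 0 <= H by rewrite !addr_ge0 // mulr_ge0 // addr_ge0.
exists (J + 2 * H + I + 1); split; first by rewrite ltr_wpDl // !addr_ge0 // mulr_ge0.
move=> l l0; have nl0 := normc_ge0 l.
set y := 1 + normc l; have y1 : 1 <= y by rewrite lerDl.
have y0 : 0 < y by rewrite (lt_le_trans ltr01).
(* With exp T = y^(1/2) the head is of order y^(-1/2) and the tail of order y^(-1/4), which decides
   the exponent. *)
pose T := ln (Num.sqrt y).
have sy1 : 1 <= Num.sqrt y by rewrite -[leLHS]sqrtr1 ler_wsqrtr.
have sy0 : 0 < Num.sqrt y by rewrite sqrtr_gt0.
have T0 : 0 <= T by rewrite ln_ge0.
have eT : expR T = Num.sqrt y by rewrite lnK.
have eT2 : expR (- (2^-1 * T)) = (s4 y)^-1.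
  rewrite expRN; congr (_^-1); apply/eqP.
  rewrite -(@eqrXn2 _ 2) ?expR_ge0 ?s4_ge0 // sqr_s4 -eT expr2 -expRD; apply/eqP; congr expR; lra.
have s0 : 0 < s4 y by exact: s4_gt0.
have split : osc l = cint mu (fun t : R' => (\1_`[0%R, T] t)%:C * oscE l t) +
   cint mu (fun t : R' => (\1_`]T, +oo[ t)%:C * oscE l t).
  rewrite /osc cint_obnd_cbnd; last exact: cintegrable_osc.
  have ii (D : set R') : measurable D -> (forall t, D t -> 0 <= t) ->
      cintegrable mu (fun t : R' => (\1_D t)%:C * oscE l t).
    move=> mD D0; apply: (cintegrable_le (cmeas_indicM mD (cmeas_oscE l)) (integrable_RZ 2 (integrable_expRN_norm ltr01))).
    move=> t; rewrite Normc.normcM normc_real indicE; have [|_] := boolP (t \in _); last first.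
      by rewrite normr0 mul0r mulr_ge0 ?expR_ge0.
    by move=> /set_mem /D0 t0; rewrite normr1 [leLHS]mul1r; apply: le_trans (normc_oscE_le l0 t0) (coshXN_le t).
  rewrite -cintD.
  - apply: eq_cint => t; rewrite -mulrDl -rmorphD /=; congr (_ * _); apply: complexP => //=.
    rewrite !indicE !mem_setE !in_itv /= andbT; have [Tt|tT] := ltP T t.
      by rewrite (ltW (le_lt_trans T0 Tt)) andbF add0r.
    by rewrite andbT addr0.
  - by apply: ii => // t; rewrite /= in_itv /= => /andP[].
  - by apply: ii => // t; rewrite /= in_itv /= andbT => /ltW; exact: le_trans.
have hd := osc_head l0 T0; have tl := osc_tail l0 T0.
set a := cint mu _ in hd split; set b := cint mu _ in tl split.
rewrite split; apply: le_trans (le_normcD _ _) _.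
rewrite eT2 -/I in tl; rewrite eT -/H in hd.
(* The trivial bound covers small l, on which [osc_head] gives no information. *)
have a1 : normc a <= J.
  apply: normc_cint_le.
  - by apply: cmeas_indicM => //; exact: cmeas_oscE.
  - by apply: integrable_RZ; exact: integrable_expRN_norm.
  move=> t; rewrite Normc.normcM normc_real indicE; have [|_] := boolP (t \in _); last first.
    by rewrite normr0 mul0r mulr_ge0 ?expR_ge0.
  move=> /set_mem h; have t0 : 0 <= t by move: h; rewrite /= in_itv /= => /andP[].
  by rewrite normr1 [leLHS]mul1r; apply: le_trans (normc_oscE_le l0 t0) (coshXN_le t).
have sy : Num.sqrt y ^+ 2 = y by rewrite sqr_sqrtr // ltW.
have s4y : s4 y ^+ 2 = Num.sqrt y by rewrite sqr_s4.
have s41 : 1 <= s4 y by exact: s4_ge1.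
have a2 : normc a * s4 y <= J + H.
  have a0 := normc_ge0 a.
  have h : normc a * y <= J * Num.sqrt y + H * Num.sqrt y.
    rewrite /y mulrDr mulr1; apply: lerD; last by rewrite mulrC.
    by rewrite (le_trans a1) // ler_peMr.
  have h2 : normc a * Num.sqrt y <= J + H by rewrite -(ler_pM2r sy0) mulrDl -mulrA -expr2 sy.
  apply: le_trans h2; rewrite ler_wpM2l // -s4y expr2 ler_peMr // ltW //.
rewrite ler_pdivlMr // mulrDl.
have b2 : normc b * s4 y <= I by rewrite -ler_pdivlMr // mulrC.
lra.
Qed.

End oscillation.

(** * Integrability of the singular weights *)

Section pole_weights.
Context {R : realType}.
Local Notation L := (@lebesgue_rV R).
Local Notation R' := (measurableTypeR R).
Local Notation mu := (@lebesgue_measure R).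

(** The uniqueness argument of [ge0_integral_lebesgue_affine] for the ratio -1; the preimage of an
    interval open on the left is now open on the right, of the same length. *)
Lemma ge0_integral_lebesgueN (f : R' -> \bar R) : measurable_fun setT f -> (forall x, 0 <= f x)%E ->
  (\int[mu]_x f (- x)%R = \int[mu]_x f x)%E.
Proof.
move=> mf f0.
pose p : R' -> R' := fun x => - x.
have mp : measurable_fun setT p by exact: measurable_funN.
pose nu0 : {measure set R' -> \bar R} := pushforward mu p.
pose nu := nu0 mp.
have E A : measurable A -> mu A = nu A.
  apply: lebesgue_measure_unique => X [[c d] _ <-] /=.
  rewrite /nu /= /pushforward.
  rewrite (_ : p @^-1` _ = `[- d, - c[%classic); last first.
    apply/seteqP; split => x /=; rewrite !in_itv /= /p.
      by move=> /andP[h1 h2]; rewrite lerNl ltrNr h1 h2.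
    by move=> /andP[h1 h2]; rewrite lerNl ltrNr h1 h2.
  by rewrite !lebesgue_measure_itv /= !lte_fin ltrN2; case: ifP => // _; rewrite -!EFinD opprK addrC.
have -> : (\int[mu]_x f x = \int[nu]_x f x)%E.
  by apply: eq_measure_integral => A mA _; exact: E.
by rewrite ge0_integral_pushforward.
Qed.

Lemma measurable_s4 : measurable_fun setT (@s4 R).
Proof. exact: (measurableT_comp measurable_sqrt measurable_sqrt). Qed.

Lemma continuous_s4 : continuous (@s4 R).
Proof. by move=> x; apply: continuous_comp; exact: sqrt_continuous. Qed.

(* |y|^(-3/4), as [s4] is the fourth root. *)
Definition pole (y : R') : \bar R :=
  if y == 0 then +oo%E else ((s4 `|y|)^-1 ^+ 3)%:E.

Lemma pole_ge0 y : (0 <= pole y)%E.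
Proof. by rewrite /pole; case: ifP => // _; rewrite lee_fin exprn_ge0 // invr_ge0 s4_ge0. Qed.

Lemma measurable_pole : measurable_fun setT pole.
Proof.
apply: measurable_fun_ifT => //; first exact: measurable_fun_eqr.
apply/measurable_EFinP; apply: measurable_funX.
apply: (measurableT_comp measurable_invr); apply: (measurableT_comp measurable_s4).
exact: normr_measurable.
Qed.

Lemma is_derive_s4 (y : R) : 0 < y -> is_derive y (1 : R) (fun x => 4 * s4 x) ((s4 y)^-1 ^+ 3).
Proof.
move=> y0; have sy : 0 < Num.sqrt y by rewrite sqrtr_gt0.
have ssy := s4_gt0 y0.
apply: (is_derive_eq (is_derive1_comp (is_derive_mull 4 _)
  (is_derive1_comp (is_derive1_sqrt sy) (is_derive1_sqrt y0)))).
rewrite /GRing.scale /= -/(s4 y) -sqr_s4; field.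
by rewrite gt_eqF.
Qed.

Lemma integral_pole_itv (a : R) : 0 < a < 1 -> (\int[mu]_(y in `[a, 1%R]) pole y <= 4%:E)%E.
Proof.
move=> /andP[a0 a1].
rewrite (_ : (\int[mu]_(y in _) _)%E = (\int[mu]_(y in `[a, 1%R]) ((s4 y)^-1 ^+ 3)%:E)%E); last first.
  apply: eq_integral => y /[!inE] /=; rewrite in_itv /= => /andP[ay _].
  have y0 := lt_le_trans a0 ay.
  by rewrite /pole gt_eqF // gtr0_norm.
rewrite (@continuous_FTC2 R _ (fun x => 4 * s4 x)) //.
- rewrite -EFinB lee_fin /s4 !sqrtr1 mulr1 lerBlDr lerDl mulr_ge0 //; exact: s4_ge0.
- apply: continuous_in_subspaceT => y /[!inE] /=; rewrite in_itv /= => /andP[ay _].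
  have y0 := lt_le_trans a0 ay.
  apply: (continuous_comp (f := fun x : R => (s4 x)^-1) (g := fun x : R => x ^+ 3)).
    by apply: cvgV; [rewrite gt_eqF // s4_gt0|exact: continuous_s4].
  exact: exprn_continuous.
- split.
  + move=> y; rewrite in_itv /= => /andP[ay _]; have y0 := lt_trans a0 ay.
    by case: (is_derive_s4 y0).
  + apply: cvg_at_right_filter; apply: cvgM; [exact: cvg_cst|exact: continuous_s4].
  + apply: cvg_at_left_filter; apply: cvgM; [exact: cvg_cst|exact: continuous_s4].
- move=> y; rewrite in_itv /= => /andP[ay _]; have y0 := lt_trans a0 ay.
  by rewrite derive1E; case: (is_derive_s4 y0).
Qed.

Lemma integral_pole01 : (\int[mu]_(y in `[0%R, 1%R]) pole y <= 4%:E)%E.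
Proof.
rewrite -integral_itv_obnd_cbnd; last exact: measurable_funTS measurable_pole.
(* Starting at 1 / 2 keeps the left endpoint strictly below 1, as [integral_pole_itv] requires. *)
pose F (i : nat) : set R' := `[i.+2%:R^-1, 1]%classic.
have -> : `]0%R, 1%R]%classic = \bigcup_i F i.
  apply/seteqP; split => y /=.
    rewrite in_itv /= => /andP[y0 y1].
    exists (Num.bound y^-1) => //; rewrite /F /= in_itv /= y1 andbT.
    rewrite -[leRHS]invrK lef_pV2 ?posrE ?invr_gt0 //.
    have yV0 : 0 <= y^-1 by rewrite invr_ge0 ltW.
    by rewrite (le_trans (ltW (archi_boundP yV0))) // ler_nat (leq_trans (leqnSn _)) // leqnSn.
  move=> [i _]; rewrite /F /= !in_itv /= => /andP[h ->]; rewrite andbT.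
  by apply: lt_le_trans h; rewrite invr_gt0.
apply: (cvge_le _ (ge0_nondecreasing_set_cvg_integral (F := F) (f := pole) (mu := mu) _ _ _ _)).
- apply: nearW => i; apply: integral_pole_itv.
  by rewrite invr_gt0 ltr0n /= invf_lt1 // ltr1n.
- move=> i j ij; apply/subsetPset => y; rewrite /F /= !in_itv /= => /andP[h ->].
  by rewrite andbT (le_trans _ h) // lef_pV2 ?posrE // ler_nat !ltnS.
- by move=> i; exact: measurable_itv.
- by move=> i; exact: measurable_funTS measurable_pole.
- by move=> i y _; exact: pole_ge0.
Qed.

Definition pole1 (y : R') : \bar R := (pole \_ `[(-1)%R, 1%R]) y.

Lemma pole1_ge0 y : (0 <= pole1 y)%E.
Proof. by rewrite /pole1 patchE; case: ifP => // _; exact: pole_ge0. Qed.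

Lemma measurable_pole1 : measurable_fun setT pole1.
Proof. by apply/(measurable_restrictT _ _).1 => //; exact: measurable_funTS measurable_pole. Qed.

Lemma integral_pole1 : (\int[mu]_y pole1 y <= 8%:E)%E.
Proof.
pose g := pole \_ `[0%R, 1%R].
have mg : measurable_fun setT g.
  by apply/(measurable_restrictT _ _).1 => //; exact: measurable_funTS measurable_pole.
have g0 y : (0 <= g y)%E by rewrite /g patchE; case: ifP => // _; exact: pole_ge0.
have ig : (\int[mu]_y g y <= 4%:E)%E by rewrite -integral_mkcond; exact: integral_pole01.
have mgN : measurable_fun setT (fun y : R' => g (- y)).
  by apply: (measurableT_comp mg); exact: measurable_funN.
apply: (@le_trans _ _ (\int[mu]_y (g y + g (- y)%R))%E).
  apply: ge0_le_integral => //.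
  - by move=> y _; exact: pole1_ge0.
  - exact: measurable_pole1.
  - exact: emeasurable_funD.
  move=> y _; rewrite /pole1 patchE mem_setE in_itv /=; case: ifP => [/andP[y1 y2]|_]; last exact: adde_ge0.
  have [y0|y0] := leP 0 y.
    by rewrite /g patchE mem_setE in_itv /= y0 y2 leeDl.
  rewrite [X in (_ <= _ + X)%E](_ : _ = pole y) ?leeDr //.
  rewrite /g patchE mem_setE in_itv /= oppr_ge0 (ltW y0) lerNl y1 /= /pole oppr_eq0.
  by rewrite normrN.
rewrite ge0_integralD // ge0_integral_lebesgueN //.
have -> : 8%:E = (4%:E + 4%:E)%E :> \bar R by rewrite -EFinD -natrD.
exact: leeD.
Qed.

(** Uniform in the position of the pole. At distance more than 1 from it [pole] is at most 1 and the
    weight is integrable; closer to it the weight is at most 1 and translation invariance removes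
    rho. *)
Lemma weight_pole_bound : exists2 K : R, 0 <= K &
  forall rho : R, (\int[mu]_a ((1 + a ^+ 2)^-1%:E * pole (a + rho)%R) <= K%:E)%E.
Proof.
pose wt (x : R') : R := (1 + x ^+ 2)^-1.
have w0 x : 0 < wt x by rewrite invr_gt0 oneDsqr_gt0'.
have mw : measurable_fun setT wt by apply/measurable_EFinP; exact: measurable_int (@integrable_oneDsqrV R).
exists (\int[mu]_x wt x + 8) => [|rho].
  by rewrite addr_ge0 //; apply: Rintegral_ge0 => x _; exact: ltW.
have mt : measurable_fun setT (fun x : R' => x + rho : R') by exact: measurable_funD.
apply: (@le_trans _ _ (\int[mu]_a ((wt a)%:E + pole1 (a + rho)%R))%E).
  apply: ge0_le_integral => //.
  - by move=> y _; apply: mule_ge0; [rewrite lee_fin; exact: (ltW (w0 y))|exact: pole_ge0].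
  - apply: emeasurable_funM; first exact/measurable_EFinP.
    exact: (measurableT_comp measurable_pole mt).
  - apply: emeasurable_funD; first exact/measurable_EFinP.
    exact: (measurableT_comp measurable_pole1 mt).
  move=> a _; set y := a + rho.
  have w1 : wt a <= 1 by rewrite invf_le1 ?oneDsqr_gt0' // lerDl sqr_ge0.
  rewrite /pole1 patchE mem_setE in_itv /=; case: ifP => [_|].
    apply: (@le_trans _ _ (pole y)); last by rewrite leeDr // lee_fin ltW.
    rewrite -[leRHS]mul1e; apply: lee_pmul => //; rewrite ?pole_ge0 // lee_fin; exact: (ltW (w0 a)).
  rewrite -ler_norml => /negbT; rewrite -ltNge => y1.
  have y0 : y != 0 by rewrite -normr_gt0 (lt_trans ltr01).
  rewrite /pole (negbTE y0) -EFinM adde0 lee_fin -[leRHS]mulr1 ler_wpM2l ?(ltW (w0 _)) //.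
  rewrite exprn_ile1 ?invr_ge0 ?s4_ge0 // invf_le1 ?s4_gt0 ?normr_gt0 //.
  exact: s4_ge1 (ltW y1).
rewrite ge0_integralD //; last 4 first.
- by move=> y _; rewrite lee_fin ltW.
- exact/measurable_EFinP.
- by move=> y _; exact: pole1_ge0.
- exact: (measurableT_comp measurable_pole1 mt).
rewrite EFinD; apply: leeD.
  by rewrite /Rintegral fineK // integrable_fin_num //; exact: integrable_oneDsqrV.
have := @ge0_integral_lebesgue_affine R 1 rho ltr01 pole1 measurable_pole1 pole1_ge0.
rewrite invr1 mul1e (_ : (fun x => _) = (fun x : R' => pole1 (x + rho))).
  by move=> ->; exact: integral_pole1.
by apply/funext => x; rewrite mul1r.
Qed.

(** With u = |x|^(-1/4) and v = |y|^(-1/4) the left-hand side is at most s4 eta * u v. Then 2 u v <=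
    u^2 + v^2 and w^2 <= 1 + w^3 trade the product of two poles for a sum, whose terms can be
    integrated one by one. *)
Lemma s4_kernel_le (x y z eta : R) : x != 0 -> y != 0 -> 0 < eta -> `|x| * `|y| <= z ->
  (s4 (1 + z / eta))^-1 <= s4 eta * (1 + (s4 `|x|)^-1 ^+ 3 + (s4 `|y|)^-1 ^+ 3).
Proof.
move=> x0 y0 e0 xyz.
have sx : 0 < s4 `|x| by rewrite s4_gt0 // normr_gt0.
have sy : 0 < s4 `|y| by rewrite s4_gt0 // normr_gt0.
have se := s4_gt0 e0.
have h : s4 `|x| * s4 `|y| <= s4 eta * s4 (1 + z / eta).
  rewrite -!s4M ?normr_ge0 ?(ltW e0) //; apply: ler_s4.
  rewrite mulrDr mulr1 mulrCA mulfV ?mulr1 ?gt_eqF //; lra.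
set u := (s4 `|x|)^-1; set v := (s4 `|y|)^-1.
have u0 : 0 < u by rewrite invr_gt0. 
have v0 : 0 < v by rewrite invr_gt0.
have s0 : 0 < s4 (1 + z / eta).
  by apply: s4_gt0; rewrite ltr_wpDr // divr_ge0 ?(ltW e0) // (le_trans _ xyz) // mulr_ge0.
apply: (@le_trans _ _ (s4 eta * (u * v))); last first.
  rewrite ler_wpM2l ?(ltW se) //.
  have : 0 <= (u - v) ^+ 2 by exact: sqr_ge0.
  have g (w : R) : 0 < w -> w ^+ 2 <= 1 + w ^+ 3.
    move=> w0; have [w1|w1] := leP w 1.
      by rewrite (@le_trans _ _ 1) // ?lerDl ?exprn_ge0 ?(ltW w0) // expr_le1 // ltW.
    by rewrite (le_trans (ler_weXn2l (ltW w1) (leqnSn 2))) // lerDr.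
  have := g u u0; have := g v v0; rewrite sqrrB; set a := u ^+ 3; set b := v ^+ 3.
  have a0 : 0 <= a by rewrite exprn_ge0 // ltW.
  have b0 : 0 <= b by rewrite exprn_ge0 // ltW.
  lra.
by rewrite -[leLHS]mul1r ler_pdivrMr // /u /v -invfM mulrAC ler_pdivlMr ?mulr_gt0 // mul1r.
Qed.

(** For r <= 0 factor a^2 + r = (a + rho) (a - rho) and apply [s4_kernel_le] to the two factors. The
    number r will stand for the contribution of the other coordinates to P, hence the uniformity in
    r. *)
Lemma quadratic_pole_bound : exists2 K : R, 0 <= K & forall eta r : R, 0 < eta ->
  (\int[mu]_a ((1 + a ^+ 2)^-1 / s4 (1 + `|a ^+ 2 + r| / eta))%:E <= (K * s4 eta)%:E)%E.
Proof.
pose wt (x : R') : R := (1 + x ^+ 2)^-1.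
have w0 x : 0 < wt x by rewrite invr_gt0 oneDsqr_gt0'.
have mw : measurable_fun setT wt by apply/measurable_EFinP; exact: measurable_int (@integrable_oneDsqrV R).
have [K K0 hK] := weight_pole_bound.
pose W := \int[mu]_x wt x.
have W0 : 0 <= W by apply: Rintegral_ge0 => x _; exact: ltW.
exists (W + K + K) => [|eta r e0]; first by rewrite !addr_ge0.
(* For r > 0 this square root is 0 by convention, and |a| |a| <= |a^2 + r| is still what
   [s4_kernel_le] needs. *)
pose rho := Num.sqrt (- r).
have mt (c : R) : measurable_fun setT (fun x : R' => x + c : R') by exact: measurable_funD.
have mp (c : R) : measurable_fun setT (fun a : R' => (wt a)%:E * pole (a + c)%R)%E.
  apply: emeasurable_funM; first exact/measurable_EFinP.
  exact: (measurableT_comp measurable_pole (mt c)).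
have p0 (c : R) a : (0 <= (wt a)%:E * pole (a + c)%R)%E.
  by rewrite mule_ge0 ?pole_ge0 // lee_fin ltW.
have se := s4_gt0 e0.
apply: (@le_trans _ _ (\int[mu]_a ((s4 eta)%:E * ((wt a)%:E + (wt a)%:E * pole (a + rho)%R +
   (wt a)%:E * pole (a + - rho)%R)))%E).
  apply: ge0_le_integral => //.
  - by move=> a _; rewrite lee_fin mulr_ge0 ?invr_ge0 ?s4_ge0 // ltW // oneDsqr_gt0'.
  - apply/measurable_EFinP; apply: measurable_funM => //.
    apply: (measurableT_comp measurable_invr); apply: (measurableT_comp measurable_s4).
    apply: measurable_funD => //; apply: measurable_funM => //; apply: measurableT_comp => //.
    by apply: measurable_funD => //; exact: measurable_funX.
  - apply: emeasurable_funM => //; apply: emeasurable_funD => //; apply: emeasurable_funD => //.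
    exact/measurable_EFinP.
  move=> a _; rewrite /pole.
  have wn : (0 < (wt a)%:E)%E by rewrite lte_fin.
  have inf0 (z : \bar R) : (0 <= z)%E -> ((s4 eta)%:E * (z + +oo) = +oo)%E.
    move=> z0; rewrite addey ?gt0_muley ?lte_fin //.
    by apply/eqP => zn; rewrite zn in z0.
  (* At the two poles a = - rho and a = rho the majorant is +oo, so the inequality holds
     everywhere. *)
  case: ifP => [_|/negbT x0].
    rewrite (gt0_muley wn) addey // addeC inf0 ?leey //; exact: (p0 (- rho) a).
  case: ifP => [_|/negbT y0].
    rewrite (gt0_muley wn) inf0 ?leey //; apply: adde_ge0; first by rewrite lee_fin ltW.
    by rewrite mule_ge0 ?(ltW wn) // lee_fin exprn_ge0 // invr_ge0 s4_ge0.
  have -> : ((s4 eta)%:E * ((wt a)%:E + (wt a)%:E * ((s4 `|a + rho|)^-1 ^+ 3)%:E + (wt a)%:E * ((s4 `|a - rho|)^-1 ^+ 3)%:E) =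
    (wt a * (s4 eta * (1 + (s4 `|a + rho|)^-1 ^+ 3 + (s4 `|a - rho|)^-1 ^+ 3)))%:E)%E.
    set u := _ ^+ 3; set v := _ ^+ 3.
    rewrite [LHS](_ : _ = (s4 eta * (wt a + wt a * u + wt a * v))%:E) //.
    by congr EFin; ring.
  rewrite lee_fin ler_pM2l //.
  apply: s4_kernel_le => //; rewrite -normrM mulrDl !mulrDr.
  rewrite mulrN (mulrC rho a) addrA subrK mulrN -expr2 -expr2 /rho.
  have [r0|r0] := leP r 0; first by rewrite sqr_sqrtr ?oppr_ge0 // opprK.
  rewrite ler0_sqrtr ?oppr_le0 ?(ltW r0) // expr0n /= subr0 !ger0_norm ?addr_ge0 ?sqr_ge0 ?(ltW r0) //.
  by rewrite lerDl ltW.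
rewrite ge0_integralZl //; last 3 first.
- apply: emeasurable_funD => //; apply: emeasurable_funD => //.
  exact/measurable_EFinP.
- by move=> a _; rewrite !adde_ge0 // lee_fin ltW.
- by rewrite lee_fin ltW.
rewrite mulrC EFinM lee_pmul2l ?lte_fin //.
have mwE : measurable_fun setT (EFin \o wt) by exact/measurable_EFinP.
rewrite ge0_integralD //; last 2 first.
- by move=> a _; rewrite adde_ge0 // lee_fin ltW.
- exact: emeasurable_funD.
rewrite ge0_integralD //; last by move=> a _; rewrite lee_fin ltW.
rewrite !EFinD; apply: leeD; last exact: hK.
apply: leeD; last exact: hK.
by rewrite /W /Rintegral fineK // integrable_fin_num //; exact: integrable_oneDsqrV.
Qed.

Lemma cons_rV_lift m a (v : 'rV[R]_m) (i : 'I_m.+1) : i != ord0 ->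
  cons_rV (a, v) ord0 i = cons_rV (0 : R, v) ord0 i.
Proof. by have [j ->|->] := unliftP ord0 i; rewrite ?eqxx // !cons_rVS. Qed.

Lemma P_cons_rV n (a : R) (v : 'rV[R]_(n + n.+1)) :
  P (cons_rV (a, v) : 'rV[R]_(n.+1 + n.+1)) = a ^+ 2 + P (cons_rV (0, v) : 'rV[R]_(n.+1 + n.+1)).
Proof.
rewrite /P !big_ord_recl /=.
have e0 : lshift n.+1 (ord0 : 'I_n.+1) = ord0 :> 'I_(n + n.+1).+1 by apply/val_inj.
have e1 (b : R) : cons_rV (b, v) ord0 (lshift n.+1 (ord0 : 'I_n.+1)) = b.
  by rewrite e0 cons_rV0.
have er j b : cons_rV (b, v) ord0 (rshift n.+1 j) = cons_rV (0 : R, v) ord0 (rshift n.+1 j).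
  by rewrite cons_rV_lift // -val_eqE.
have el j b : cons_rV (b, v) ord0 (lshift n.+1 (lift ord0 j)) = cons_rV (0 : R, v) ord0 (lshift n.+1 (lift ord0 j)).
  by rewrite cons_rV_lift // -val_eqE.
rewrite !e1 er expr0n /= add0r addrA; congr (_ + _).
by apply: eq_bigr => j _; rewrite er el.
Qed.

Lemma measurable_P n : measurable_fun setT (@P R n).
Proof.
apply: measurable_sum => i; apply: measurable_funB; apply: measurable_funX; exact: measurable_coord.
Qed.

Lemma rV_weight_cons m a (v : 'rV[R]_m) :
  rV_weight (cons_rV (a, v)) = (1 + a ^+ 2)^-1 * rV_weight v.
Proof. by rewrite /rV_weight (prod_cons_rV (fun _ x => (1 + x ^+ 2)^-1)). Qed.

Lemma measurable_rV_weight m : measurable_fun setT (@rV_weight R m).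
Proof. by apply/measurable_EFinP; exact: measurable_int (@integrable_rV_weight R m). Qed.

Lemma integral_rV_weight m : (\int[L m]_v (rV_weight v)%:E = (\int[L m]_v rV_weight v)%:E)%E.
Proof. by rewrite /Rintegral fineK // integrable_fin_num //; exact: integrable_rV_weight. Qed.

Lemma Rintegral_rV_weight_ge0 m : 0 <= \int[L m]_v rV_weight v.
Proof. by apply: Rintegral_ge0 => v _; rewrite ltW // rV_weight_gt0. Qed.

(** By [P_cons_rV] the form is a^2 + r in its first coordinate. The bound uniform in r is then
    integrated over the remaining coordinates against their weight. *)
Lemma quadratic_form_bound n : (1 <= n)%N -> exists2 K : R, 0 <= K & forall eta : R, 0 < eta ->
  (\int[L (n + n)]_xi (rV_weight xi / s4 (1 + `|P xi| / eta))%:E <= (K * s4 eta)%:E)%E.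
Proof.
case: n => // n _; have [K K0 hK] := quadratic_pole_bound.
exists (K * \int[L (n + n.+1)]_v rV_weight v) => [|eta e0].
  by rewrite mulr_ge0 // Rintegral_rV_weight_ge0.
have se := s4_gt0 e0.
have mf m (Q : 'rV[R]_m -> R) : measurable_fun setT Q ->
    measurable_fun setT (fun v : 'rV[R]_m => (rV_weight v / s4 (1 + `|Q v| / eta))%:E).
  move=> mQ; apply/measurable_EFinP; apply: measurable_funM; first exact: measurable_rV_weight.
  apply: (measurableT_comp measurable_invr); apply: (measurableT_comp measurable_s4).
  by apply: measurable_funD => //; apply: measurable_funM => //; exact: measurableT_comp.
have f0 m (Q : 'rV[R]_m -> R) v : (0 <= (rV_weight v / s4 (1 + `|Q v| / eta))%:E)%E.
  by rewrite lee_fin mulr_ge0 ?invr_ge0 ?s4_ge0 // ltW // rV_weight_gt0.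
have m1 := mf _ _ (@measurable_P n.+1).
pose F (xi : 'rV[R]_(n + n.+1).+1) : \bar R :=
  (rV_weight xi / s4 (1 + `|P (xi : 'rV[R]_(n.+1 + n.+1))| / eta))%:E.
have mF : measurable_fun setT F := m1.
have F0 x : (0 <= F x)%E by exact: (f0 _ (@P R n.+1)).
change (\int[L (n + n.+1).+1]_xi F xi <= (K * (\int[L (n + n.+1)]_v rV_weight v) * s4 eta)%:E)%E.
rewrite ge0_integral_rVS2 //.
pose F2 (p : R' * 'rV[R]_(n + n.+1)) := F (cons_rV p).
have m2 : measurable_fun setT F2.
  by apply: (measurableT_comp mF); exact: measurable_cons_rV.
have F20 p : (0 <= F2 p)%E by exact: F0.
rewrite -(fubini_tonelli1 _ m2) // (fubini_tonelli2 _ m2) //.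
apply: (@le_trans _ _ (\int[L (n + n.+1)]_v ((K * s4 eta)%:E * (rV_weight v)%:E))%E); last first.
  rewrite ge0_integralZl //; first by rewrite integral_rV_weight -EFinM lee_fin mulrAC.
  - by apply/measurable_EFinP; exact: measurable_rV_weight.
  - by move=> v _; rewrite lee_fin ltW // rV_weight_gt0.
  - by rewrite lee_fin mulr_ge0 // ltW.
apply: ge0_le_integral => //.
- by move=> v _; apply: integral_ge0.
- exact: (measurable_fun_fubini_tonelli_G _ m2 F20).
- apply: emeasurable_funM => //; apply/measurable_EFinP; exact: measurable_rV_weight.
move=> v _; rewrite /fubini_G; under eq_integral => a _ do
  rewrite /F2 /F rV_weight_cons P_cons_rV (mulrC (1 + a ^+ 2)^-1) -mulrA EFinM.
rewrite ge0_integralZl //; last 3 first.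
- apply/measurable_EFinP; apply: measurable_funM.
    by apply/measurable_EFinP; exact: measurable_int (@integrable_oneDsqrV R).
  apply: (measurableT_comp measurable_invr); apply: (measurableT_comp measurable_s4).
  apply: measurable_funD => //; apply: measurable_funM => //; apply: measurableT_comp => //.
  by apply: measurable_funD => //; exact: measurable_funX.
- by move=> a _; rewrite lee_fin mulr_ge0 ?invr_ge0 ?s4_ge0 // ltW // oneDsqr_gt0'.
- by rewrite lee_fin ltW // rV_weight_gt0.
rewrite muleC; apply: lee_wpmul2r; first by rewrite lee_fin ltW // rV_weight_gt0.
exact: hK.
Qed.

(** The singularity |th|^(-3/4) is at most |a|^(-3/4) for the first coordinate a of th, which is
    integrable on the line, so that s = 1 is included. *)
Lemma radial_pole_bound s : (1 <= s)%N -> exists K : R,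
  (\int[L s]_th ((eucl_norm th)^-1 * s4 (eucl_norm th) * rV_weight th)%:E <= K%:E)%E.
Proof.
case: s => // s _; have [K K0 hK] := weight_pole_bound.
exists (K * \int[L s]_v rV_weight v).
have f0 m (v : 'rV[R]_m) : (0 <= ((eucl_norm v)^-1 * s4 (eucl_norm v) * rV_weight v)%:E)%E.
  by rewrite lee_fin !mulr_ge0 ?invr_ge0 ?s4_ge0 ?eucl_norm_ge0 // ltW // rV_weight_gt0.
rewrite ge0_integral_rVS2 //; last first.
  apply/measurable_EFinP; apply: measurable_funM; last exact: measurable_rV_weight.
  apply: measurable_funM; first by apply: (measurableT_comp measurable_invr); exact: measurable_eucl_norm.
  by apply: (measurableT_comp measurable_s4); exact: measurable_eucl_norm.
pose g (p : R' * 'rV[R]_s) := ((1 + p.1 ^+ 2)^-1%:E * pole p.1 * (rV_weight p.2)%:E)%E.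
have w0 a : (0 <= (1 + a ^+ 2)^-1%:E * pole a)%E :> Prop.
  by rewrite mule_ge0 ?pole_ge0 // lee_fin invr_ge0 ltW // oneDsqr_gt0'.
have mw : measurable_fun setT (fun a : R' => (1 + a ^+ 2)^-1%:E * pole a)%E.
  by apply: emeasurable_funM; [exact: measurable_int (@integrable_oneDsqrV R)|exact: measurable_pole].
apply: (@le_trans _ _ (\int[mu]_a \int[L s]_v g (a, v))%E).
  have mf : measurable_fun setT (fun p : R' * 'rV[R]_s => ((eucl_norm (cons_rV p))^-1 * s4 (eucl_norm (cons_rV p)) * rV_weight (cons_rV p))%:E).
    apply/measurable_EFinP; apply: (measurableT_comp (f := fun v : 'rV[R]_s.+1 =>
       (eucl_norm v)^-1 * s4 (eucl_norm v) * rV_weight v)); last exact: measurable_cons_rV.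
    apply: measurable_funM; last exact: measurable_rV_weight.
    apply: measurable_funM; first by apply: (measurableT_comp measurable_invr); exact: measurable_eucl_norm.
    by apply: (measurableT_comp measurable_s4); exact: measurable_eucl_norm.
  have mg : measurable_fun setT g.
    apply: emeasurable_funM.
      by apply: (measurableT_comp mw); exact: measurable_fst.
    apply/measurable_EFinP; apply: (measurableT_comp (@measurable_rV_weight s)); exact: measurable_snd.
  have g0 p : (0 <= g p)%E by rewrite mule_ge0 // lee_fin ltW // rV_weight_gt0.
  rewrite -(fubini_tonelli1 _ mf) // -(fubini_tonelli1 _ mg) //.
  apply: ge0_le_integral => //.
  move=> -[a v] _; rewrite /g /= rV_weight_cons.
  have wv := rV_weight_gt0 v; have wa := oneDsqr_gt0' a.
  rewrite /pole; case: ifP => [_|/negbT a0].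
    by rewrite gt0_muley ?lte_fin ?invr_gt0 // gt0_mulye ?lte_fin // leey.
  rewrite -!EFinM lee_fin mulrA ler_pM2r // mulrC ler_pM2l ?invr_gt0 //.
  have na : 0 < `|a| by rewrite normr_gt0.
  set t := eucl_norm _.
  have at_ : `|a| <= t by have := eucl_norm_coord (cons_rV (a, v)) ord0; rewrite cons_rV0.
  have t0 : 0 < t by exact: lt_le_trans at_.
  have st := s4_gt0 t0; have sa := s4_gt0 na.
  rewrite -{1}(s4X4 (ltW t0)) exprS invfM mulrAC mulVf ?gt_eqF // mul1r exprVn lef_pV2 ?posrE ?exprn_gt0 //.
  by rewrite lerXn2r ?nnegrE ?s4_ge0 // ler_s4.
have wi : (\int[L s]_v (rV_weight v)%:E)%E \is a fin_num by rewrite integral_rV_weight.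
rewrite (_ : (\int[mu]_a _)%E = (\int[mu]_a ((1 + a ^+ 2)^-1%:E * pole a * \int[L s]_v (rV_weight v)%:E))%E); last first.
  apply: eq_integral => a _; rewrite /g /=.
  rewrite ge0_integralZl //.
  - by apply/measurable_EFinP; exact: measurable_rV_weight.
  - by move=> v _; rewrite lee_fin ltW // rV_weight_gt0.
rewrite integral_rV_weight ge0_integralZr //; last by rewrite lee_fin Rintegral_rV_weight_ge0.
rewrite EFinM; apply: lee_wpmul2r; first by rewrite lee_fin Rintegral_rV_weight_ge0.
have := hK 0; rewrite (_ : (fun a => _) = (fun a : R' => ((1 + a ^+ 2)^-1)%:E * pole a)%E) //.
by apply/funext => a; rewrite addr0.
Qed.

(* By [osc_bound] a multiple of this dominates the regularized q times a
   transformed test function. *)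
Definition sing_weight n s (xi : 'rV[R]_(n + n)) (th : 'rV[R]_s) : R :=
  (eucl_norm th)^-1 * ((rV_weight xi / s4 (1 + `|P xi| / eucl_norm th)) * rV_weight th).

Lemma sing_weight_ge0 n s (xi : 'rV[R]_(n + n)) (th : 'rV[R]_s) : 0 <= sing_weight xi th.
Proof.
by rewrite !mulr_ge0 ?invr_ge0 ?eucl_norm_ge0 ?s4_ge0 // ltW // rV_weight_gt0.
Qed.

(** Integrating in xi first, with eta = |th|, produces the factor s4 |th| that weakens 1/|th| to
    |th|^(-3/4). *)
Lemma integrable_sing_weight n s : (1 <= n)%N -> (1 <= s)%N ->
  (L (n + n + s)).-integrable setT (EFin \o (fun w => sing_weight (lsubmx w) (rsubmx w))).
Proof.
move=> n1 s1.
have [K1 K10 hK1] := quadratic_form_bound n1.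
have [K2 hK2] := radial_pole_bound s1.
have ml : measurable_fun setT (fun w : 'rV[R]_(n + n + s) => lsubmx w).
  apply: measurable_fun_rV => i; under eq_fun do rewrite mxE; exact: measurable_coord.
have mr : measurable_fun setT (fun w : 'rV[R]_(n + n + s) => rsubmx w).
  apply: measurable_fun_rV => i; under eq_fun do rewrite mxE; exact: measurable_coord.
have mS d (T : measurableType d) (f : T -> 'rV[R]_(n + n)) (g : T -> 'rV[R]_s) :
    measurable_fun setT f -> measurable_fun setT g ->
    measurable_fun setT (fun t => sing_weight (f t) (g t)).
  move=> mf mg; have me : measurable_fun setT (fun t => (eucl_norm (g t))^-1).
    apply: (measurableT_comp measurable_invr).
    by apply: (measurableT_comp (@measurable_eucl_norm R s)).
  apply: measurable_funM => //; apply: measurable_funM.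
    apply: measurable_funM; first exact: (measurableT_comp (@measurable_rV_weight _)).
    apply: (measurableT_comp measurable_invr); apply: (measurableT_comp measurable_s4).
    apply: measurable_funD => //; apply: measurable_funM => //; apply: measurableT_comp => //.
    exact: (measurableT_comp (@measurable_P n)).
  exact: (measurableT_comp (@measurable_rV_weight _)).
apply/integrableP; split; first by apply/measurable_EFinP; exact: mS.
under eq_integral do rewrite gee0_abs ?lee_fin ?sing_weight_ge0 //.
have mE : measurable_fun setT (fun w : 'rV[R]_(n + n + s) => (sing_weight (lsubmx w) (rsubmx w))%:E).
  by apply/measurable_EFinP; exact: mS.
rewrite (@row_mx_transfer R (n + n) s) // ?mul1e; last by move=> w; rewrite lee_fin sing_weight_ge0.
under eq_integral do rewrite /comp row_mxKl row_mxKr.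
pose F (p : 'rV[R]_(n + n) * 'rV[R]_s) := (sing_weight p.1 p.2)%:E.
have mF : measurable_fun setT F.
  by apply/measurable_EFinP; apply: mS; [exact: measurable_fst|exact: measurable_snd].
have F0 p : (0 <= F p)%E by rewrite lee_fin sing_weight_ge0.
rewrite (fubini_tonelli2 F mF F0).
have K2fin : (K1%:E * K2%:E < +oo)%E by rewrite -EFinM ltry.
apply: le_lt_trans K2fin.
have mth : measurable_fun setT (fun th : 'rV[R]_s => ((eucl_norm th)^-1 * s4 (eucl_norm th) * rV_weight th)%:E).
  apply/measurable_EFinP; apply: measurable_funM; last exact: measurable_rV_weight.
  apply: measurable_funM; first by apply: (measurableT_comp measurable_invr); exact: measurable_eucl_norm.
  by apply: (measurableT_comp measurable_s4); exact: measurable_eucl_norm.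
have th0 (th : 'rV[R]_s) : (0 <= ((eucl_norm th)^-1 * s4 (eucl_norm th) * rV_weight th)%:E)%E.
  by rewrite lee_fin !mulr_ge0 ?invr_ge0 ?s4_ge0 ?eucl_norm_ge0 // ltW // rV_weight_gt0.
apply: le_trans (lee_wpmul2l _ hK2); last by rewrite lee_fin.
rewrite -ge0_integralZl //.
apply: ge0_le_integral => //.
- by move=> th _; exact: integral_ge0.
- exact: (measurable_fun_fubini_tonelli_G _ mF F0).
- exact: emeasurable_funM.
move=> th _; rewrite /fubini_G /F /sing_weight /=.
have wt := rV_weight_gt0 th.
(* At th = 0 both sides vanish, the inverse of 0 being 0. *)
have [e0|e0] := eqVneq (eucl_norm th) 0.
  rewrite e0 invr0 !mul0r mule0 integral0_eq // => x _; by rewrite mul0r.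
have et : 0 < eucl_norm th by rewrite lt_neqAle eq_sym e0 eucl_norm_ge0.
have mX : measurable_fun setT (fun x : 'rV[R]_(n + n) => (rV_weight x / s4 (1 + `|P x| / eucl_norm th))%:E).
  apply/measurable_EFinP; apply: measurable_funM; first exact: measurable_rV_weight.
  apply: (measurableT_comp measurable_invr); apply: (measurableT_comp measurable_s4).
  apply: measurable_funD => //; apply: measurable_funM => //; apply: measurableT_comp => //.
  exact: measurable_P.
have X0 (x : 'rV[R]_(n + n)) : (0 <= (rV_weight x / s4 (1 + `|P x| / eucl_norm th))%:E)%E.
  by rewrite lee_fin mulr_ge0 ?invr_ge0 ?s4_ge0 // ltW // rV_weight_gt0.
rewrite (_ : (\int[_]_x _)%E = (\int[L (n + n)]_x (((eucl_norm th)^-1 * rV_weight th)%:E *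
   (rV_weight x / s4 (1 + `|P x| / eucl_norm th))%:E))%E); last first.
  by apply: eq_integral => x _; rewrite -EFinM; congr EFin; ring.
have c0 : (0 <= ((eucl_norm th)^-1 * rV_weight th)%:E)%E.
  by rewrite lee_fin mulr_ge0 ?invr_ge0 ?ltW.
rewrite ge0_integralZl //.
apply: le_trans (lee_wpmul2l c0 (hK1 _ et)) _.
rewrite -!EFinM lee_fin le_eqVlt; apply/orP; left; apply/eqP; ring.
Qed.

End pole_weights.

(** * The weight and the size of the phase on the space of (th, t) *)

Section hyperbolic_weight.
Context {R : realType}.
Local Notation L := (@lebesgue_rV R).
Local Notation R' := (measurableTypeR R).
Local Notation mu := (@lebesgue_measure R).
Variables n s : nat.
Hypotheses (n1 : (1 <= n)%N) (s1 : (1 <= s)%N).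
Local Notation Y := ('rV[R]_s * R')%type.
Local Notation nu := (L s \x mu)%E.

(* coth t for 0 < t; the maximum only serves to have [1 <= cth t] everywhere. *)
Definition cth (t : R) : R := Num.max 1 (cosh t / sinh t).

Lemma cth_ge1 t : 1 <= cth t.
Proof. by rewrite /cth le_max lexx. Qed.

Lemma cthE t : 0 < t -> cth t = cosh t / sinh t.
Proof.
move=> t0; apply/max_idPr; rewrite ler_pdivlMr ?sinh_gt0 // mul1r.
by rewrite (le_trans (ler_norm _)) // norm_sinh_le.
Qed.

Lemma measurable_cth : measurable_fun setT (cth : R' -> R').
Proof.
apply: measurable_maxr => //; apply: measurable_funM; first exact: measurable_cosh.
by apply: (measurableT_comp measurable_invr); exact: measurable_sinh.
Qed.

(** The factor |th|^(n-1) is written |th|^(-1) |th|^n, so that it vanishes at th = 0 for n = 1 too,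
    in agreement with the value of q there. *)
Definition hw (y : Y) : R :=
  \1_`]0%R, +oo[ y.2 * ((eucl_norm y.1)^-1 * eucl_norm y.1 ^+ n * (sinh y.2 ^+ n)^-1).

Definition hM (y : Y) : R := eucl_norm y.1 * cth y.2.

Lemma hw_pos (th : 'rV[R]_s) (t : R) : 0 < t ->
  hw (th, t) = (eucl_norm th)^-1 * eucl_norm th ^+ n * (sinh t ^+ n)^-1.
Proof. by move=> t0; rewrite /hw /= indicE mem_set ?mul1r //= in_itv /= t0. Qed.

Lemma hw_npos (th : 'rV[R]_s) (t : R) : t <= 0 -> hw (th, t) = 0.
Proof. by move=> t0; rewrite /hw /= indicE memNset ?mul0r //= in_itv /= ltNge t0. Qed.

Lemma hw_ge0 y : 0 <= hw y.
Proof.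
case: y => th t; have [t0|t0] := leP t 0; first by rewrite hw_npos.
by rewrite hw_pos // !mulr_ge0 ?invr_ge0 ?exprn_ge0 ?eucl_norm_ge0 // ltW // sinh_gt0.
Qed.

Lemma hM_ge0 y : 0 <= hM y.
Proof. by rewrite mulr_ge0 ?eucl_norm_ge0 // (le_trans ler01 (cth_ge1 _)). Qed.

Lemma eucl_norm_le_hM y : eucl_norm y.1 <= hM y.
Proof. by rewrite ler_peMr ?eucl_norm_ge0 // cth_ge1. Qed.

Lemma measurable_hw : measurable_fun setT hw.
Proof.
apply: measurable_funM.
  have mi : measurable_fun setT (\1_`]0%R, +oo[ : R' -> R) by exact: measurable_indic.
  exact: (measurableT_comp mi measurable_snd).
apply: measurable_funM.
  have me : measurable_fun setT (fun y : Y => eucl_norm y.1).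
    by apply: (measurableT_comp (@measurable_eucl_norm R s)); exact: measurable_fst.
  by apply: measurable_funM; [exact: (measurableT_comp measurable_invr)|exact: measurable_funX].
apply: (measurableT_comp measurable_invr); apply: measurable_funX.
by apply: (measurableT_comp measurable_sinh); exact: measurable_snd.
Qed.

Lemma measurable_hM : measurable_fun setT hM.
Proof.
apply: measurable_funM.
  by apply: (measurableT_comp (@measurable_eucl_norm R s)); exact: measurable_fst.
by apply: (measurableT_comp measurable_cth); exact: measurable_snd.
Qed.

Lemma integrable_radial (c : R) : 0 < c -> (L s).-integrable setT
  (EFin \o (fun th : 'rV[R]_s => (eucl_norm th)^-1 * eucl_norm th ^+ n * expR (- (c * eucl_norm th)))).
Proof.
move=> c0; have [C [C0 hC]] := @expR_eucl_norm_le R s n.-1 c c0.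
apply: (le_integrable measurableT _ _ (integrable_RZ C (@integrable_rV_weight R s))).
  apply/measurable_EFinP; have me := @measurable_eucl_norm R s.
  apply: measurable_funM; first by apply: measurable_funM; [exact: (measurableT_comp measurable_invr)|exact: measurable_funX].
  by apply: measurableT_comp => //; apply: measurableT_comp => //; exact: measurable_funM.
move=> th _ /=; have e0 := eucl_norm_ge0 th.
rewrite lee_fin ger0_norm ?mulr_ge0 ?invr_ge0 ?exprn_ge0 ?expR_ge0 //.
apply: le_trans (ler_norm _); apply: le_trans (hC th); rewrite ler_wpM2r ?expR_ge0 //.
have [->|t0] := eqVneq (eucl_norm th) 0; first by rewrite invr0 mul0r exprn_ge0 // addr0.
rewrite -(prednK n1) exprS mulrA mulVf // mul1r lerXn2r ?nnegrE ?addr_ge0 //.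
by rewrite lerDr.
Qed.

(** For fixed t the dilation of th by r = coth t turns the th-integral into a constant times (sinh
    t)^(-n) r^(1-n-s) = (cosh t)^(-n) r^(1-s), at most (cosh t)^(-n): the decay in th compensates
    the pole of (sinh t)^(-n) at t = 0. *)
Lemma integrable_hw (c : R) : 0 < c ->
  nu.-integrable setT (EFin \o (fun y => hw y * expR (- (c * hM y)))).
Proof.
move=> c0.
have mf : measurable_fun setT (fun y => hw y * expR (- (c * hM y))).
  apply: measurable_funM; first exact: measurable_hw.
  apply: measurableT_comp => //; apply: measurableT_comp => //; apply: measurable_funM => //.
  exact: measurable_hM.
apply/integrableP; split; first exact/measurable_EFinP.
pose F y := (hw y * expR (- (c * hM y)))%:E.
have F0 y : (0 <= F y)%E by rewrite lee_fin mulr_ge0 ?expR_ge0 ?hw_ge0.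
have mF : measurable_fun setT F by exact/measurable_EFinP.
under eq_integral do rewrite gee0_abs ?F0 //.
change (\int[nu]_y F y < +oo)%E; rewrite (fubini_tonelli2 F mF F0).
pose h (th : 'rV[R]_s) : R := (eucl_norm th)^-1 * eucl_norm th ^+ n * expR (- (c * eucl_norm th)).
have h0 th : 0 <= h th by rewrite !mulr_ge0 ?invr_ge0 ?exprn_ge0 ?eucl_norm_ge0 ?expR_ge0.
have ih : (L s).-integrable setT (EFin \o h) := integrable_radial c0.
have mh : measurable_fun setT h by apply/measurable_EFinP; exact: measurable_int ih.
pose H := \int[L s]_th h th.
have HE : (\int[L s]_th (h th)%:E)%E = H%:E by rewrite /H /Rintegral fineK // integrable_fin_num.
have H0 : 0 <= H by apply: Rintegral_ge0.
have ie := integrable_RZ H (integrable_RZ 2 (@integrable_expRN_norm R 1 ltr01)).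
apply: (@le_lt_trans _ _ (\int[mu]_t (H * (2 * expR (- (1 * `|t|))))%:E)%E); last first.
  rewrite (_ : (\int[mu]_t _)%E = (\int[mu]_t (H * (2 * expR (- (1 * `|t|)))))%:E)%E ?ltry //.
  by rewrite /Rintegral fineK // integrable_fin_num.
apply: ge0_le_integral => //.
- by move=> t _; exact: integral_ge0.
- exact: (measurable_fun_fubini_tonelli_G F mF F0).
- by have /integrableP[] := ie.
move=> t _; rewrite /fubini_G /F.
have [t0|t0] := leP t 0.
  rewrite integral0_eq; first by rewrite lee_fin mulr_ge0 // mulr_ge0 // expR_ge0.
  by move=> th _; rewrite hw_npos // mul0r.
have r1 := cth_ge1 t; set r := cth t in r1.
have r0 : 0 < r := lt_le_trans ltr01 r1.
have sh := sinh_gt0 t0.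
rewrite (_ : (\int[_]_x _)%E = (\int[L s]_th (((sinh t ^+ n)^-1 * r * r^-1 ^+ n)%:E * (h (r *: th + 0)%R)%:E))%E); last first.
  apply: eq_integral => th _; rewrite -EFinM; congr EFin; rewrite hw_pos // addr0 /h /hM eucl_normZ /= -/r (gtr0_norm r0).
  move: (sinh t ^+ n) (eucl_norm th) => S E.
  rewrite exprVn (exprMn n r E) (invfM r E) [E * r]mulrC; set X := expR _.
  move: (E^-1) (E ^+ n) S^-1 => a b d.
  by field; rewrite ?expf_neq0 ?gt_eqF.
have k0 : (0 <= ((sinh t ^+ n)^-1 * r * r^-1 ^+ n)%:E)%E.
  by rewrite lee_fin !mulr_ge0 ?invr_ge0 ?exprn_ge0 ?invr_ge0 // ltW.
have hE0 th : (0 <= (h th)%:E)%E by rewrite lee_fin.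
have mhE : measurable_fun setT (fun th => (h th)%:E) by exact/measurable_EFinP.
rewrite ge0_integralZl //; last first.
  by apply: (measurableT_comp mhE); exact: measurable_affine_rV.
rewrite (@ge0_integral_rV_affine R s r 0 r0 (fun th => (h th)%:E) mhE hE0) HE.
rewrite -!EFinM lee_fin mulrA mulrC ler_wpM2l //.
apply: le_trans (coshXN_le n1 t).
have e : r^-1 ^+ n = sinh t ^+ n / cosh t ^+ n by rewrite /r cthE // invf_div expr_div_n.
have ch := cosh_gt0 t.
have -> : (sinh t ^+ n)^-1 * r * r^-1 ^+ n * r^-1 ^+ s = (cosh t ^+ n)^-1 * (r * r^-1 ^+ s).
  by rewrite e; field; rewrite ?expf_neq0 ?gt_eqF.
rewrite -[leRHS]mulr1 ler_wpM2l ?invr_ge0 ?exprn_ge0 ?(ltW ch) //.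
rewrite -(prednK s1) exprS mulrA divff ?gt_eqF // mul1r exprn_ile1 ?invr_ge0 ?(ltW r0) //.
by rewrite invf_le1.
Qed.

Lemma integrable_hw_poly k (c : R) : 0 < c ->
  nu.-integrable setT (EFin \o (fun y => (1 + hM y) ^+ k * hw y * expR (- (c * hM y)))).
Proof.
move=> c0; have c2 : 0 < c / 2 by rewrite divr_gt0.
have [C [C0 hC]] := @poly_expRN_le R k (c / 2) c2.
apply: (le_integrable measurableT _ _ (integrable_RZ C (integrable_hw c2))).
  apply/measurable_EFinP; apply: measurable_funM.
    apply: measurable_funM; last exact: measurable_hw.
    by apply: measurable_funX; apply: measurable_funD => //; exact: measurable_hM.
  apply: measurableT_comp => //; apply: measurableT_comp => //; apply: measurable_funM => //.
  exact: measurable_hM.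
move=> y _ /=; have M0 := hM_ge0 y; have w0 := hw_ge0 y.
rewrite lee_fin ger0_norm; last first.
  by apply: mulr_ge0; [apply: mulr_ge0 => //; apply: exprn_ge0; exact: addr_ge0|exact: expR_ge0].
apply: le_trans (ler_norm _).
have -> : expR (- (c * hM y)) = expR (- (c / 2 * hM y)) * expR (- (c / 2 * hM y)).
  by rewrite -expRD; congr expR; lra.
rewrite (_ : _ * _ = (1 + hM y) ^+ k * expR (- (c / 2 * hM y)) * (hw y * expR (- (c / 2 * hM y)))); last by ring.
by rewrite ler_wpM2r ?hC // mulr_ge0 ?expR_ge0.
Qed.

Lemma hw_scale (r : R) (th : 'rV[R]_s) (t : R') : 0 < r ->
  hw (r *: th, t) = r^-1 * r ^+ n * hw (th, t).
Proof.
move=> r0; have [t0|t0] := leP t 0; first by rewrite !hw_npos // mulr0.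
by rewrite !hw_pos // eucl_normZ (gtr0_norm r0) exprMn invfM; ring.
Qed.

Lemma ge0_transfer_scale (r : R) : 0 < r ->
  ge0_transfer nu nu (fun y : Y => (r *: y.1, y.2)) (r ^+ s).
Proof.
move=> r0 f mf f0.
have mp : measurable_fun setT (fun y : Y => (r *: y.1, y.2)).
  apply/measurable_fun_pair => /=; last exact: measurable_snd.
  have := @measurable_affine_rV R s r 0; under eq_fun do rewrite addr0.
  by move=> h; apply: (measurableT_comp h); exact: measurable_fst.
have mfp : measurable_fun setT (fun y : Y => f (r *: y.1, y.2)) by exact: measurableT_comp.
rewrite (fubini_tonelli2 _ mf f0) (fubini_tonelli2 _ mfp) //.
have rs : (0 <= (r ^+ s)%:E)%E by rewrite lee_fin exprn_ge0 // ltW.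
rewrite -ge0_integralZl //; last 2 first.
- by apply: (measurable_fun_fubini_tonelli_G _ mfp).
- by move=> t _; exact: integral_ge0.
apply: eq_integral => t _; rewrite /fubini_G /=.
have mft : measurable_fun setT (fun th => f (th, t)) by exact: (measurableT_comp mf (measurable_pair2 t)).
rewrite (@rV_affine_transfer R s r 0 r0 (fun th => f (th, t)) mft) //.
by under eq_integral do rewrite addr0.
Qed.

End hyperbolic_weight.

(** * The kernel off the cone *)

Section contour_rotation.
Context {R : realType}.
Local Notation L := (@lebesgue_rV R).
Local Notation R' := (measurableTypeR R).
Local Notation mu := (@lebesgue_measure R).
Variables n s : nat.
Hypotheses (n1 : (1 <= n)%N) (s1 : (1 <= s)%N).
Local Notation Y := ('rV[R]_s * R')%type.
Local Notation nu := (L s \x mu)%E.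

Definition dot (u v : 'rV[R]_s) : R := \sum_i u ord0 i * v ord0 i.

Lemma dotZr r u v : dot u (r *: v) = r * dot u v.
Proof. by rewrite /dot mulr_sumr; apply: eq_bigr => i _; rewrite mxE; ring. Qed.

Lemma norm_dot_le u v : `|dot u v| <= eucl_norm u * eucl_norm v.
Proof. exact: cauchy_schwarz_rV. Qed.

Lemma measurable_dot_y u : measurable_fun setT (fun y : Y => dot u y.1).
Proof.
apply: measurable_sum => i; apply: measurable_funM => //.
by apply: (measurableT_comp (@measurable_coord R s i)); exact: measurable_fst.
Qed.

(** The phase in J_e, with p for P(x) / 4 and b for e |x|^2 / 4. *)
Definition osc_phase (p b : R) (z : 'rV[R]_s) (y : Y) : R[i] :=
  (hM y * b) +i* (dot z y.1 + hM y * p).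

(** The quotient of [osc_phase] by sg i when sg is 1 or -1: the end of the quarter turn at which the
    distance to the cone produces decay. *)
Definition decay_phase (sg p b : R) (z : 'rV[R]_s) (y : Y) : R[i] :=
  (sg * dot z y.1 + hM y * (sg * p)) +i* (- (sg * (hM y * b))).

Lemma cmeas_decay_phase sg p b z : cmeas (decay_phase sg p b z).
Proof.
have mM := @measurable_hM R s; have md := measurable_dot_y z.
apply: cmeas_pair.
  by apply: measurable_funD; apply: measurable_funM.
by apply: measurable_funN; apply: measurable_funM => //; apply: measurable_funM.
Qed.

Variables (sg p b del : R) (z : 'rV[R]_s).
Hypotheses (sg1 : sg ^+ 2 = 1) (del0 : 0 < del).
Hypotheses (pz : eucl_norm z + del <= sg * p) (bdel : del <= b).

Let X := decay_phase sg p b z.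
Let N : R := (n + s).-1%:R.

Lemma norm_sg : `|sg| = 1.
Proof. by apply/eqP; rewrite -(@eqrXn2 _ 2) // ?expr1n real_normK ?num_real // sg1. Qed.

Lemma Re_decay_ge y : del * hM y <= Re (X y).
Proof.
rewrite /=; have M0 := hM_ge0 y; have e0 := eucl_norm_ge0 z.
have h : `|sg * dot z y.1| <= eucl_norm z * hM y.
  rewrite normrM norm_sg mul1r; apply: le_trans (norm_dot_le _ _) _.
  by rewrite ler_wpM2l // eucl_norm_le_hM.
have := ler_wpM2l M0 pz; have := ler_norm (- (sg * dot z y.1)); rewrite normrN; nra.
Qed.

(** The real part is cos t times that of X plus sg sin t times [hM y * b]. Both quantities are at
    least [del * hM y], and the nonnegative coefficients have sum at least 1 because their squares
    sum to 1. At the end cos t = 0 only b is left, which is why e must be positive. *)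
Lemma Re_rot_ge t y : 0 <= cos t -> 0 <= sg * sin t -> del * hM y <= Re (cis t * X y).
Proof.
move=> c0 s0; have M0 := hM_ge0 y; have h := Re_decay_ge y.
rewrite ReM [Re (cis t)]/= [Im (cis t)]/= [Im (X y)]/=.
have e := cos2Dsin2 t.
have cs : 1 <= cos t + sg * sin t.
  have : 1 <= (cos t + sg * sin t) ^+ 2.
    rewrite sqrrD exprMn sg1 mul1r; have : 0 <= cos t * (sg * sin t) by rewrite mulr_ge0.
    by rewrite mulr2n; lra.
  move=> h1; rewrite -[leLHS](@ger0_norm _ 1) // -[leRHS]ger0_norm ?addr_ge0 //.
  by rewrite -ler_sqr ?nnegrE ?normr_ge0 // !real_normK ?num_real // expr1n.
have h1 := ler_wpM2l c0 h.
have h2 : sg * sin t * (del * hM y) <= sg * sin t * (hM y * b).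
  by rewrite ler_wpM2l // mulrC ler_wpM2l.
have h3 : del * hM y <= (cos t + sg * sin t) * (del * hM y).
  by rewrite ler_peMl // mulr_ge0 // ltW.
rewrite mulrN opprK (mulrCA (sin t)) (mulrA sg); lra.
Qed.

Lemma normc_decay_le y : normc (X y) <= (eucl_norm z + `|p| + `|b|) / del * (del * hM y).
Proof.
have M0 := hM_ge0 y.
rewrite mulrA divfK ?gt_eqF //.
apply: le_trans (normc_leD _) _; rewrite [Re _]/= [Im _]/= normrN.
apply: (@le_trans _ _ (`|sg * dot z y.1| + `|hM y * (sg * p)| + `|sg * (hM y * b)|)).
  by rewrite lerD2r ler_normD.
rewrite (normrM sg) (normrM (hM y)) (normrM sg p) (normrM sg) (normrM (hM y)) norm_sg !mul1r (ger0_norm M0).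
rewrite !mulrDl [_ * `|p|]mulrC [_ * `|b|]mulrC !lerD2r; apply: le_trans (norm_dot_le _ _) _.
by rewrite ler_wpM2l ?eucl_norm_ge0 // eucl_norm_le_hM.
Qed.

Lemma decay_phase_scale (r : R) (y : Y) : 0 < r -> X (r *: y.1, y.2) = r%:C * X y.
Proof.
move=> r0; have e : hM (r *: y.1, y.2) = r * hM y.
  by rewrite /hM eucl_normZ (gtr0_norm r0) mulrA.
rewrite /X /decay_phase e dotZr; apply: complexP; rewrite ?ReM ?ImM /=; ring.
Qed.

Lemma cintegrable_hw_rot (w : R[i]) (c : R) : 0 < c -> (forall y, c * hM y <= Re (w * X y)) ->
  cintegrable nu (fun y => (hw n y)%:C * cexp (- (w * X y))).
Proof.
move=> c0 h; apply: (cintegrable_le _ (integrable_hw n1 s1 c0)) => [|y].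
  apply: cmeasM; first by apply: cmeas_real; exact: measurable_hw.
  apply: cmeas_cexp.
  have := cmeasM (cmeas_cst (- w)) (cmeas_decay_phase sg p b z).
  by under eq_fun do rewrite mulNr.
rewrite Normc.normcM normc_real ger0_norm ?hw_ge0 // normc_cexp ler_wpM2l ?hw_ge0 //.
by rewrite ler_expR ReN lerN2.
Qed.

(** Substitute r th for th: the phase has degree 1 in th, the weight degree n - 1 and Lebesgue
    measure degree s, whence the exponent N = n + s - 1. *)
Lemma rotation_scale t r : 0 <= cos t -> 0 <= sg * sin t -> 0 < r ->
  cint nu (fun y => (hw n y)%:C * cexp (- (r%:C * cis t * X y))) =
  (r `^ (- N))%:C * cint nu (fun y => (hw n y)%:C * cexp (- (cis t * X y))).
Proof.
move=> c0 s0 r0.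
pose f y := (hw n y)%:C * cexp (- (cis t * X y)).
have If := cintegrable_hw_rot del0 (fun y => Re_rot_ge y c0 s0).
have mf : cmeas f := cintegrable_meas If.
pose pr (y : Y) : Y := (r *: y.1, y.2).
have mpr : measurable_fun setT pr.
  apply/measurable_fun_pair => /=; last exact: measurable_snd.
  have := @measurable_affine_rV R s r 0; under eq_fun do rewrite addr0.
  by move=> h; apply: (measurableT_comp h); exact: measurable_fst.
have rh y : r * del * hM y <= Re (r%:C * cis t * X y).
  have h := Re_rot_ge y c0 s0.
  have -> : Re (r%:C * cis t * X y) = r * Re (cis t * X y).
    rewrite -mulrA [LHS]ReM (_ : Re r%:C = r) // (_ : Im r%:C = 0) // mul0r.
    exact: subr0.
  by rewrite -mulrA ler_wpM2l // ltW.
have Ig := cintegrable_hw_rot (mulr_gt0 r0 del0) rh.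
have fE y : f (pr y) = (r^-1 * r ^+ n)%:C * ((hw n y)%:C * cexp (- (r%:C * cis t * X y))).
  case: y => th u; rewrite /f /pr /= hw_scale // (decay_phase_scale (th, u) r0) (mulrCA (cis t)) -(mulrA r%:C).
  by rewrite [RHS]mulrA -rmorphM.
have If' : cintegrable nu (f \o pr).
  by rewrite (_ : f \o pr = (fun y => (r^-1 * r ^+ n)%:C * ((hw n y)%:C * cexp (- (r%:C * cis t * X y))))); [exact: cintegrableZ|exact/funext].
have [_] := cint_transfer (exprn_gt0 s r0) mpr (ge0_transfer_scale r0) mf If'.
rewrite (eq_cint _ fE) cintZ // mulrA -rmorphM /= => ->.
rewrite mulrA -rmorphM /= powRN powR_mulrn ?(ltW r0) //.
rewrite (_ : _ * (r ^+ s * _) = 1) ?mul1r //.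
rewrite (_ : (n + s).-1 = (n.-1 + s)%N); last by rewrite -{1}(prednK n1).
by rewrite -{2}(prednK n1) exprS exprD; field; rewrite !expf_neq0 ?gt_eqF.
Qed.

(** The angle runs from 0 to pi / 2 if sg = 1 and from - pi / 2 to 0 if sg = -1, so that sg sin t
    stays nonnegative in both cases. *)
Lemma rotation :
  cint nu (fun y => (hw n y)%:C * cexp (- osc_phase p b z y)) =
  cis (- (sg * (N * (pi / 2)))) * cint nu (fun y => (hw n y)%:C * cexp (- X y)).
Proof.
have Xm := cmeas_decay_phase sg p b z.
have M0 (y : Y) : 0 <= del * hM y by rewrite mulr_ge0 ?hM_ge0 // ltW.
have iW c : 0 < c -> nu.-integrable setT (EFin \o (fun y => hw n y * expR (- (c * (del * hM y))))).
  by move=> c0; under eq_fun do rewrite mulrA; apply: integrable_hw => //; exact: mulr_gt0.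
have pi0 := @pi_ge0 R.
have key (t0 t1 : R) : t0 <= t1 -> (forall t, t0 <= t <= t1 -> 0 <= cos t /\ 0 <= sg * sin t) ->
    cint nu (fun y => (hw n y)%:C * cexp (- (cis t1 * X y))) =
    cis (- (N * (t1 - t0))) * cint nu (fun y => (hw n y)%:C * cexp (- (cis t0 * X y))).
  move=> t01 ht; apply: (@rotation_eq _ _ _ nu (fun y : Y => hw n y) (fun y => del * hM y) X ((eucl_norm z + `|p| + `|b|) / del) N t0 t1) => //.
  - exact: measurable_hw.
  - by move=> y; exact: hw_ge0.
  - exact: normc_decay_le.
  - by move=> t y /ht[]; exact: Re_rot_ge.
  - by move=> t r /ht[]; exact: rotation_scale.
have c0E : cint nu (fun y => (hw n y)%:C * cexp (- (cis 0 * X y))) =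
    cint nu (fun y => (hw n y)%:C * cexp (- X y)).
  by apply: eq_cint => y; rewrite cis0 mul1r.
have sgE : sg = 1 \/ sg = -1.
  move/eqP : sg1; rewrite -subr_eq0 (_ : sg ^+ 2 - 1 = (sg - 1) * (sg + 1)); last by ring.
  by rewrite mulf_eq0 => /orP[]/eqP h; [left|right]; lra.
have [sgE1|sgE1] := sgE.
  have := key 0 (pi / 2) _ _; rewrite c0E subr0 sgE1 mul1r => <-.
  - apply: eq_cint => y; congr (_ * cexp (- _)).
    apply: complexP; rewrite ?ReM ?ImM /X /= sgE1 cos_pihalf sin_pihalf; ring.
  - by rewrite divr_ge0.
  - move=> t /andP[t0 t1]; rewrite mul1r; split.
      by apply: cos_ge0_pihalf; apply/andP; split => //; lra.
    by apply: sin_ge0_pi; apply/andP; split => //; lra.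
have := key (- (pi / 2)) 0 _ _; rewrite c0E sub0r opprK sgE1 => ->.
- rewrite mulrA -cisD mulN1r opprK subrr cis0 mul1r.
  apply: eq_cint => y; congr (_ * cexp (- _)).
  apply: complexP; rewrite ?ReM ?ImM /X /= sgE1 cosN sinN cos_pihalf sin_pihalf; ring.
- by rewrite oppr_le0 divr_ge0.
- move=> t /andP[t0 t1]; rewrite mulN1r; split.
    by apply: cos_ge0_pihalf; apply/andP; split => //; lra.
  by rewrite -sinN; apply: sin_ge0_pi; apply/andP; split => //; lra.
Qed.

End contour_rotation.

(** * The regularization of q and the Gaussian integral in xi *)

Section regularized_kernel.
Context {R : realType}.
Local Notation L := (@lebesgue_rV R).
Local Notation R' := (measurableTypeR R).
Local Notation mu := (@lebesgue_measure R).
Variables n s : nat.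
Hypotheses (n1 : (1 <= n)%N) (s1 : (1 <= s)%N).
Local Notation V := ('rV[R]_(n + n + s)).

Definition qe (e : R) (xi : 'rV[R]_(n + n)) (th : 'rV[R]_s) : R[i] :=
  ((eucl_norm th)^-1)%:C * osc n (lam e xi * ((eucl_norm th)^-1)%:C).

Definition qcst : R[i] := 'i%C / ((2 * pi) `^ (n%:R + s%:R / 2))%:C.

Lemma Re_lam_scale (e : R) xi (r : R) : 0 <= e -> 0 <= r -> Re (@lam R n e xi * r%:C) <= 0.
Proof.
move=> e0 r0; rewrite ReM (_ : Re r%:C = r) // (_ : Im r%:C = 0) // mulr0.
rewrite -[X in _ - X]/(0 : R); have := Re_lam_le0 xi e0; nra.
Qed.

Lemma q_qe xi th : q xi th = qcst * qe 0 xi th.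
Proof.
rewrite /q /qe; congr (_ * _).
have l0 : Re (@lam R n 0 xi * ((eucl_norm th)^-1)%:C) <= 0.
  by apply: Re_lam_scale; rewrite // invr_ge0 eucl_norm_ge0.
rewrite /osc cint_obnd_cbnd; last exact: cintegrable_osc.
rewrite cintegral_indic -cintZ; last first.
  apply: (cintegrable_le (cmeas_indicM _ (cmeas_oscE n _)) (integrable_RZ 2 (integrable_expRN_norm ltr01))) => //.
  move=> t; rewrite Normc.normcM normc_real indicE; have [|_] := boolP (t \in _); last first.
    by rewrite normr0 mul0r mulr_ge0 ?expR_ge0.
  move=> /set_mem h; have t0 : 0 <= t by move: h; rewrite /= in_itv /= andbT.
  by rewrite normr1 [leLHS]mul1r; apply: le_trans (normc_oscE_le n l0 t0) (coshXN_le n1 t).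
apply: eq_cint => t; rewrite [RHS]mulrCA; congr (_ * _).
rewrite invfM rmorphM /= /oscE [RHS]mulrA; congr (_ * _).
rewrite -cexp_imag; congr cexp; apply: complexP => /=;
 rewrite !(mul0r, mulr0, oppr0, expr0n, addr0, add0r, subr0) /=.
  by rewrite ?invr1 ?mul0r ?mulr0 ?subr0 ?addr0 ?mul0r ?mulr0.
by rewrite divr1 -mulrA [_^-1 * _]mulrC.
Qed.

(** Uniform in e, since |lam e xi| >= |P xi| / (1 + e^2) >= |P xi| / 2; the constant s4 (1 / 2) pays
    for the last factor. *)
Lemma qe_bound : exists C : R, 0 < C /\ forall e xi th, 0 <= e <= 1 ->
  normc (qe e xi th) <= C * ((eucl_norm th)^-1 / s4 (1 + `|P xi| / eucl_norm th)).
Proof.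
have [C [C0 hC]] := @osc_bound R n n1.
have s2 : 0 < s4 (2^-1 : R) by rewrite s4_gt0 // invr_gt0.
exists (C / s4 2^-1); split; first by rewrite divr_gt0.
move=> e xi th /andP[e0 e1]; set r := (eucl_norm th)^-1.
have r0 : 0 <= r by rewrite invr_ge0 eucl_norm_ge0.
rewrite Normc.normcM normc_real ger0_norm // [leRHS]mulrCA ler_wpM2l //.
apply: le_trans (hC _ (Re_lam_scale xi e0 r0)) _; rewrite -[leRHS]mulrA ler_pM2l //.
have P0 : 0 <= `|P xi| * r by rewrite mulr_ge0.
have a0 : 0 < 1 + `|P xi| * r by lra.
rewrite -invfM lef_pV2 ?posrE ?mulr_gt0 ?s4_gt0 //; last first.
  by rewrite ltr_wpDr // normc_ge0.
rewrite -s4M ?invr_ge0 //; apply: ler_s4.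
rewrite Normc.normcM normc_real (ger0_norm r0).
have h := normc_lam_ge e xi.
have h2 : `|P xi| / 2 <= normc (lam e xi).
  apply: le_trans h; rewrite ler_wpM2l // lef_pV2 ?posrE ?oneDsqr_gt0' //.
  have : e ^+ 2 <= 1 by rewrite expr_le1.
  lra.
have := ler_wpM2r r0 h2; lra.
Qed.

Lemma measurable_lsub : measurable_fun setT (fun w : V => lsubmx w).
Proof. by apply: measurable_fun_rV => i; under eq_fun do rewrite mxE; exact: measurable_coord. Qed.

Lemma measurable_rsub : measurable_fun setT (fun w : V => rsubmx w).
Proof. by apply: measurable_fun_rV => i; under eq_fun do rewrite mxE; exact: measurable_coord. Qed.

Lemma cmeas_lam d (T : measurableType d) (f : T -> 'rV[R]_(n + n)) e :
  measurable_fun setT f -> cmeas (fun t => lam e (f t)).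
Proof.
move=> mf; apply: cmeasM; last exact: cmeas_cst.
apply: cmeas_pair; last exact: (measurableT_comp (@measurable_P R n)).
apply: measurable_funN; apply: measurable_funM => //; apply: measurable_funX.
exact: (measurableT_comp (@measurable_eucl_norm R _)).
Qed.

Lemma cmeas_qeE d (T : measurableType d) (f : T -> 'rV[R]_(n + n)) (g : T -> 'rV[R]_s) (h : T -> R') e :
  measurable_fun setT f -> measurable_fun setT g -> measurable_fun setT h ->
  cmeas (fun x => (\1_`]0%R, +oo[ (h x))%:C * oscE n (lam e (f x) * ((eucl_norm (g x))^-1)%:C) (h x)).
Proof.
move=> mf mg mh; apply: cmeasM.
  apply: cmeas_real.
  have mi : measurable_fun setT (\1_`]0%R, +oo[ : R' -> R) by exact: measurable_indic.
  exact: (measurableT_comp mi mh).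
have me : measurable_fun setT (fun x => (eucl_norm (g x))^-1).
  by apply: (measurableT_comp measurable_invr); exact: (measurableT_comp (@measurable_eucl_norm R _)).
apply: cmeasM.
  apply: cmeas_real; apply: (measurableT_comp measurable_invr); apply: measurable_funX.
  exact: (measurableT_comp measurable_cosh mh).
apply: cmeas_cexp; apply: cmeasM.
  by apply: cmeas_real; exact: (measurableT_comp measurable_tanh mh).
by apply: cmeasM; [exact: cmeas_lam|exact: cmeas_real].
Qed.

Lemma cmeas_qe d (T : measurableType d) (f : T -> 'rV[R]_(n + n)) (g : T -> 'rV[R]_s) e :
  measurable_fun setT f -> measurable_fun setT g -> cmeas (fun x => qe e (f x) (g x)).
Proof.
move=> mf mg; apply: cmeasM.
  apply: cmeas_real; apply: (measurableT_comp measurable_invr).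
  exact: (measurableT_comp (@measurable_eucl_norm R _)).
have mf1 : measurable_fun setT (fun p : T * R' => f p.1) by exact: (measurableT_comp mf measurable_fst).
have mg1 : measurable_fun setT (fun p : T * R' => g p.1) by exact: (measurableT_comp mg measurable_fst).
exact: (cmeas_cint_section mu (cmeas_qeE e mf1 mg1 measurable_snd)).
Qed.

Variable phi : V -> R[i].
Hypothesis tphi : test_fun phi.

Lemma regularization_dom : exists C : R, 0 < C /\ forall e (w : V), 0 <= e <= 1 ->
  normc (qe e (lsubmx w) (rsubmx w) * ft phi w) <= C * sing_weight (lsubmx w) (rsubmx w).
Proof.
have [C [C0 hC]] := qe_bound; have [C' [C'0 hC']] := ft_decay tphi.
exists (C * C'); split; first exact: mulr_gt0.
move=> e w ee; rewrite Normc.normcM.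
apply: le_trans (ler_pM (normc_ge0 _) (normc_ge0 _) (hC _ _ _ ee) (hC' w)) _.
rewrite -[X in rV_weight X](hsubmxK w) rV_weight_row_mx /sing_weight le_eqVlt; apply/orP; left; apply/eqP; ring.
Qed.

Lemma cintegrable_reg e : 0 <= e <= 1 ->
  cintegrable (L (n + n + s)) (fun w => qe e (lsubmx w) (rsubmx w) * ft phi w).
Proof.
move=> ee; have [C [C0 hC]] := regularization_dom.
apply: (cintegrable_le _ (integrable_RZ C (integrable_sing_weight n1 s1))) => [|w]; last exact: hC.
by apply: cmeasM; [exact: cmeas_qe measurable_lsub measurable_rsub|exact: cmeas_ft].
Qed.

Lemma lam_cvg (u : nat -> R) xi : u @ \oo --> (0 : R) -> ccvg (fun k => @lam R n (u k) xi) (lam 0 xi).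
Proof.
move=> u0.
have c2 : (fun k => (1 + u k ^+ 2)^-1) @ \oo --> ((1 + 0 ^+ 2)^-1 : R).
  apply: cvgV; first by rewrite expr0n /= addr0 oner_neq0.
  apply: cvgD; first exact: cvg_cst.
  rewrite (_ : (fun k => u k ^+ 2) = (fun k => u k * u k)); last by apply/funext => k; rewrite expr2.
  by rewrite expr2; exact: cvgM.
apply: ccvgM; last exact: ccvg_real.
split; last exact: cvg_cst.
apply: cvgN; apply: cvgM => //; exact: cvg_cst.
Qed.

Lemma K0s_ft (psi : schwartz R (n + n + s)) : (psi : V -> R[i]) = phi ->
  K0s psi = qcst * ((2 * pi) `^ (- ((n + n + s)%:R / 2)))%:C *
    cint (L (n + n + s)) (fun w => qe 0 (lsubmx w) (rsubmx w) * ft phi w).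
Proof.
move=> e; rewrite -cintZ; last by apply: cintegrable_reg; rewrite lexx ler01.
by apply: eq_cint => w; rewrite q_qe e fourierE; ring.
Qed.

Lemma reg_cvg (u : nat -> R) : (forall k, 0 <= u k <= 1) -> u @ \oo --> (0 : R) ->
  ccvg (fun k => cint (L (n + n + s)) (fun w => qe (u k) (lsubmx w) (rsubmx w) * ft phi w))
   (cint (L (n + n + s)) (fun w => qe 0 (lsubmx w) (rsubmx w) * ft phi w)).
Proof.
move=> u01 u0; have [C [C0 hC]] := regularization_dom.
apply: (cint_dct (g := fun w => C * sing_weight (lsubmx w) (rsubmx w))).
- by move=> k; exact: cintegrable_meas (cintegrable_reg (u01 k)).
- move=> w; apply: ccvgM; last exact: ccvg_cst.
  apply: ccvgM; first exact: ccvg_cst.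
  apply: cvg_osc => //.
    by move=> k; have /andP[? _] := u01 k; apply: Re_lam_scale; rewrite // invr_ge0 eucl_norm_ge0.
  by apply: ccvgM; [exact: lam_cvg|exact: ccvg_cst].
- by apply: integrable_RZ; exact: integrable_sing_weight.
- by move=> k w; exact: hC.
Qed.

Definition bphase (e : R) (y : 'rV[R]_s * R') (v : V) : R[i] :=
  osc_phase (P (lsubmx v) / 4) (e * eucl_norm (lsubmx v) ^+ 2 / 4) (rsubmx v) y.

Definition gphi (e : R) (y : 'rV[R]_s * R') : R[i] :=
  cint (L (n + n + s)) (fun v => phi v * cexp (- bphase e y v)).

(** The part of the constant in [gauss_tensor] that depends neither on th nor on t. *)
Definition gcst (e : R) : R := (pi * Num.sqrt (1 + e ^+ 2)) ^+ n.

Lemma ft_row (xi : 'rV[R]_(n + n)) (th : 'rV[R]_s) (f : V -> R[i]) : ft f (row_mx xi th) =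
  cint (L (n + n + s)) (fun v => f v * cis (- dot (rsubmx v) th) *
     cis (- \sum_i lsubmx v ord0 i * xi ord0 i)).
Proof.
apply: eq_cint => v; rewrite -mulrA -cisD; congr (_ * cis _).
rewrite big_split_ord /= opprD addrC; congr (- _ - _); apply: eq_bigr => i _.
  by rewrite row_mxEr mxE.
by rewrite row_mxEl mxE.
Qed.

(** Write the transform of phi as an integral over v. As e > 0 the Gaussian decays in xi, the two
    integrals can be exchanged, and [gauss_tensor] applies with tau = tanh t / |th|. The powers
    combine to (cosh t)^(-n) tau^(-n) = |th|^n (sinh t)^(-n). *)
Lemma inner_gauss (e t : R) (th : 'rV[R]_s) : 0 < e -> 0 < t -> th != 0 ->
  cint (L (n + n)) (fun xi => oscE n (lam e xi * ((eucl_norm th)^-1)%:C) t * ft phi (row_mx xi th)) =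
  (gcst e * (eucl_norm th ^+ n * (sinh t ^+ n)^-1))%:C * gphi e (th, t).
Proof.
move=> e0 t0 th0.
have r0 : 0 < eucl_norm th by rewrite lt_neqAle eucl_norm_ge0 eq_sym eucl_norm_eq0 th0.
set tau := tanh t / eucl_norm th.
have tau0 : 0 < tau by rewrite divr_gt0 // tanh_gt0.
have ch := cosh_gt0 t; have sh := sinh_gt0 t0.
pose A (v : V) := phi v * cis (- dot (rsubmx v) th).
pose B (v : V) (xi : 'rV[R]_(n + n)) := cexp (tau%:C * lam e xi) * cis (- \sum_i lsubmx v ord0 i * xi ord0 i).
pose F (p : 'rV[R]_(n + n) * V) := A p.2 * B p.2 p.1.
have mrs : measurable_fun setT (fun v : V => dot (rsubmx v) th).
  apply: measurable_sum => i; apply: measurable_funM => //; under eq_fun do rewrite mxE.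
  exact: measurable_coord.
have mA : cmeas A.
  apply: cmeasM; first exact: test_fun_cmeas.
  under eq_fun do rewrite -cexp_imag.
  by apply: cmeas_cexp; apply: cmeas_pair => //; exact: measurable_funN.
have mF : cmeas F.
  apply: cmeasM; first exact: (cmeas_comp mA measurable_snd).
  apply: cmeasM.
    by apply: cmeas_cexp; apply: cmeasM; [exact: cmeas_cst|exact: cmeas_lam measurable_fst].
  under eq_fun do rewrite -cexp_imag.
  apply: cmeas_cexp; apply: cmeas_pair => //; apply: measurable_funN.
  apply: measurable_sum => i; apply: measurable_funM.
    have m1 : measurable_fun setT (fun v : V => lsubmx v ord0 i).
      by under eq_fun do rewrite mxE; exact: measurable_coord.
    exact: (measurableT_comp m1 measurable_snd).
  exact: (measurableT_comp (@measurable_coord R _ i) measurable_fst).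
have [C [C0 hC]] := test_fun_bound tphi.
pose g1 (xi : 'rV[R]_(n + n)) := expR (- (tau * e / (1 + e ^+ 2) * eucl_norm xi ^+ 2)).
have c0 : 0 < tau * e / (1 + e ^+ 2) by apply: divr_gt0; [exact: mulr_gt0|exact: oneDsqr_gt0'].
have ig1 : (L (n + n)).-integrable setT (EFin \o g1).
  have [D [D0 hD]] := @expR_eucl_norm_le R (n + n) 0 _ c0.
  apply: (le_integrable measurableT _ _ (integrable_RZ (expR (tau * e / (1 + e ^+ 2)) * D) (@integrable_rV_weight R (n + n)))).
    apply/measurable_EFinP; apply: measurableT_comp => //; apply: measurable_funN.
    by apply: measurable_funM => //; apply: measurable_funX; exact: measurable_eucl_norm.
  move=> xi _ /=; rewrite lee_fin ger0_norm ?expR_ge0 //; apply: le_trans (ler_norm _).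
  rewrite -mulrA; have h := hD xi; rewrite expr0 mul1r in h.
  apply: le_trans (ler_wpM2l (expR_ge0 _) h); rewrite /g1 -expRD ler_expR.
  set c := tau * e / _ in c0 *; set x := eucl_norm xi.
  have : c * x <= c * (1 + x ^+ 2).
    rewrite ler_pM2l //; have : 0 <= (x - 1) ^+ 2 by exact: sqr_ge0.
    have : 0 <= x ^+ 2 by exact: sqr_ge0.
    rewrite sqrrB1; lra.
  lra.
have nB v xi : normc (B v xi) = g1 xi by rewrite Normc.normcM normc_cis mulr1 normc_gauss_tensor.
have nA v : normc (A v) = normc (phi v) by rewrite Normc.normcM normc_cis mulr1.
have iw := integrable_RZ C (@integrable_rV_weight R (n + n + s)).
have bF xi v : normc (F (xi, v)) <= g1 xi * (C * rV_weight v).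
  by rewrite Normc.normcM nA nB mulrC ler_wpM2l ?expR_ge0.
have [sw _] := cfubini_dom mF ig1 iw bF.
have Aphase v : A v * cexp (- (acoef e (lsubmx v) / (4 * tau%:C))) = phi v * cexp (- bphase e (th, t) v).
  rewrite /A -mulrA -cexp_imag -cexpD; congr (_ * cexp _).
  have -> : acoef e (lsubmx v) / (4 * tau%:C) = acoef e (lsubmx v) * ((4 * tau)^-1)%:C.
    have e4 : (4 : R)%:C = (4 : R[i]) := rmorph_nat _ 4.
    by rewrite -e4 -rmorphM fmorphV.
  have tE : (4 * tau)^-1 = hM (th, t) / 4.
    by rewrite /hM /= cthE // /tau /tanh; field; rewrite !gt_eqF.
  by rewrite tE; apply: complexP; rewrite ?(ReD, ImD, ReN, ImN) ?ReM ?ImM /=; field.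
have iphase : cintegrable (L (n + n + s)) (fun v => phi v * cexp (- bphase e (th, t) v)).
  apply: (cintegrable_le _ iw) => [|v].
    under eq_fun do rewrite -Aphase.
    apply: cmeasM => //; apply: cmeas_cexp; under eq_fun do rewrite -mulNr mulrC.
    apply: cmeasM; first exact: cmeas_cst.
    have mac : cmeas (fun v : V => acoef e (lsubmx v)).
      apply: cmeas_pair; last exact: (measurableT_comp (@measurable_P R n) measurable_lsub).
      apply: measurable_funM => //; apply: measurable_funX.
      exact: (measurableT_comp (@measurable_eucl_norm R _) measurable_lsub).
    have := cmeasM (cmeas_cst (-1)) mac; by under eq_fun do rewrite mulN1r.
  rewrite Normc.normcM -[leRHS]mulr1; apply: ler_pM; rewrite ?normc_ge0 ?hC //.
  rewrite normc_cexp -expR0 ler_expR /= oppr_le0 mulr_ge0 ?hM_ge0 // divr_ge0 // mulr_ge0 ?sqr_ge0 //.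
  exact: ltW.
have iAc (xi : 'rV[R]_(n + n)) : cintegrable (L (n + n + s)) (fun v => A v * cis (- \sum_i lsubmx v ord0 i * xi ord0 i)).
  apply: (cintegrable_le _ iw) => [|v]; last by rewrite Normc.normcM normc_cis mulr1 nA.
  apply: cmeasM => //; under eq_fun do rewrite -cexp_imag.
  apply: cmeas_cexp; apply: cmeas_pair => //; apply: measurable_funN.
  apply: measurable_sum => i; apply: measurable_funM => //.
  by under eq_fun do rewrite mxE; exact: measurable_coord.
have tauE : tau%:C = (tanh t)%:C * ((eucl_norm th)^-1)%:C := rmorphM _ _ _.
have iF1 : cintegrable (L (n + n)) (fun xi => cint (L (n + n + s)) (fun v => F (xi, v))).
  apply: (cintegrable_le (g := fun xi => (2 * \int[L (n + n + s)]_v (C * rV_weight v)) * g1 xi)).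
  - exact: (cmeas_cint_section (L (n + n + s)) mF).
  - exact: integrable_RZ.
  - move=> xi; rewrite -mulrA [_ * g1 xi]mulrC -RintegralZl //.
    apply: normc_cint_le; [exact: cmeas_section|exact: integrable_RZ|exact: bF].
transitivity (((cosh t ^+ n)^-1)%:C * cint (L (n + n)) (fun xi => cint (L (n + n + s)) (fun v => F (xi, v)))).
  rewrite -(cintZ _ iF1); apply: eq_cint => xi; rewrite /oscE -[LHS]mulrA.
  apply: (f_equal (GRing.mul _)).
  rewrite ft_row -(cintZ _ (iAc xi)); apply: eq_cint => v; rewrite [LHS]mulrCA.
  have pE : (tanh t)%:C * ((eucl_norm th)^-1)%:C * lam e xi = (tanh t)%:C * (lam e xi * ((eucl_norm th)^-1)%:C).
    by rewrite -[LHS]mulrA; apply: (f_equal (GRing.mul _)); exact: mulrC.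
  by rewrite /F [snd _]/= [fst _]/= /B tauE pE.
rewrite sw /gphi -[in RHS](cintZ _ iphase).
rewrite -[LHS]cintZ; last first.
  apply: (cintegrable_le (g := fun v => (2 * \int[L (n + n)]_xi g1 xi) * (C * rV_weight v))).
  - have mF' : cmeas (fun p : V * 'rV[R]_(n + n) => F (p.2, p.1)).
      have msw : measurable_fun setT (fun p : V * 'rV[R]_(n + n) => (p.2, p.1)) by exact: measurable_swap.
      exact: (cmeas_comp mF msw).
    exact: (cmeas_cint_section (L (n + n)) mF').
  - exact: integrable_RZ.
  - move=> v; rewrite -mulrA [_ * (C * _)]mulrC -RintegralZl //.
    apply: normc_cint_le.
    + exact: (cmeas_comp mF (measurable_pair2 v)).
    + exact: integrable_RZ.
    + by move=> xi; rewrite mulrC; exact: bF.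
apply: eq_cint => v; rewrite -Aphase /F /=.
rewrite cintZ; last first.
  apply: (cintegrable_le _ ig1) => [|xi]; last by rewrite nB.
  apply: cmeasM; first by apply: cmeas_cexp; apply: cmeasM; [exact: cmeas_cst|exact: cmeas_lam].
  under eq_fun do rewrite -cexp_imag.
  apply: cmeas_cexp; apply: cmeas_pair => //; apply: measurable_funN.
  by apply: measurable_sum => i; apply: measurable_funM => //; exact: measurable_coord.
rewrite gauss_tensor //.
set a := acoef _ _ / _; set c1 := (pi * _ / _) ^+ n; set c2 := gcst e * _.
have -> : c2 = (cosh t ^+ n)^-1 * c1.
  have gen (S D E X p : R) : S != 0 -> D != 0 -> E != 0 ->
      (p * X) ^+ n * (E ^+ n * (S ^+ n)^-1) = (D ^+ n)^-1 * (p * X / (S / D / E)) ^+ n.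
    move=> S0 D0 E0; rewrite !(exprMn, exprVn, invfM, invrK).
    by field; rewrite !expf_neq0.
  by apply: gen; rewrite gt_eqF.
have m3 (x y z w : R[i]) : x * (y * (z * w)) = x * z * (y * w) by ring.
by rewrite [LHS]m3 -rmorphM.
Qed.

End regularized_kernel.

Section product_sigma_finite.
Context d1 d2 (T1 : measurableType d1) (T2 : measurableType d2) (R : realType).
Variable m1 : {sigma_finite_measure set T1 -> \bar R}.
Variable m2 : {sigma_finite_measure set T2 -> \bar R}.

Lemma sigma_finite_prod : sigma_finite setT (m1 \x m2)%E.
Proof.
have /sigma_finiteP[F [TF ndF Foo]] := sigma_finiteT m1.
have /sigma_finiteP[G [TG ndG Goo]] := sigma_finiteT m2.
exists (fun n => F n `*` G n).
  rewrite -setXTT TF TG predeqE => -[x y]; split; last by move=> [n _ []]; split; exists n.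
  move=> [/= [n _ Fnx] [k _ Gky]]; exists (maxn n k) => //; split.
    by move: x Fnx; exact/subsetPset/ndF/leq_maxl.
  by move: y Gky; exact/subsetPset/ndG/leq_maxr.
move=> k; have [? ?] := Foo k; have [? ?] := Goo k.
by split; [exact: measurableX|rewrite product_measure1E // lte_mul_pinfty // ge0_fin_numE].
Qed.

(* Canonical inference finds no sigma-finite structure on [m1 \x m2]. *)
Definition prod_sf : {sigma_finite_measure set (T1 * T2)%type -> \bar R} :=
  HB.pack_for {sigma_finite_measure set (T1 * T2)%type -> \bar R} (m1 \x m2)%E
    (Measure_isSigmaFinite.Build _ _ _ (m1 \x m2)%E sigma_finite_prod).

End product_sigma_finite.

(** * Interchange of the integrals for e > 0 *)

Section regularized_swap.
Context {R : realType}.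
Local Notation L := (@lebesgue_rV R).
Local Notation R' := (measurableTypeR R).
Local Notation mu := (@lebesgue_measure R).
Variables n s : nat.
Hypotheses (n1 : (1 <= n)%N) (s1 : (1 <= s)%N).
Local Notation V := ('rV[R]_(n + n + s)).
Local Notation Y := ('rV[R]_s * R')%type.
Local Notation nu := (L s \x mu)%E.

Lemma cmeas_bphase d (T : measurableType d) (f : T -> Y) (g : T -> V) e :
  measurable_fun setT f -> measurable_fun setT g -> cmeas (fun t => @bphase R n s e (f t) (g t)).
Proof.
move=> mf mg.
have mM : measurable_fun setT (fun t => hM (f t)) := measurableT_comp (@measurable_hM R s) mf.
have ml := measurableT_comp (@measurable_lsub R n s) mg.
apply: cmeas_pair.
  apply: measurable_funM => //; apply: measurable_funM => //; apply: measurable_funM => //.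
  by apply: measurable_funX; exact: (measurableT_comp (@measurable_eucl_norm R _) ml).
apply: measurable_funD.
  apply: measurable_sum => i; apply: measurable_funM.
    apply: (measurableT_comp (@measurable_coord R s i)); exact: (measurableT_comp (@measurable_rsub R n s) mg).
  by apply: (measurableT_comp (@measurable_coord R s i)); exact: (measurableT_comp measurable_fst mf).
apply: measurable_funM => //; apply: measurable_funM => //.
exact: (measurableT_comp (@measurable_P R n) ml).
Qed.

Lemma cint0 d (T : measurableType d) (m : {measure set T -> \bar R}) :
  cint m (fun=> 0 : R[i]) = 0.
Proof. by apply: complexP => /=; rewrite /Rintegral integral0. Qed.

Lemma cmeas_expN d (T : measurableType d) (f : T -> R[i]) : cmeas f -> cmeas (fun t => cexp (- f t)).
Proof.
move=> mf; apply: cmeas_cexp; have := cmeasM (cmeas_cst (-1)) mf.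
by under eq_fun do rewrite mulN1r.
Qed.

Variable phi : V -> R[i].
Hypothesis tphi : test_fun phi.

Definition reg_int (e : R) (th : 'rV[R]_s) (p : 'rV[R]_(n + n) * R') : R[i] :=
  ((eucl_norm th)^-1)%:C * ((\1_`]0%R, +oo[ p.2)%:C * oscE n (lam e p.1 * ((eucl_norm th)^-1)%:C) p.2) *
  ft phi (row_mx p.1 th).

Lemma cmeas_reg_int e th : cmeas (reg_int e th).
Proof.
apply: cmeasM.
  apply: cmeasM; first exact: cmeas_cst.
  exact: (cmeas_qeE e measurable_fst (measurable_cst th) measurable_snd).
have mr : measurable_fun setT (fun xi : 'rV[R]_(n + n) => row_mx xi th).
  exact: (measurableT_comp (@measurable_row_mx R (n + n) s) (measurable_pair2 th)).
apply: (cmeas_comp (cmeas_ft tphi)); exact: (measurableT_comp mr measurable_fst).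
Qed.

Lemma reg_int_dom : exists C : R, 0 < C /\ forall e th xi t, 0 <= e ->
  normc (reg_int e th (xi, t)) <=
  (eucl_norm th)^-1 * (C * rV_weight th) * rV_weight xi * (2 * expR (- (1 * `|t|))).
Proof.
have [C [C0 hC]] := ft_decay tphi; exists C; split => // e th xi t e0.
rewrite Normc.normcM Normc.normcM normc_real ger0_norm ?invr_ge0 ?eucl_norm_ge0 //.
have r0 : 0 <= (eucl_norm th)^-1 by rewrite invr_ge0 eucl_norm_ge0.
have h1 := osc_dom n1 t (@Re_lam_scale R n e xi _ e0 r0).
have h2 := hC (row_mx xi th); rewrite rV_weight_row_mx in h2.
rewrite [fst _]/= [snd _]/= -[leLHS]mulrA.
rewrite [leRHS](_ : _ = (eucl_norm th)^-1 * ((2 * expR (- (1 * `|t|))) * (C * (rV_weight xi * rV_weight th)))); last by ring.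
by rewrite ler_wpM2l // (ler_pM (normc_ge0 _) (normc_ge0 _) h1 h2).
Qed.

Lemma reg_int_t e th xi : 0 <= e ->
  cint mu (fun t => reg_int e th (xi, t)) = qe e xi th * ft phi (row_mx xi th).
Proof.
move=> e0; have r0 : 0 <= (eucl_norm th)^-1 by rewrite invr_ge0 eucl_norm_ge0.
have io := cintegrable_osc n1 (@Re_lam_scale R n e xi _ e0 r0).
rewrite /qe /osc -mulrA [_ * ft _ _]mulrC mulrA -(cintZ _ io).
by apply: eq_cint => t; rewrite /reg_int [fst _]/= [snd _]/= [LHS]mulrAC.
Qed.

Lemma reg_int_xi e th t : 0 < e ->
  cint (L (n + n)) (fun xi => reg_int e th (xi, t)) = (gcst n e * hw n (th, t))%:C * gphi phi e (th, t).
Proof.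
move=> e0.
have zero : hw n (th, t) = 0 -> (forall xi, reg_int e th (xi, t) = 0) ->
    cint (L (n + n)) (fun xi => reg_int e th (xi, t)) = (gcst n e * hw n (th, t))%:C * gphi phi e (th, t).
  move=> -> h; rewrite mulr0 mul0r (eq_cint _ h).
  exact: cint0.
have [t0|t0] := leP t 0.
  apply: zero; first exact: hw_npos.
  by move=> xi; rewrite /reg_int /= indicE memNset ?mul0r ?mulr0 ?mul0r //= in_itv /= ltNge t0.
(* At th = 0 the factor 1/|th| is 0 by convention on both sides. *)
have [th0|th0] := eqVneq th 0.
  apply: zero; first by rewrite hw_pos // th0 eucl_norm0 invr0 !mul0r.
  by move=> xi; rewrite /reg_int th0 eucl_norm0 invr0 !mul0r.
have r0 : 0 <= (eucl_norm th)^-1 by rewrite invr_ge0 eucl_norm_ge0.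
have [C [C0 hC]] := ft_decay tphi.
pose G xi := oscE n (lam e xi * ((eucl_norm th)^-1)%:C) t * ft phi (row_mx xi th).
have iG : cintegrable (L (n + n)) G.
  apply: (cintegrable_le (g := fun xi => C * rV_weight th * rV_weight xi)).
  - have mr : measurable_fun setT (fun xi : 'rV[R]_(n + n) => row_mx xi th).
      exact: (measurableT_comp (@measurable_row_mx R (n + n) s) (measurable_pair2 th)).
    apply: cmeasM; last exact: (cmeas_comp (cmeas_ft tphi) mr).
    apply: cmeasM; first exact: cmeas_cst.
    apply: cmeas_cexp; apply: cmeasM; first exact: cmeas_cst.
    by apply: cmeasM; [exact: cmeas_lam|exact: cmeas_cst].
  - by apply: integrable_RZ; exact: integrable_rV_weight.
  - move=> xi; rewrite Normc.normcM.
    have h1 := normc_oscE_le n (@Re_lam_scale R n e xi _ (ltW e0) r0) (ltW t0).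
    have h2 := hC (row_mx xi th); rewrite rV_weight_row_mx in h2.
    have h3 : (cosh t ^+ n)^-1 <= 1.
      by rewrite invf_le1 ?exprn_gt0 ?cosh_gt0 // exprn_ege1 // cosh_ge1.
    apply: le_trans (ler_pM (normc_ge0 _) (normc_ge0 _) (le_trans h1 h3) h2) _.
    by rewrite mul1r le_eqVlt; apply/orP; left; apply/eqP; ring.
transitivity (((eucl_norm th)^-1)%:C * cint (L (n + n)) G).
  rewrite -(cintZ _ iG); apply: eq_cint => xi.
  rewrite /reg_int [fst _]/= [snd _]/= indicE mem_set ?mul1r; last by rewrite /= in_itv /= t0.
  by rewrite -[LHS]mulrA.
rewrite /G (inner_gauss tphi e0 t0 th0) mulrA -rmorphM.
by rewrite hw_pos // mulrCA !mulrA.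
Qed.

Variables (sg del : R).
Hypotheses (sg1 : sg ^+ 2 = 1) (del0 : 0 < del).
Hypothesis supp : forall v, phi v != 0 ->
  eucl_norm (rsubmx v) + del <= sg * (P (lsubmx v) / 4).

(** Since |P(x)| <= |x|^2, points off the cone have x away from 0. Hence e |x|^2 / 4 >= e del on the
    support: this makes J_e converge absolutely and is the lower bound on b used in [rotation]. *)
Lemma supp_sqr v : phi v != 0 -> del <= eucl_norm (lsubmx v) ^+ 2 / 4.
Proof.
move=> /supp h; have h1 := P_le_sqr_norm (lsubmx v); have h2 := eucl_norm_ge0 (rsubmx v).
have h3 : sg * P (lsubmx v) <= `|P (lsubmx v)|.
  by apply: le_trans (ler_norm _) _; rewrite normrM (norm_sg sg1) mul1r.
lra.
Qed.

Lemma phi_bphase_le e y v C : 0 < e -> (forall v, normc (phi v) <= C * rV_weight v) ->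
  normc (phi v * cexp (- bphase e y v)) <= expR (- (e * del * hM y)) * (C * rV_weight v).
Proof.
move=> e0 hC; have [->|pv] := eqVneq (phi v) 0.
  by rewrite mul0r Normc.normc0 mulr_ge0 ?expR_ge0 // (le_trans _ (hC v)) // normc_ge0.
rewrite Normc.normcM mulrC; apply: ler_pM; rewrite ?normc_ge0 ?hC //.
rewrite normc_cexp ler_expR ReN lerN2 [Re _]/= mulrC ler_wpM2l ?hM_ge0 //.
by rewrite -mulrA ler_wpM2l ?supp_sqr // ltW.
Qed.

(** The majorant of [reg_int] contains 1/|th|, so xi and t are exchanged for each fixed th only.
    Integrability over th comes from [cintegrable_reg] before that exchange and, after it, from
    [integrable_hw] with rate e del, which also justifies exchanging v with (th, t). *)
Lemma reg_eq e : 0 < e -> e <= 1 ->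
  cint (L (n + n + s)) (fun w => qe e (lsubmx w) (rsubmx w) * ft phi w) =
  (gcst n e)%:C * cint (L (n + n + s)) (fun v => phi v *
     cint nu (fun y => (hw n y)%:C * cexp (- bphase e y v))).
Proof.
move=> e0 e1; have e0' := ltW e0.
have [C [C0 hC]] := test_fun_bound tphi.
have [D [D0 hD]] := reg_int_dom.
pose f (w : V) := qe e (lsubmx w) (rsubmx w) * ft phi w.
pose pr (p : 'rV[R]_(n + n) * 'rV[R]_s) : V := row_mx p.1 p.2.
have mpr : measurable_fun setT pr := @measurable_row_mx R (n + n) s.
have If : cintegrable (L (n + n + s)) f by apply: cintegrable_reg => //; rewrite e0' e1.
have [mf1 mf2] : cmeas f := cintegrable_meas If.
have iw k := integrable_RZ k (@integrable_rV_weight R (n + n)).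
have ie := integrable_RZ 2 (@integrable_expRN_norm R 1 ltr01).
have Ifp : cintegrable (L (n + n) \x L s)%E (f \o pr).
  by case: If => a b; split;
   [exact: (integrable_transfer ltr01 mpr (@row_mx_transfer R (n + n) s) mf1).2|
    exact: (integrable_transfer ltr01 mpr (@row_mx_transfer R (n + n) s) mf2).2].
have fpE xi th : f (pr (xi, th)) = cint mu (fun t => reg_int e th (xi, t)).
  by rewrite (reg_int_t th xi e0') /f /pr row_mxKl row_mxKr.
pose gD (th : 'rV[R]_s) (xi : 'rV[R]_(n + n)) := (eucl_norm th)^-1 * (D * rV_weight th) * rV_weight xi.
have bI th xi t : normc (reg_int e th (xi, t)) <= gD th xi * (2 * expR (- (1 * `|t|))) by exact: hD.
have sect th : cintegrable (L (n + n)) (fun xi => (f \o pr) (xi, th)).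
  apply: (cintegrable_le (g := fun xi => (2 * \int[mu]_(t in setT) (2 * expR (- (1 * `|t|)))) * gD th xi)).
  - have := cmeas_cint_section mu (cmeas_reg_int e th).
    by under eq_fun do rewrite -fpE.
  - apply: integrable_RZ; exact: iw.
  - move=> xi; rewrite [X in normc X]fpE -mulrA [_ * gD _ _]mulrC -RintegralZl //.
    apply: normc_cint_le; [exact: (cmeas_section xi (cmeas_reg_int e th))|exact: integrable_RZ|exact: bI].
pose g (y : Y) := (gcst n e * hw n y)%:C * gphi phi e y.
have mphase : cmeas (fun p : Y * V => phi p.2 * cexp (- bphase e p.1 p.2)).
  apply: cmeasM; first exact: (cmeas_comp (test_fun_cmeas tphi) measurable_snd).
  by apply: cmeas_expN; exact: cmeas_bphase measurable_fst measurable_snd.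
have mg : cmeas g.
  apply: cmeasM; last exact: (cmeas_cint_section (L (n + n + s)) mphase).
  by apply: cmeas_real; apply: measurable_funM => //; exact: measurable_hw.
have ed : 0 < e * del by exact: mulr_gt0.
have iV k := integrable_RZ k (@integrable_rV_weight R (n + n + s)).
have ihw := integrable_hw n1 s1 ed.
have gc0 : 0 <= gcst n e by rewrite exprn_ge0 // mulr_ge0 ?pi_ge0 ?sqrtr_ge0.
have Ig : cintegrable nu g.
  apply: (cintegrable_le (g := fun y => (gcst n e * (2 * \int[L (n + n + s)]_v (C * rV_weight v))) *
     (hw n y * expR (- (e * del * hM y)))) mg).
    exact: integrable_RZ.
  move=> y; rewrite Normc.normcM normc_real (ger0_norm (mulr_ge0 gc0 (hw_ge0 n y))).
  have h : normc (gphi phi e y) <= 2 * \int[L (n + n + s)]_v (expR (- (e * del * hM y)) * (C * rV_weight v)).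
    apply: normc_cint_le; first exact: (cmeas_section y mphase).
      exact: integrable_RZ (iV C).
    by move=> v; exact: phi_bphase_le.
  rewrite RintegralZl // in h.
  apply: le_trans (ler_wpM2l (mulr_ge0 gc0 (hw_ge0 n y)) h) _.
  by rewrite le_eqVlt; apply/orP; left; apply/eqP; ring.
have sectg th : cintegrable mu (fun t => g (th, t)).
  apply: (cintegrable_le (g := fun t : R' => (2 * \int[L (n + n)]_xi gD th xi) * (2 * expR (- (1 * `|t|))))).
  - exact: (cmeas_section th mg).
  - exact: integrable_RZ.
  - move=> t; rewrite /g -reg_int_xi // -mulrA [_ * (2 * expR _)]mulrC -RintegralZl //; last exact: iw.
    apply: normc_cint_le.
    + exact: (cmeas_comp (cmeas_reg_int e th) (measurable_pair2 t)).
    + by apply: integrable_RZ; exact: iw.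
    + by move=> xi; rewrite mulrC; exact: bI.
have [_ ->] := cint_transfer ltr01 mpr (@row_mx_transfer R (n + n) s) (conj mf1 mf2) Ifp.
rewrite mul1r (cfubini2 Ifp sect).
transitivity (cint nu g).
  rewrite (cfubini1 Ig sectg); apply: eq_cint => th.
  rewrite (eq_cint (L (n + n)) (fun xi => fpE xi th)).
  have [-> _] := cfubini_dom (cmeas_reg_int e th) (iw ((eucl_norm th)^-1 * (D * rV_weight th))) ie (bI th).
  by apply: eq_cint => t; rewrite reg_int_xi.
have mF2 : cmeas (fun p : Y * V => (hw n p.1)%:C * (phi p.2 * cexp (- bphase e p.1 p.2))).
  apply: cmeasM mphase; apply: cmeas_real.
  exact: (measurableT_comp (@measurable_hw R n s) measurable_fst).
have bF2 y v : normc ((hw n y)%:C * (phi v * cexp (- bphase e y v))) <=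
    (hw n y * expR (- (e * del * hM y))) * (C * rV_weight v).
  rewrite Normc.normcM normc_real ger0_norm ?hw_ge0 // -mulrA ler_wpM2l ?hw_ge0 //.
  exact: phi_bphase_le.
have [sw _] := @cfubini_dom _ _ _ _ _ (prod_sf (L s) mu) (L (n + n + s)) _ _ _ mF2 ihw (iV C) bF2.
have sphase y : cintegrable (L (n + n + s)) (fun v => phi v * cexp (- bphase e y v)).
  apply: (cintegrable_le (cmeas_section y mphase) (integrable_RZ (expR (- (e * del * hM y))) (iV C))).
  by move=> v; exact: phi_bphase_le.
have Ihg : cintegrable nu (fun y => (hw n y)%:C * gphi phi e y).
  apply: (cintegrable_le (g := fun y => (2 * \int[L (n + n + s)]_v (C * rV_weight v)) *
     (hw n y * expR (- (e * del * hM y))))).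
  - apply: cmeasM; last exact: (cmeas_cint_section (L (n + n + s)) mphase).
    by apply: cmeas_real; exact: measurable_hw.
  - exact: integrable_RZ.
  - move=> y.
    have eI : \int[L (n + n + s)]_v ((hw n y * expR (- (e * del * hM y))) * (C * rV_weight v)) =
      (hw n y * expR (- (e * del * hM y))) * \int[L (n + n + s)]_v (C * rV_weight v).
      by rewrite RintegralZl //; exact: iV.
    rewrite -[leRHS]mulrA [X in _ <= _ * X]mulrC -eI.
    rewrite /gphi -(cintZ _ (sphase y)); apply: normc_cint_le.
    + exact: (cmeas_section y mF2).
    + by apply: integrable_RZ; exact: iV.
    + exact: bF2.
transitivity ((gcst n e)%:C * cint nu (fun y => (hw n y)%:C * gphi phi e y)).
  rewrite -(cintZ _ Ihg); apply: eq_cint => y; by rewrite /g rmorphM -[LHS]mulrA.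
congr (_ * _).
transitivity (cint nu (fun y => cint (L (n + n + s)) (fun v => (hw n y)%:C * (phi v * cexp (- bphase e y v))))).
  by apply: eq_cint => y; rewrite /gphi -(cintZ _ (sphase y)).
rewrite [LHS]sw; apply: eq_cint => v.
have [->|pv] := eqVneq (phi v) 0.
  rewrite mul0r; transitivity (cint nu (fun=> 0 : R[i])); first by apply: eq_cint => y; rewrite mul0r mulr0.
  exact: cint0.
have bb : del * e <= e * eucl_norm (lsubmx v) ^+ 2 / 4.
  by rewrite mulrC -mulrA ler_wpM2l ?supp_sqr.
rewrite -cintZ; last first.
  apply: (cintegrable_le (g := fun y => hw n y * expR (- (e * del * hM y)))) => //.
    apply: cmeasM; first by apply: cmeas_real; exact: measurable_hw.
    by apply: cmeas_expN; apply: (cmeas_bphase e (f := id)).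
  move=> y; rewrite Normc.normcM normc_real ger0_norm ?hw_ge0 // ler_wpM2l ?hw_ge0 //.
  rewrite normc_cexp ler_expR ReN lerN2 [Re _]/= mulrC ler_wpM2l ?hM_ge0 //.
  by rewrite mulrC.
by apply: eq_cint => y; rewrite mulrCA.
Qed.

End regularized_swap.

(** * The limit e -> 0 and the kernel representing the distribution *)

Section kernel_formula.
Context {R : realType}.
Local Notation L := (@lebesgue_rV R).
Local Notation R' := (measurableTypeR R).
Local Notation mu := (@lebesgue_measure R).
Variables n s : nat.
Hypotheses (n1 : (1 <= n)%N) (s1 : (1 <= s)%N).
Local Notation V := ('rV[R]_(n + n + s)).
Local Notation Y := ('rV[R]_s * R')%type.
Local Notation nu := (L s \x mu)%E.

Definition vphase (sg e : R) (v : V) (y : Y) : R[i] :=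
  decay_phase sg (P (lsubmx v) / 4) (e * eucl_norm (lsubmx v) ^+ 2 / 4) (rsubmx v) y.

Definition kern (sg e : R) (v : V) : R[i] :=
  cint nu (fun y => (hw n y)%:C * cexp (- vphase sg e v y)).

Lemma cmeas_vphase sg e : cmeas (fun p : V * Y => vphase sg e p.1 p.2).
Proof.
have mM : measurable_fun setT (fun p : V * Y => hM p.2) := measurableT_comp (@measurable_hM R s) measurable_snd.
have ml : measurable_fun setT (fun p : V * Y => lsubmx p.1) := measurableT_comp (@measurable_lsub R n s) measurable_fst.
have mP : measurable_fun setT (fun p : V * Y => P (lsubmx p.1)) := measurableT_comp (@measurable_P R n) ml.
apply: cmeas_pair.
  apply: measurable_funD; apply: measurable_funM => //.
    apply: measurable_sum => i; apply: measurable_funM.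
      apply: (measurableT_comp (@measurable_coord R s i)); exact: (measurableT_comp (@measurable_rsub R n s) measurable_fst).
    by apply: (measurableT_comp (@measurable_coord R s i)); exact: (measurableT_comp measurable_fst measurable_snd).
  by apply: measurable_funM => //; apply: measurable_funM.
apply: measurable_funN; apply: measurable_funM => //; apply: measurable_funM => //.
apply: measurable_funM => //; apply: measurable_funM => //; apply: measurable_funX.
exact: (measurableT_comp (@measurable_eucl_norm R _) ml).
Qed.

Lemma cmeas_kern sg e : cmeas (kern sg e).
Proof.
have mF : cmeas (fun p : V * Y => (hw n p.2)%:C * cexp (- vphase sg e p.1 p.2)).
  apply: cmeasM.
    by apply: cmeas_real; exact: (measurableT_comp (@measurable_hw R n s) measurable_snd).
  by apply: cmeas_expN; exact: cmeas_vphase.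
exact: (cmeas_cint_section (prod_sf (L s) mu) mF).
Qed.

Lemma Re_vphase_ge sg e v y (del : R) : sg ^+ 2 = 1 ->
  eucl_norm (rsubmx v) + del <= sg * (P (lsubmx v) / 4) -> del * hM y <= Re (vphase sg e v y).
Proof. by move=> sg1 h; apply: Re_decay_ge. Qed.

Lemma normc_kern_int_le sg e v y (del : R) : sg ^+ 2 = 1 ->
  eucl_norm (rsubmx v) + del <= sg * (P (lsubmx v) / 4) ->
  normc ((hw n y)%:C * cexp (- vphase sg e v y)) <= hw n y * expR (- (del * hM y)).
Proof.
move=> sg1 h; rewrite Normc.normcM normc_real (ger0_norm (hw_ge0 n y)) ler_wpM2l ?hw_ge0 //.
by rewrite normc_cexp ler_expR ReN lerN2; exact: Re_vphase_ge.
Qed.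

Lemma cmeas_kern_int sg e v : cmeas (fun y : Y => (hw n y)%:C * cexp (- vphase sg e v y)).
Proof.
apply: cmeasM; first by apply: cmeas_real; exact: measurable_hw.
by apply: cmeas_expN; exact: (cmeas_section v (cmeas_vphase sg e)).
Qed.

Variable phi : V -> R[i].
Hypothesis tphi : test_fun phi.
Variables (sg del : R).
Hypotheses (sg1 : sg ^+ 2 = 1) (del0 : 0 < del).
Hypothesis supp : forall v, phi v != 0 ->
  eucl_norm (rsubmx v) + del <= sg * (P (lsubmx v) / 4).

Lemma kern_rotation e v : 0 < e -> e <= 1 -> phi v != 0 ->
  cint nu (fun y => (hw n y)%:C * cexp (- bphase e y v)) =
  cis (- (sg * ((n + s).-1%:R * (pi / 2)))) * kern sg e v.
Proof.
move=> e0 e1 pv.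
(* [rotation] takes a single margin for both ends of the turn; e del fits both, here because e <=
   1. *)
have h1 : eucl_norm (rsubmx v) + e * del <= sg * (P (lsubmx v) / 4).
  by apply: le_trans (supp pv); rewrite lerD2l ler_piMl // ltW.
have h2 : e * del <= e * eucl_norm (lsubmx v) ^+ 2 / 4.
  by rewrite -mulrA ler_wpM2l ?(supp_sqr sg1 supp pv) // ltW.
exact: (rotation n1 s1 sg1 (mulr_gt0 e0 del0) h1 h2).
Qed.

(** The bound does not involve e: after the rotation e occurs only in the imaginary part of the
    phase, and the margin del alone controls the modulus. *)
Lemma kern_dom : exists D : R, 0 < D /\ forall e v,
  normc (phi v * kern sg e v) <= D * rV_weight v.
Proof.
have [C [C0 hC]] := test_fun_bound tphi.
have ihw := integrable_hw n1 s1 del0.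
pose I := 2 * \int[nu]_y (hw n y * expR (- (del * hM y))).
have I0 : 0 <= I.
  by rewrite mulr_ge0 //; apply: Rintegral_ge0 => y _; rewrite mulr_ge0 ?hw_ge0 ?expR_ge0.
exists (C * (I + 1)); split; first by rewrite mulr_gt0 // ltr_wpDl.
move=> e v; have wv := ltW (rV_weight_gt0 v).
have [->|pv] := eqVneq (phi v) 0.
  by rewrite mul0r Normc.normc0 !mulr_ge0 ?(ltW C0) // addr_ge0.
rewrite Normc.normcM mulrAC; apply: ler_pM; rewrite ?normc_ge0 ?hC //.
apply: le_trans (_ : I <= I + 1); last by rewrite lerDl.
apply: normc_cint_le => //; first exact: cmeas_kern_int.
by move=> y; exact: normc_kern_int_le (supp pv).
Qed.

Lemma kern_cvg (u : nat -> R) : u @ \oo --> (0 : R) ->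
  ccvg (fun k => cint (L (n + n + s)) (fun v => phi v * kern sg (u k) v))
    (cint (L (n + n + s)) (fun v => phi v * kern sg 0 v)).
Proof.
move=> u0; have [D [D0 hD]] := kern_dom.
apply: (cint_dct (g := fun v => D * rV_weight v)).
- by move=> k; apply: cmeasM; [exact: test_fun_cmeas|exact: cmeas_kern].
- move=> v; have [->|pv] := eqVneq (phi v) 0.
    by rewrite mul0r; under eq_fun do rewrite mul0r; exact: ccvg_cst.
  apply: ccvgM; first exact: ccvg_cst.
  apply: (cint_dct (g := fun y => hw n y * expR (- (del * hM y)))).
  + by move=> k; exact: cmeas_kern_int.
  + move=> y; apply: ccvgM; first exact: ccvg_cst.
    apply: ccvg_cexp; split; first exact: cvg_cst.
    rewrite (_ : Im (- vphase sg 0 v y) = sg * hM y * (eucl_norm (lsubmx v) ^+ 2 / 4) * 0); last by rewrite /=; ring.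
    rewrite (_ : Im \o _ = (fun k => sg * hM y * (eucl_norm (lsubmx v) ^+ 2 / 4) * u k)); last first.
      by apply/funext => k /=; ring.
    by apply: cvgM => //; exact: cvg_cst.
  + exact: integrable_hw.
  + by move=> k y; exact: normc_kern_int_le (supp pv).
- by apply: integrable_RZ; exact: integrable_rV_weight.
- by move=> k v; exact: hD.
Qed.

Definition kcst : R[i] := qcst n s * ((2 * pi) `^ (- ((n + n + s)%:R / 2)))%:C *
  ((gcst n 0)%:C * cis (- (sg * ((n + s).-1%:R * (pi / 2))))).

(** Both sides of [reg_eq] converge along e = 1 / (k + 1), the left by [reg_cvg] and the right, once
    rotated, by [kern_cvg]; uniqueness of the limit identifies them. *)
Lemma K0s_kern (psi : schwartz R (n + n + s)) : (psi : V -> R[i]) = phi ->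
  K0s psi = cint (L (n + n + s)) (fun v => kcst * kern sg 0 v * phi v).
Proof.
move=> epsi; rewrite (K0s_ft n1 s1 tphi epsi).
(* The shift by one keeps every term positive and at most 1, as [reg_eq] demands. *)
pose u (k : nat) : R := k.+1%:R^-1.
have u0 : u @ \oo --> (0 : R) by exact: cvg_harmonic.
have upos k : 0 < u k by rewrite invr_gt0.
have u1 k : u k <= 1 by rewrite invf_le1 // ler1n.
have u01 k : 0 <= u k <= 1 by rewrite u1 ltW.
have c1 := reg_cvg n1 s1 tphi u01 u0.
have c2 := kern_cvg u0.
set w := cis (- (sg * ((n + s).-1%:R * (pi / 2)))).
have iK e : cintegrable (L (n + n + s)) (fun v => phi v * kern sg e v).
  have [D [D0 hD]] := kern_dom.
  apply: (cintegrable_le _ (integrable_RZ D (@integrable_rV_weight R (n + n + s)))) => [|v]; last exact: hD.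
  by apply: cmeasM; [exact: test_fun_cmeas|exact: cmeas_kern].
have E k : cint (L (n + n + s)) (fun w => qe (u k) (lsubmx w) (rsubmx w) * ft phi w) =
    (gcst n (u k))%:C * w * cint (L (n + n + s)) (fun v => phi v * kern sg (u k) v).
  rewrite (reg_eq n1 s1 tphi sg1 del0 supp (upos k) (u1 k)) -[RHS]mulrA; apply: (f_equal (GRing.mul _)).
  rewrite -(cintZ _ (iK (u k))); apply: eq_cint => v.
  have [->|pv] := eqVneq (phi v) 0; first by rewrite !mul0r mulr0.
  by rewrite (kern_rotation (upos k) (u1 k) pv) mulrCA.
have cg : (fun k => gcst n (u k)) @ \oo --> gcst n 0.
  pose g (x : R) := (pi * Num.sqrt (1 + x ^+ 2)) ^+ n.
  have cont : {for (0 : R), continuous g}.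
    apply: (continuous_comp (f := fun x : R => pi * Num.sqrt (1 + x ^+ 2)) (g := fun x : R => x ^+ n)).
      apply: cvgM; first exact: cvg_cst.
      apply: (continuous_comp (f := fun x : R => 1 + x ^+ 2)); last exact: sqrt_continuous.
      by apply: cvgD; [exact: cvg_cst|exact: exprn_continuous].
    exact: exprn_continuous.
  exact: (cvg_comp _ _ u0 cont).
have c3 : ccvg (fun k => cint (L (n + n + s)) (fun w => qe (u k) (lsubmx w) (rsubmx w) * ft phi w))
    ((gcst n 0)%:C * w * cint (L (n + n + s)) (fun v => phi v * kern sg 0 v)).
  rewrite (_ : (fun k => _) = (fun k => (gcst n (u k))%:C * w * cint (L (n + n + s)) (fun v => phi v * kern sg (u k) v))); last exact/funext.
  by apply: ccvgM c2; apply: ccvgM; [exact: ccvg_real|exact: ccvg_cst].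
rewrite (ccvg_unique c1 c3) mulrA -(cintZ _ (iK 0)).
by apply: eq_cint => v; rewrite /kcst -/w; ring.
Qed.

End kernel_formula.

(** * Smoothness of the kernel *)

Section kernel_smooth.
Context {R : realType}.
Local Notation L := (@lebesgue_rV R).
Local Notation R' := (measurableTypeR R).
Local Notation mu := (@lebesgue_measure R).
Variables n s : nat.
Hypotheses (n1 : (1 <= n)%N) (s1 : (1 <= s)%N).
Local Notation V := ('rV[R]_(n + n + s)).
Local Notation Y := ('rV[R]_s * R')%type.
Local Notation nu := (L s \x mu)%E.

Lemma is_derive_of_line m (g : 'rV[R]_m -> R) (x e : 'rV[R]_m) (l : R) :
  is_derive (0 : R) (1 : R) (fun t : R => g (x + t *: e)) l -> is_derive x e g l.
Proof.
move=> [dg <-].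
have E : (fun t : R => t^-1 *: ((g \o shift x) (t *: e) - g x)) =
   (fun t : R => t^-1 *: (((fun t : R => g (x + t *: e)) \o shift 0) (t *: (1 : R)) - g (x + 0 *: e))).
  apply/funext => t; rewrite scale0r addr0; congr (_ *: (g _ - _)).
  by rewrite /shift /= [t *: 1]mulr1 addr0 addrC.
by apply: DeriveDef; rewrite /derivable /derive E.
Qed.

Definition psign (k : 'I_(n + n)) : R := if fintype.split k is inl _ then 1 else -1.

Lemma P_psign (x : 'rV[R]_(n + n)) : P x = \sum_k psign k * x ord0 k ^+ 2.
Proof.
rewrite big_split_ord /= -big_split /=; apply: eq_bigr => j _.
rewrite /psign (unsplitK (inl j : 'I_n + 'I_n)) (unsplitK (inr j : 'I_n + 'I_n)).
by rewrite mul1r mulN1r.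
Qed.

Lemma P_line (x : 'rV[R]_(n + n)) j (h : R) :
  P (x + h *: delta_mx ord0 j) = P x + psign j * (2 * x ord0 j * h + h ^+ 2).
Proof.
rewrite !P_psign (bigD1 j) //= [in RHS](bigD1 j) //= !mxE !eqxx mulr1.
rewrite (eq_bigr (fun k => psign k * x ord0 k ^+ 2)); first by ring.
by move=> k kj; rewrite !mxE (negbTE kj) andbF mulr0 addr0.
Qed.

Lemma dot_line (z th : 'rV[R]_s) j (h : R) :
  dot (z + h *: delta_mx ord0 j) th = dot z th + th ord0 j * h.
Proof.
rewrite /dot (bigD1 j) //= [in RHS](bigD1 j) //= !mxE !eqxx mulr1.
rewrite (eq_bigr (fun k => z ord0 k * th ord0 k)); first by ring.
by move=> k kj; rewrite !mxE (negbTE kj) andbF mulr0 addr0.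
Qed.

Lemma lsubmx_line_l (v : V) j (h : R) :
  lsubmx (v + h *: delta_mx ord0 (lshift s j)) = lsubmx v + h *: delta_mx ord0 j.
Proof. by apply/rowP => k; rewrite !mxE (inj_eq (@lshift_inj _ _)). Qed.

Lemma rsubmx_line_l (v : V) j (h : R) : rsubmx (v + h *: delta_mx ord0 (lshift s j)) = rsubmx v.
Proof. by apply/rowP => k; rewrite !mxE eq_rlshift andbF mulr0 addr0. Qed.

Lemma lsubmx_line_r (v : V) j (h : R) : lsubmx (v + h *: delta_mx ord0 (rshift (n + n) j)) = lsubmx v.
Proof. by apply/rowP => k; rewrite !mxE eq_lrshift andbF mulr0 addr0. Qed.

Lemma rsubmx_line_r (v : V) j (h : R) :
  rsubmx (v + h *: delta_mx ord0 (rshift (n + n) j)) = rsubmx v + h *: delta_mx ord0 j.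
Proof. by apply/rowP => k; rewrite !mxE (inj_eq (@rshift_inj _ _)). Qed.

Lemma cont_sum m I (r : seq I) (F : I -> 'rV[R]_m -> R) : (forall i, continuous (F i)) ->
  continuous (fun v => \sum_(i <- r) F i v).
Proof.
move=> cF; elim: r => [|i r IH].
  by under eq_fun do rewrite big_nil; exact: cont_cst.
by under eq_fun do rewrite big_cons; exact: cont_add.
Qed.

Lemma cont_dist m (g : 'rV[R]_m -> R) (c : R) : continuous g ->
  continuous (fun v => `|g v - c|).
Proof.
move=> cg v; have h : (fun v => g v - c) x @[x --> v] --> (g v - c) := cont_add cg (@cont_cst R m (- c)) (x := v).
exact: (cvg_norm h).
Qed.

Lemma cont_lcoord k : continuous (fun v : V => lsubmx v ord0 k).
Proof. by under eq_fun do rewrite mxE; exact: coord_continuous_rV. Qed.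

Lemma cont_rcoord k : continuous (fun v : V => rsubmx v ord0 k).
Proof. by under eq_fun do rewrite mxE; exact: coord_continuous_rV. Qed.

Lemma cont_P : continuous (fun v : V => P (lsubmx v)).
Proof.
under eq_fun do rewrite P_psign; apply: cont_sum => k; apply: cont_mul; first exact: cont_cst.
by under eq_fun do rewrite expr2; apply: cont_mul; exact: cont_lcoord.
Qed.

Lemma cont_eucl_norm : continuous (fun v : V => eucl_norm (rsubmx v)).
Proof.
move=> v; apply: (continuous_comp (f := fun v : V => \sum_i rsubmx v ord0 i ^+ 2)); last exact: sqrt_continuous.
apply: cont_sum => k; under eq_fun do rewrite expr2; apply: cont_mul; exact: cont_rcoord.
Qed.

Variable sg : R.
Hypothesis sg1 : sg ^+ 2 = 1.

(** A quarter of sg P(x) - 4 |z|. By [decay_ge] it is also the exponential rate, measured in [hM],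
    at which the integrand of the kernel decays. *)
Definition gap (v : V) : R := sg * (P (lsubmx v) / 4) - eucl_norm (rsubmx v).

Lemma cont_gap : continuous gap.
Proof.
rewrite (_ : gap = fun v => sg * (P (lsubmx v) * 4^-1) + -1 * eucl_norm (rsubmx v)); last first.
  by apply/funext => v; rewrite mulN1r.
apply: cont_add; apply: cont_mul; [exact: cont_cst| |exact: cont_cst|exact: cont_eucl_norm].
by apply: cont_mul; [exact: cont_P|exact: cont_cst].
Qed.

Lemma open_gap : open [set v | 0 < gap v].
Proof.
rewrite (_ : [set v | 0 < gap v] = gap @^-1` [set x | 0 < x]) //.
by apply: open_comp; [move=> v _; exact: cont_gap|exact: open_gt].
Qed.

Definition decay (v : V) (y : Y) : R :=
  sg * dot (rsubmx v) y.1 + hM y * (sg * (P (lsubmx v) / 4)).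

Lemma decay_ge v y : gap v * hM y <= decay v y.
Proof.
have h : eucl_norm (rsubmx v) + gap v <= sg * (P (lsubmx v) / 4) by rewrite addrC subrK.
exact: (Re_decay_ge 0 sg1 h y).
Qed.

Lemma measurable_decay v : measurable_fun setT (decay v).
Proof.
apply: measurable_funD; first by apply: measurable_funM => //; exact: measurable_dot_y.
by apply: measurable_funM => //; exact: measurable_hM.
Qed.

(** Each derivative of the exponential brings down a factor of size at most a multiple of [hM]. This
    class of amplitudes is stable under such factors, and exp (- del hM) still integrates them. *)
Definition admissible (M : Y -> R) := measurable_fun setT M /\
  exists (C : R) (k : nat), 0 <= C /\ forall y, `|M y| <= C * ((1 + hM y) ^+ k * hw n y).

Lemma admissible_hw : admissible (fun y => hw n y).
Proof.
split; first exact: measurable_hw.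
exists 1, 0%N; split => // y; rewrite expr0 !mul1r ger0_norm //; exact: hw_ge0.
Qed.

Lemma admissibleM M (W : Y -> R) : admissible M -> measurable_fun setT W ->
  (forall y, `|W y| <= hM y) -> admissible (fun y => M y * W y).
Proof.
move=> [mM [C [k [C0 h]]]] mW hW; split; first exact: measurable_funM.
exists C, k.+1; split => // y; have M0 := hM_ge0 y; have w0 := hw_ge0 n y.
rewrite normrM exprSr -mulrA [_ * hw n y]mulrC mulrA mulrA -[_ * _ * hw n y]mulrA.
apply: ler_pM => //; apply: le_trans (hW y) _; by rewrite lerDr.
Qed.

Definition laplace (M : Y -> R) (v : V) : R := \int[nu]_y (M y * expR (- decay v y)).

Lemma laplace_dom M : admissible M -> forall del : R, 0 < del -> exists G : Y -> R,
  [/\ nu.-integrable setT (EFin \o G), (forall y, 0 <= G y) &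
   forall v y, del <= gap v -> `|M y * expR (- decay v y)| <= G y].
Proof.
move=> [mM [C [k [C0 h]]]] del d0.
exists (fun y => C * ((1 + hM y) ^+ k * hw n y * expR (- (del * hM y)))); split.
- by apply: integrable_RZ; exact: integrable_hw_poly.
- move=> y; apply: mulr_ge0 => //; apply: mulr_ge0; last exact: expR_ge0.
  by apply: mulr_ge0; [rewrite exprn_ge0 // addr_ge0 // hM_ge0|exact: hw_ge0].
move=> v y gv; rewrite normrM (ger0_norm (expR_ge0 _)) mulrA.
apply: ler_pM; rewrite ?normr_ge0 ?expR_ge0 //.
rewrite ler_expR lerN2; apply: le_trans (decay_ge v y).
by rewrite ler_wpM2r ?hM_ge0.
Qed.

Lemma measurable_laplace (M : Y -> R) v : measurable_fun setT M ->
  measurable_fun setT (fun y => M y * expR (- decay v y)).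
Proof.
move=> mM; apply: measurable_funM => //; apply: measurableT_comp => //; apply: measurable_funN.
exact: measurable_decay.
Qed.

Lemma integrable_laplace M v : admissible M -> 0 < gap v ->
  nu.-integrable setT (EFin \o (fun y => M y * expR (- decay v y))).
Proof.
move=> aM gv; have [G [iG G0 hG]] := laplace_dom aM gv.
apply: le_integrable iG => //; first by apply/measurable_EFinP; apply: measurable_laplace; case: aM.
by move=> y _ /=; rewrite lee_fin [leRHS]ger0_norm // hG.
Qed.

Lemma expRN_lipschitz (a b m : R) : m <= a -> m <= b ->
  `|expR (- a) - expR (- b)| <= `|a - b| * expR (- m).
Proof.
have main (x y : R) : m <= x -> x <= y -> `|expR (- x) - expR (- y)| <= `|x - y| * expR (- m).
  move=> mx xy; rewrite ger0_norm; last by rewrite subr_ge0 ler_expR lerN2.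
  rewrite distrC ger0_norm ?subr_ge0 //.
  have -> : expR (- x) - expR (- y) = (1 - expR (- (y - x))) * expR (- x).
    by rewrite mulrBl mul1r -expRD; congr (_ - expR _); ring.
  apply: ler_pM; rewrite ?expR_ge0 ?ler_expR ?lerN2 //.
    by rewrite subr_ge0 -expR0 ler_expR oppr_le0 subr_ge0.
  have := expR_ge1Dx (- (y - x)); lra.
move=> ma mb; have [ab|ba] := leP a b; first exact: main.
by rewrite distrC (distrC a); apply: main => //; exact: ltW.
Qed.

Lemma decay_lipschitz v v0 y : `|decay v y - decay v0 y| <=
  hM y * (\sum_j `|rsubmx v ord0 j - rsubmx v0 ord0 j| + `|P (lsubmx v) - P (lsubmx v0)|).
Proof.
have M0 := hM_ge0 y.
have -> : decay v y - decay v0 y = sg * (dot (rsubmx v) y.1 - dot (rsubmx v0) y.1) +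
   sg * (hM y * ((P (lsubmx v) - P (lsubmx v0)) / 4)) by rewrite /decay; ring.
apply: le_trans (ler_normD _ _) _; rewrite (normrM sg) (normrM sg (hM y * _)) (norm_sg sg1) !mul1r mulrDr.
apply: lerD.
  rewrite -sumrB mulr_sumr; apply: le_trans (ler_norm_sum _ _ _) _; apply: ler_sum => j _.
  rewrite -mulrBl normrM mulrC ler_wpM2r //.
  by apply: le_trans (eucl_norm_coord _ _) _; exact: eucl_norm_le_hM.
rewrite normrM (ger0_norm M0) ler_wpM2l // normrM (ger0_norm (_ : 0 <= 4^-1)) //.
by rewrite ler_piMr // invf_le1 // ler1n.
Qed.

(** The exponents at v and v0 differ by at most [hM] times a modulus [Lam v] independent of (th, t).
    Near v0, where [gap] stays above half its value, the integrals thus differ by at most [Lam v]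
    times a fixed finite integral, with [hM] absorbed into the amplitude. *)
Lemma laplace_continuous M v0 : admissible M -> 0 < gap v0 -> {for v0, continuous (laplace M)}.
Proof.
move=> aM gv; pose del := gap v0 / 2; have d0 : 0 < del by rewrite divr_gt0.
have aM2 : admissible (fun y => M y * hM y).
  apply: admissibleM => //; first exact: measurable_hM.
  by move=> y; rewrite ger0_norm ?hM_ge0.
have [mM [C [k [C0 hC]]]] := aM2.
pose G (y : Y) := C * ((1 + hM y) ^+ k * hw n y * expR (- (del * hM y))).
have iG : nu.-integrable setT (EFin \o G) by apply: integrable_RZ; exact: integrable_hw_poly.
pose Lam (v : V) := \sum_j `|rsubmx v ord0 j - rsubmx v0 ord0 j| + `|P (lsubmx v) - P (lsubmx v0)|.
have Lam0 v : 0 <= Lam v by rewrite addr_ge0 // sumr_ge0.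
have cLam : Lam v @[v --> v0] --> (0 : R).
  have -> : 0 = Lam v0 by rewrite /Lam subrr normr0 addr0 big1 // => j _; rewrite subrr normr0.
  apply: (cont_add (g := fun v : V => \sum_j `|rsubmx v ord0 j - rsubmx v0 ord0 j|)).
    by apply: cont_sum => j; apply: cont_dist; exact: cont_rcoord.
  by apply: cont_dist; exact: cont_P.
have gd0 : del < gap v0 by rewrite /del; lra.
have bound : \forall v \near v0, `|laplace M v0 - laplace M v| <= Lam v * \int[nu]_y G y.
  have near1 : \forall v \near v0, gap v > del by exact: (cvgr_gt _ (cont_gap (x := v0))).
  near=> v; have gv1 : del < gap v by near: v.
  have i0 := integrable_laplace aM gv; have i1 := integrable_laplace aM (lt_trans d0 gv1).
  rewrite /laplace -RintegralB //.
  have mB : measurable_fun setT (fun y => M y * expR (- decay v0 y) - M y * expR (- decay v y)).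
    by apply: measurable_funB; apply: measurable_laplace; case: aM.
  have hB y : `|M y * expR (- decay v0 y) - M y * expR (- decay v y)| <= Lam v * G y.
    have m0 : del * hM y <= decay v0 y.
      by apply: le_trans (decay_ge v0 y); rewrite ler_wpM2r ?hM_ge0 // ltW.
    have m1 : del * hM y <= decay v y.
      by apply: le_trans (decay_ge v y); rewrite ler_wpM2r ?hM_ge0 // ltW.
    rewrite -mulrBr normrM.
    apply: le_trans (ler_wpM2l (normr_ge0 _) (expRN_lipschitz m0 m1)) _.
    have h1 : `|decay v0 y - decay v y| <= hM y * Lam v by rewrite distrC; exact: decay_lipschitz.
    apply: le_trans (ler_wpM2l (normr_ge0 _) (ler_wpM2r (expR_ge0 _) h1)) _.
    have := hC y; rewrite normrM (ger0_norm (hM_ge0 y)) => h2.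
    have := ler_wpM2r (mulr_ge0 (Lam0 v) (expR_ge0 (- (del * hM y)))) h2.
    rewrite /G; set E := expR _; set a := `|M y|; set b := _ ^+ k; set w := hw n y; set m := hM y; set l := Lam v.
    by move=> h3; apply: le_trans (le_trans _ h3) _; rewrite le_eqVlt; apply/orP; left; apply/eqP; ring.
  have iB : nu.-integrable setT (EFin \o (fun y => M y * expR (- decay v0 y) - M y * expR (- decay v y))).
    by have := integrableB measurableT i0 i1.
  apply: le_trans (le_normr_Rintegral _ iB) _ => //.
  rewrite -RintegralZl //; apply: le_Rintegral => //.
    exact: integrable_norm.
  exact: integrable_RZ.
have c3 : Lam v * \int[nu]_y G y @[v --> v0] --> (0 : R).
  rewrite -(mul0r (\int[nu]_y G y)); apply: (cvgM cLam); exact: (@cst_continuous V R).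
have near_le e : 0 < e -> \forall v \near v0, `|laplace M v0 - laplace M v| <= e.
  move=> e0; have c4 : \forall v \near v0, Lam v * \int[nu]_y G y < e.
    by exact: (cvgr_lt _ c3).
  by apply: filterS2 bound c4 => v h1 h2; exact: le_trans h1 (ltW h2).
have key : laplace M v @[v --> v0] --> laplace M v0.
  apply: (iffRL (@cvgrPdist_le R R^o V (nbhs v0) (nbhs_filter v0) (laplace M) (laplace M v0))) => e e0.
  exact: near_le.
exact: key.
Unshelve. all: by end_near.
Qed.

Definition dcoef (k : 'I_(n + n + s)) (v : V) (y : Y) : R :=
  match fintype.split k with
  | inl j => hM y * (sg * (psign j * (2 * v ord0 k) / 4))
  | inr j => sg * y.1 ord0 j
  end.

Definition dquad (k : 'I_(n + n + s)) (y : Y) : R :=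
  if fintype.split k is inl j then hM y * (sg * (psign j / 4)) else 0.

(** P being diagonal, [decay] is a quadratic polynomial along each coordinate line: [dcoef] is its
    slope and [dquad] half its second derivative. *)
Lemma decay_line k v y h : decay (v + h *: delta_mx ord0 k) y =
  decay v y + (dcoef k v y * h + dquad k y * h ^+ 2).
Proof.
rewrite -(splitK k) /dcoef /dquad unsplitK; case: (fintype.split k) => j /=.
  by rewrite /decay lsubmx_line_l rsubmx_line_l P_line mxE; field.
rewrite /decay lsubmx_line_r rsubmx_line_r dot_line; ring.
Qed.

Lemma dcoef_line k v y h : dcoef k (v + h *: delta_mx ord0 k) y = dcoef k v y + 2 * (dquad k y * h).
Proof.
rewrite /dcoef /dquad; case: (fintype.split k) => j; last by rewrite mul0r mulr0 addr0.
by rewrite !mxE !eqxx mulr1; field.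
Qed.

Lemma is_derive_decay_line k v y (h : R) :
  is_derive h (1 : R) (fun t : R => decay (v + t *: delta_mx ord0 k) y)
    (dcoef k (v + h *: delta_mx ord0 k) y).
Proof.
under eq_fun do rewrite decay_line.
have d1 := is_derive_mull (dcoef k v y) h.
have d2 := is_deriveX 2 (is_derive_id h (1 : R)).
have d3 := is_derive1_comp (is_derive_mull (dquad k y) _) d2.
have d4 := is_deriveD (is_derive_cst (decay v y) h (1 : R)) (is_deriveD d1 d3).
apply: (is_derive_eq d4); rewrite dcoef_line /GRing.scale /=; ring.
Qed.

Lemma laplace_line M k v : admissible M -> 0 < gap v ->
  is_derive (0 : R) (1 : R) (fun h : R => laplace M (v + h *: delta_mx ord0 k))
    (\int[nu]_y (- (M y * dcoef k v y) * expR (- decay v y))).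
Proof.
move=> aM gv; set e : V := delta_mx ord0 k.
pose del := gap v / 2; have d0 : 0 < del by rewrite divr_gt0.
have gd0 : del < gap v by rewrite /del; lra.
have [r r0 hr] : exists2 r : R, 0 < r & forall h, - r < h < r -> del < gap (v + h *: e).
  have c : gap (v + h *: e) @[h --> (0 : R)] --> gap v.
    have cl : v + h *: e @[h --> (0 : R)] --> v.
      rewrite -[X in _ --> X]addr0 -(scale0r e); apply: cvgD; first exact: cvg_cst.
      by apply: cvgZr_tmp; exact: cvg_id.
    exact: (cvg_comp _ _ cl (cont_gap (x := v))).
  have nb : \forall h \near (0 : R), gap (v + h *: e) > del by exact: (cvgr_gt _ c).
  have /nbhs_ballP[r /= r0 hr] := nb.
  exists r => // h hh; apply: hr; by rewrite /ball /= sub0r normrN ltr_norml.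
have aM2 : admissible (fun y => M y * hM y).
  apply: admissibleM => //; first exact: measurable_hM.
  by move=> y; rewrite ger0_norm ?hM_ge0.
have [G [iG G0 hG]] := laplace_dom aM2 d0.
(* For |h| < r, [dcoef] at v + h e is at most [hM] times this constant: a derivative in x_k
   contributes the coordinate itself, one in z a component of th. *)
pose c := `|v ord0 k| + r + 1.
pose f (h : R) (y : Y) : R[i] := (M y * expR (- decay (v + h *: e) y))%:C.
pose f' (h : R) (y : Y) : R[i] := (- (M y * dcoef k (v + h *: e) y) * expR (- decay (v + h *: e) y))%:C.
have dcoef_le w y : `|dcoef k w y| <= hM y * (`|w ord0 k| + 1).
  have M0 := hM_ge0 y; rewrite /dcoef; case: (fintype.split k) => j.
    rewrite (normrM (hM y)) (ger0_norm M0) ler_wpM2l // normrM (norm_sg sg1) mul1r.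
    have -> : psign j * (2 * w ord0 k) / 4 = psign j * w ord0 k / 2 by field.
    have ps : `|psign j| = 1 by rewrite /psign; case: fintype.split => _; rewrite ?normrN normr1.
    rewrite normrM normrM ps mul1r (ger0_norm (_ : 0 <= 2^-1)) //.
    have := normr_ge0 (w ord0 k); lra.
  rewrite normrM (norm_sg sg1) mul1r; apply: le_trans (eucl_norm_coord _ _) _.
  apply: le_trans (eucl_norm_le_hM y) _; rewrite ler_peMr //.
  by rewrite lerDr.
have bf' h y : - r < h < r -> normc (f' h y) <= c * G y.
  move=> hh; rewrite normc_real normrM normrN normrM.
  have h1 := hG _ y (ltW (hr h hh)); rewrite (normrM (M y * _)) (normrM (M y)) (ger0_norm (hM_ge0 y)) in h1.
  have h2 : `|dcoef k (v + h *: e) y| <= hM y * c.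
    apply: le_trans (dcoef_le _ _) _; rewrite ler_wpM2l ?hM_ge0 // /c lerD2r.
    rewrite !mxE !eqxx mulr1; apply: le_trans (ler_normD _ _) _; rewrite lerD2l.
    by rewrite ler_norml; case/andP: hh => /ltW -> /ltW ->.
  have c0 : 0 <= c by rewrite !addr_ge0 // ltW.
  have h3 := ler_wpM2l c0 h1.
  apply: le_trans h3; set E := `|expR _|.
  rewrite [leRHS](_ : _ = `|M y| * (hM y * c) * E); last by ring.
  apply: ler_wpM2r; first exact: normr_ge0.
  by apply: ler_wpM2l; first exact: normr_ge0.
have If h : - r < h < r -> cintegrable nu (f h).
  move=> hh; have ih := integrable_laplace aM (lt_trans d0 (hr h hh)).
  by split => //; have := integrable_RZ 0 ih; apply: eq_integrable => // y _; rewrite /= mul0r.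
have df h y : - r < h < r -> is_cderive (f^~ y) h (f' h y).
  move=> _; apply: is_cderive_real.
  have d1 := is_derive1_comp (is_derive_mull (-1) _) (is_derive_decay_line k v y h).
  have d2 := is_derive1_comp (is_derive_expR _) d1.
  have d3 := is_derive1_comp (is_derive_mull (M y) _) d2.
  rewrite (_ : (fun t => _) = (fun t : R => M y * expR (-1 * decay (v + t *: e) y))); last first.
    by apply/funext => t; rewrite mulN1r.
  by apply: (is_derive_eq d3); rewrite /= !mulN1r; ring.
have r00 : - r < 0 < r by rewrite oppr_lt0 r0.
have [d _] := is_cderive_cint r00 If df (integrable_RZ c iG) bf'.
apply: (is_derive_eq (d : is_derive (0 : R) (1 : R) (fun h : R => laplace M (v + h *: e)) _)).
by apply: eq_Rintegral => y _; rewrite /f' /= scale0r addr0.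
Qed.

(* A class stable under partial derivatives on [0 < gap], where it consists of
   continuous functions. *)
Inductive good : (V -> R) -> Prop :=
| good_laplace M : admissible M -> good (laplace M)
| good_coord k g : good g -> good (fun v => v ord0 k * g v)
| good_scale c g : good g -> good (fun v => c * g v)
| good_add g h : good g -> good h -> good (fun v => g v + h v).

Lemma is_derive_coord k i (v : V) :
  is_derive v (delta_mx ord0 i) (fun v : V => v ord0 k) (i == k)%:R.
Proof.
apply: is_derive_of_line.
rewrite (_ : (fun t => _) = (fun t : R => v ord0 k + (i == k)%:R * t)); last first.
  by apply/funext => t; rewrite !mxE eqxx eq_sym mulrC.
apply: (is_derive_eq (is_deriveD (is_derive_cst (v ord0 k) (0 : R) (1 : R)) (is_derive_mull _ _))).
by rewrite add0r.
Qed.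

Lemma good_derive g i : good g -> exists2 g', good g' &
  forall v, 0 < gap v -> is_derive v (delta_mx ord0 i) g (g' v).
Proof.
elim => {g} [M aM|k g gg [g' gg' dg]|c g gg [g' gg' dg]|g h gg [g' gg' dg] gh [h' gh' dh]].
- have mM : measurable_fun setT M by case: aM.
  have [j ij|j ij] := fintype.split_ordP i.
    have aM2 : admissible (fun y => M y * hM y).
      apply: admissibleM => //; first exact: measurable_hM.
      by move=> y; rewrite ger0_norm ?hM_ge0.
    exists (fun v : V => - (sg * psign j / 2) * (v ord0 i * laplace (fun y => M y * hM y) v)).
      by apply: good_scale; apply: good_coord; exact: good_laplace.
    move=> v gv; apply: is_derive_of_line.
    apply: (is_derive_eq (laplace_line i aM gv)).
    rewrite /laplace mulrA -RintegralZl //; last exact: integrable_laplace.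
    apply: eq_Rintegral => y _; rewrite /dcoef ij (unsplitK (inl j : 'I_(n + n) + 'I_s)); by field.
  have aM2 : admissible (fun y => M y * y.1 ord0 j).
    apply: admissibleM => //; first by apply: (measurableT_comp (@measurable_coord R s j)); exact: measurable_fst.
    by move=> y; apply: le_trans (eucl_norm_coord _ _) (eucl_norm_le_hM _).
  exists (fun v : V => - sg * laplace (fun y => M y * y.1 ord0 j) v).
    by apply: good_scale; exact: good_laplace.
  move=> v gv; apply: is_derive_of_line.
  apply: (is_derive_eq (laplace_line i aM gv)).
  rewrite /laplace -RintegralZl //; last exact: integrable_laplace.
  apply: eq_Rintegral => y _; rewrite /dcoef ij (unsplitK (inr j : 'I_(n + n) + 'I_s)); ring.
- exists (fun v : V => (i == k)%:R * g v + v ord0 k * g' v).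
    by apply: good_add; [exact: good_scale|exact: good_coord].
  move=> v gv; have d1 := is_derive_coord k i v; have d2 := dg v gv.
  apply: (is_derive_eq (is_deriveM d1 d2)).
  by rewrite /GRing.scale /= addrC [g v * _]mulrC.
- exists (fun v : V => c * g' v); first exact: good_scale.
  by move=> v gv; apply: (is_derive_eq (is_deriveZ c (dg v gv))).
- exists (fun v : V => g' v + h' v); first exact: good_add.
  by move=> v gv; exact: (is_deriveD (dg v gv) (dh v gv)).
Qed.

Lemma good_continuous g v : good g -> 0 < gap v -> {for v, continuous g}.
Proof.
move=> gg gv; elim: gg => {g} [M aM|k g _ cg|c g _ cg|g h _ cg _ ch].
- exact: laplace_continuous.
- exact: (cvgM (@coord_continuous_rV R _ k v) cg).
- exact: (cvgM (@cst_continuous V R c v) cg).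
- exact: (cvgD cg ch).
Qed.

(** Each iterated partial derivative agrees with good functions only where [gap] is positive; that
    set being open, the agreement can be differentiated once more. *)
Lemma smooth_good gr gi : good gr -> good gi ->
  smooth_on [set v | 0 < gap v] (fun v => gr v +i* gi v).
Proof.
move=> ggr ggi.
have key l : exists hr hi, [/\ good hr, good hi &
    forall v, 0 < gap v -> partials l (fun v => gr v +i* gi v) v = hr v +i* hi v].
  elim: l => [|i l [hr [hi [gh gh' e]]]]; first by exists gr, gi.
  have [dr gdr hdr] := good_derive i gh; have [di gdi hdi] := good_derive i gh'.
  exists dr, di; split => // v gv.
  have nv : \forall w \near v, 0 < gap w := open_nbhs_nbhs (conj open_gap gv).
  rewrite /= /partial.
  have er : \forall w \near v, (Re \o partials l (fun v => gr v +i* gi v)) w = hr w.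
    by apply: filterS nv => w gw; rewrite /comp e.
  have ei : \forall w \near v, (Im \o partials l (fun v => gr v +i* gi v)) w = hi w.
    by apply: filterS nv => w gw; rewrite /comp e.
  by rewrite (near_eq_derive _ er) (near_eq_derive _ ei); case: (hdr v gv) => _ ->; case: (hdi v gv) => _ ->.
move=> l v gv; have [hr [hi [gh gh' e]]] := key l.
have nv : \forall w \near v, 0 < gap w := open_nbhs_nbhs (conj open_gap gv).
have er : \forall w \near v, hr w = (Re \o partials l (fun v => gr v +i* gi v)) w.
  by apply: filterS nv => w gw; rewrite /comp e.
have ei : \forall w \near v, hi w = (Im \o partials l (fun v => gr v +i* gi v)) w.
  by apply: filterS nv => w gw; rewrite /comp e.
split.
- have c : hr w @[w --> v] --> hr v := good_continuous gh gv.
  have E : (Re \o partials l (fun v => gr v +i* gi v)) v = hr v by rewrite /comp e.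
  rewrite -E in c; exact: cvg_trans (near_eq_cvg er) c.
- have c : hi w @[w --> v] --> hi v := good_continuous gh' gv.
  have E : (Im \o partials l (fun v => gr v +i* gi v)) v = hi v by rewrite /comp e.
  rewrite -E in c; exact: cvg_trans (near_eq_cvg ei) c.
- move=> i; have [dr _ hdr] := good_derive i gh; have [di _ hdi] := good_derive i gh'.
  split; first by apply: near_eq_derivable er _; case: (hdr v gv).
  by apply: near_eq_derivable ei _; case: (hdi v gv).
Qed.

Lemma kern_laplace v : kern sg 0 v = (laplace (fun y => hw n y) v)%:C.
Proof.
transitivity (cint nu (fun y : Y => (hw n y * expR (- decay v y))%:C)).
  apply: eq_cint => y; rewrite (_ : vphase sg 0 v y = (decay v y)%:C).
    by rewrite -rmorphN cexp_real -rmorphM.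
  by apply: complexP => //=; rewrite !mul0r mulr0 mulr0 oppr0.
apply: complexP => //=.
by rewrite /Rintegral integral0.
Qed.

Lemma smooth_kern (c : R[i]) : smooth_on [set v | 0 < gap v] (fun v => c * kern sg 0 v).
Proof.
have := smooth_good (good_scale (Re c) (good_laplace admissible_hw)) (good_scale (Im c) (good_laplace admissible_hw)).
rewrite (_ : (fun v => _ +i* _) = (fun v => c * kern sg 0 v)) //.
apply/funext => v; rewrite kern_laplace; apply: complexP; rewrite ?ReM ?ImM /=; ring.
Qed.

End kernel_smooth.

(** * From the kernel formula to the singular support *)

Section conclusion.
Context {R : realType}.
Variables n s : nat.
Hypotheses (n1 : (1 <= n)%N) (s1 : (1 <= s)%N).
Local Notation V := ('rV[R]_(n + n + s)).

(** Compactness of the support of the test function supplies the uniform margin del on which the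
    estimates for the kernel rest. *)
Lemma compact_gap_min (sg : R) (A : set V) : compact A -> A `<=` [set v | 0 < gap sg v] ->
  exists2 del : R, 0 < del & forall v, A v -> del <= gap sg v.
Proof.
move=> cA AU; have [->|A0] := eqVneq A set0; first by exists 1.
have cg : {within A, continuous (gap sg)} by apply: continuous_subspaceT => v; exact: cont_gap.
have [c cin h] := @compact_EVT_min V R (gap sg) A (proj1 (set0P A) A0) cA cg.
exists (gap sg c) => [|v Av]; first by apply: AU; exact: set_mem.
by apply: h; exact: mem_set.
Qed.

Lemma K0s_smooth_on_gap (sg : R) : sg ^+ 2 = 1 ->
  smooth_distribution_on (@K0s R n s) [set v | 0 < gap sg v].
Proof.
move=> sg1; exists (fun v => kcst n s sg * kern sg 0 v); first exact: smooth_kern.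
move=> phi cphi sphi; have tphi : test_fun phi by split => //; exact: (schwartz_smooth phi).
have [del d0 hd] := compact_gap_min cphi sphi.
rewrite (K0s_kern n1 s1 tphi sg1 d0 _ (erefl _)); last first.
  move=> v fv; have tv : tsupport phi v by apply: subset_closure.
  by have := hd v tv; rewrite /gap; lra.
rewrite cintegral_indic; apply: eq_cint => v; rewrite indicE.
have [vin|vnin] := boolP (v \in _); first by rewrite mul1r.
rewrite mul0r; have -> : phi v = 0; last by rewrite mulr0.
by apply: tsupport_notin => /sphi /mem_set; apply/negP.
Qed.

End conclusion.

Theorem theorem8p1 (R : realType) (n s : nat) (hn : (1 <= n)%N)
    (hs : (1 <= s)%N) :
  singular_support (@K0s R n s) `<=`
  [set w : 'rV[R]_(n + n + s) |
    `|P (lsubmx w)| <= 4 * eucl_norm (rsubmx w)].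
Proof.
move=> w nw /=; rewrite leNgt; apply/negP => hw; apply: nw.
have [sg sg1 hsg] : exists2 sg : R, sg ^+ 2 = 1 & sg * P (lsubmx w) = `|P (lsubmx w)|.
  have [h|h] := leP 0 (P (lsubmx w)).
    by exists 1; rewrite ?expr1n // mul1r ger0_norm.
  by exists (-1); rewrite ?sqrrN ?expr1n // mulN1r ltr0_norm.
exists [set v | 0 < gap sg v]; last by rewrite /= /gap mulrA hsg; lra.
by split; [exact: open_gap|exact: K0s_smooth_on_gap].
Qed.
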